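(* Let $a>0$, $\operatorname{Re}(b)\le1$ and let $z$ be complex with $\operatorname{Re}\left(z^{\frac1a}\right)>0$. Then $$\int_{0}^{\infty}\frac{z^{u}}{\Gamma(b+au)}\,du=\frac{z^{\frac{1-b}{a}}}{a}\left\{e^{z^{\frac1a}}+\int_{0}^{\infty}\frac{e^{-z^{\frac1a}x}}{x^{b}}\left(\frac{\frac{\sin b\pi}{\pi}\ln x+\cos b\pi}{\pi^{2}+(\ln x)^{2}}\right)dx\right\}.$$
   Context: $1/\Gamma$ is the entire reciprocal Gamma function. Powers of $z$ are $z^{c}=e^{c\log z}$ with $\arg z\in[-\pi,\pi]$.
   Formalization: The formal theorem also assumes that the argument of z^{1/a}, namely arg(z)/a, lies in [-π,π] (automatic for a≥2/3); without this the claim fails, e.g. for a=1/2, b=0, z=-1 with arg z=π. *)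

(* Defs.v *)
From Stdlib Require Import Reals ZArith.
From Coquelicot Require Import Coquelicot.

Open Scope R_scope.

Definition Cexp (w : C) : C := (exp (Re w) * cos (Im w), exp (Re w) * sin (Im w)).

Definition Csin (w : C) : C := ((Cexp (Ci * w) - Cexp (- (Ci * w))) / (2 * Ci))%C.

Definition Ccos (w : C) : C := ((Cexp (Ci * w) + Cexp (- (Ci * w))) / 2)%C.

(** The argument ranges over the closed interval [-PI, PI], so a negative real [z] has two
    admissible logarithms. *)
Definition is_log (z w : C) : Prop := Cexp w = z /\ - PI <= Im w <= PI.

(** The power [z ^ c], where the branch is given by [logz], a logarithm of [z].  The identity
    [(z ^ (1 / a)) ^ c = z ^ (c / a)] respects the range of arguments only if
    [Im logz / a], the argument of [z ^ (1 / a)], lies in [-PI, PI]; for [a < 2 / 3] this does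
    not follow from [0 < Re (z ^ (1 / a))]. *)
Definition Cpower (logz c : C) : C := Cexp (c * logz).

(** Complex-valued improper Riemann integrals.  They may converge only conditionally: this
    happens at [x = 0] in the integral of [kernel] below when [Re b = 1] and [b <> 1]. *)
Definition ex_CInt_gen (f : R -> C) (Fa Fb : (R -> Prop) -> Prop) : Prop :=
  ex_RInt_gen (V := C_R_CompleteNormedModule) f Fa Fb.

Definition CInt_gen (f : R -> C) (Fa Fb : (R -> Prop) -> Prop) : C :=
  RInt_gen (V := C_R_CompleteNormedModule) f Fa Fb.

(** Euler's integral, meaningful for [0 < Re s]. *)
Definition CGamma (s : C) : C :=
  CInt_gen (fun t => (Cpower (ln t) (s - 1) * exp (- t))%C)
    (at_right 0) (Rbar_locally p_infty).

(** [n] applications of [1 / Gamma s = s * (1 / Gamma (s + 1))]. *)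
Fixpoint rGamma_shift (n : nat) (s : C) : C :=
  match n with
  | O => (/ CGamma s)%C
  | S m => (s * rGamma_shift m (s + 1))%C
  end.

(** The entire function [1 / Gamma].  Since [r < IZR (up r)], the number of shifts [n] satisfies
    [0 < Re s + n], so Euler's integral is only used in its half-plane of convergence. *)
Definition rGamma (s : C) : C := rGamma_shift (Z.to_nat (up (- Re s))) s.

(** The integrand on the right-hand side, with [s] standing for [z ^ (1 / a)]. *)
Definition kernel (b s : C) (x : R) : C :=
  (Cexp (- s * x) / Cpower (ln x) b
   * ((Csin (b * PI) / PI * ln x + Ccos (b * PI)) / (PI ^ 2 + ln x ^ 2)))%C.

(* Main.v *)
Require Import Defs.
From Stdlib Require Import Reals ZArith Lra Lia.
From Coquelicot Require Import Coquelicot.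

(** With [L = log z / a] and [S = e^L = z^(1/a)], the hypotheses force [|Im L| < PI / 2], and
    [v = a u] turns the left-hand side into the integral of [e^(L v) / Gamma(b + v)] over
    [v >= 0].  Put [Q(c) = Gamma(c, S) / Gamma(c)].  Integration by parts gives
    [Q(c + 1) - Q(c) = S^c e^(-S) / Gamma(c + 1)], so the integral telescopes: since
    [Q(b + v)] tends to [1] as [v] grows, it equals [S^(1 - b) e^S (1 - I)], where [I] is the
    integral of [Q(b - 1 + v)] over [0 <= v <= 1].  By the reflection formula,
    [Q(1 - w) = sin(PI w) / PI * \int_0^oo e^(- S (1 + x)) x^(w - 1) / (1 + x) dx] for
    [Re w > 0].  Take [w = 2 - b - v] and integrate in [v] first: the integral of
    [sin(PI w) x^(w - 1)] over [0 <= v <= 1] is elementary and produces the kernel of the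
    right-hand side, which therefore integrates to [- e^S I].

    The reflection formula reduces to the integral of [2 cosh(u y) / (1 + cosh y)] over
    [y >= 0], which is evaluated by Green's identity against the Poisson kernel of a strip.
    All Gamma integrals are taken in the logarithmic variable [y = ln t], where the integrands
    are entire and decay exponentially, and rotating the ray of integration is a shift of
    [y]. *)

Local Open Scope R_scope.

Local Notation is_Cderive := (is_derive (K := R_AbsRing) (V := C_R_NormedModule)).
Local Notation is_CInt := (is_RInt (V := C_R_NormedModule)).

(** Contour integration is replaced by a real argument: two integrals along parallel lines are
    compared through a closed form on a rectangle whose far side contributes nothing in the limit.
    The rotation of a ray and Green's identity are both instances. Every interchange of limits rests
    on an explicit bound [K e^(- eta y)], uniform in the parameter.

    The obstacle is the case [Re b = 1]. At [v = 1] the exponent [w] then has real part zero, the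
    integral for [Q(1 - w)] no longer converges at [x = 0], and no exponential bound is uniform in
    [v]. Two facts repair this: [sin(PI w)] is [O(|w|)], and, by parts, [w] times the part of the
    integral over [x < e^(-Y)] is [O(e^(- Re w Y))]. Integrating that over [v] leaves [O(1 / Y)],
    which suffices.

    The strip of the Poisson kernel is used only up to a height [t0 < PI], because [cosh y + cos t]
    vanishes at [(0, PI)]; the limit [t0 -> PI] is a separate estimate. *)

Definition CInt (f : R -> C) (a b : R) : C := RInt (V := C_R_CompleteNormedModule) f a b.
Local Notation Clocally := (locally (T := C_UniformSpace)).

(** * Complex-valued functions of a real variable *)

Lemma continuous_C {T : UniformSpace} (f : T -> C) (x : T) :
  continuous (fun t => Re (f t)) x -> continuous (fun t => Im (f t)) x ->
  continuous (U := C_UniformSpace) f x.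
Proof.
intros h1 h2 P [e HP]. unfold filtermap.
assert (a1 : locally x (fun t => ball (Re (f x)) e (Re (f t))))
  by (apply (h1 (ball (Re (f x)) e)), locally_ball).
assert (a2 : locally x (fun t => ball (Im (f x)) e (Im (f t))))
  by (apply (h2 (ball (Im (f x)) e)), locally_ball).
generalize (filter_and _ _ a1 a2). apply filter_imp.
intros t [a b]. apply HP. split; assumption.
Qed.

Lemma continuous_Re {T : UniformSpace} (f : T -> C) (x : T) :
  continuous (U := C_UniformSpace) f x -> continuous (fun t => Re (f t)) x.
Proof. intros h. exact (continuous_comp f (@fst R R) x h (continuous_fst _ _)). Qed.

Lemma continuous_Im {T : UniformSpace} (f : T -> C) (x : T) :
  continuous (U := C_UniformSpace) f x -> continuous (fun t => Im (f t)) x.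
Proof. intros h. exact (continuous_comp f (@snd R R) x h (continuous_snd _ _)). Qed.

Lemma continuous_Cplus {T : UniformSpace} (f g : T -> C) (x : T) :
  continuous (U := C_UniformSpace) f x -> continuous (U := C_UniformSpace) g x ->
  continuous (U := C_UniformSpace) (fun t => f t + g t)%C x.
Proof. intros hf hg. exact (continuous_plus (V := C_R_NormedModule) f g x hf hg). Qed.

Lemma continuous_Copp {T : UniformSpace} (f : T -> C) (x : T) :
  continuous (U := C_UniformSpace) f x ->
  continuous (U := C_UniformSpace) (fun t => - f t)%C x.
Proof. intros hf. exact (continuous_opp (V := C_R_NormedModule) f x hf). Qed.

Lemma continuous_Cminus {T : UniformSpace} (f g : T -> C) (x : T) :
  continuous (U := C_UniformSpace) f x -> continuous (U := C_UniformSpace) g x ->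
  continuous (U := C_UniformSpace) (fun t => f t - g t)%C x.
Proof. intros hf hg. apply continuous_Cplus; [|apply continuous_Copp]; assumption. Qed.

Lemma continuous_Rmult {T : UniformSpace} (f g : T -> R) (x : T) :
  continuous f x -> continuous g x -> continuous (fun t => f t * g t) x.
Proof. intros hf hg. exact (continuous_mult (K := R_AbsRing) f g x hf hg). Qed.

Lemma continuous_Rplus {T : UniformSpace} (f g : T -> R) (x : T) :
  continuous f x -> continuous g x -> continuous (fun t => f t + g t) x.
Proof. intros hf hg. exact (continuous_plus (V := R_NormedModule) f g x hf hg). Qed.

Lemma continuous_Ropp {T : UniformSpace} (f : T -> R) (x : T) :
  continuous f x -> continuous (fun t => - f t) x.
Proof. intros hf. exact (continuous_opp (V := R_NormedModule) f x hf). Qed.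

Lemma continuous_Rminus {T : UniformSpace} (f g : T -> R) (x : T) :
  continuous f x -> continuous g x -> continuous (fun t => f t - g t) x.
Proof. intros hf hg. apply continuous_Rplus; [|apply continuous_Ropp]; assumption. Qed.

Lemma continuous_Rinv {T : UniformSpace} (f : T -> R) (x : T) :
  continuous f x -> f x <> 0 -> continuous (fun t => / f t) x.
Proof.
intros hf h0. apply (continuous_comp f Rinv x hf).
apply continuity_pt_filterlim, continuity_pt_inv with (f := fun y : R => y);
  [apply continuity_pt_id | exact h0].
Qed.

Lemma continuous_Cmult {T : UniformSpace} (f g : T -> C) (x : T) :
  continuous (U := C_UniformSpace) f x -> continuous (U := C_UniformSpace) g x ->
  continuous (U := C_UniformSpace) (fun t => f t * g t)%C x.
Proof.
intros hf hg.
apply continuous_C; simpl; [apply continuous_Rminus | apply continuous_Rplus];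
apply continuous_Rmult; first [apply (continuous_Re f x) | apply (continuous_Re g x)
  | apply (continuous_Im f x) | apply (continuous_Im g x)]; assumption.
Qed.

Lemma continuous_RtoC {T : UniformSpace} (f : T -> R) (x : T) :
  continuous f x -> continuous (U := C_UniformSpace) (fun t => RtoC (f t)) x.
Proof. intros hf. apply continuous_C; simpl; [exact hf | apply continuous_const]. Qed.

Lemma continuous_Rcomp {T : UniformSpace} (g : R -> R) (f : T -> R) (x : T) :
  (forall y, continuity_pt g y) -> continuous f x -> continuous (fun t => g (f t)) x.
Proof.
intros hg hf. apply (continuous_comp f g x hf). apply continuity_pt_filterlim, hg.
Qed.

Lemma continuous_Rexp {T : UniformSpace} (f : T -> R) (x : T) :
  continuous f x -> continuous (fun t => exp (f t)) x.
Proof.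
apply continuous_Rcomp. intros y. apply derivable_continuous_pt, derivable_pt_exp.
Qed.

Lemma continuous_Cexp {T : UniformSpace} (f : T -> C) (x : T) :
  continuous (U := C_UniformSpace) f x ->
  continuous (U := C_UniformSpace) (fun t => Cexp (f t)) x.
Proof.
intros hf.
pose proof (continuous_Rexp _ _ (continuous_Re _ _ hf)).
pose proof (continuous_Im _ _ hf) as hI.
apply continuous_C; simpl; apply continuous_Rmult; try assumption.
- apply continuous_Rcomp; [apply continuity_cos | exact hI].
- apply continuous_Rcomp; [apply continuity_sin | exact hI].
Qed.

Lemma C_neq_0_sqr (z : C) : z <> 0%C -> 0 < Re z ^ 2 + Im z ^ 2.
Proof.
intros hz. destruct z as [p q]; unfold Re, Im; cbn [fst snd].
destruct (Req_dec p 0) as [-> | hp].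
- destruct (Req_dec q 0) as [-> | hq]; [now elim hz | ].
  pose proof (pow2_gt_0 q hq). lra.
- pose proof (pow2_gt_0 p hp). pose proof (pow2_ge_0 q). lra.
Qed.

Lemma continuous_Cinv {T : UniformSpace} (f : T -> C) (x : T) :
  continuous (U := C_UniformSpace) f x -> f x <> 0%C ->
  continuous (U := C_UniformSpace) (fun t => / f t)%C x.
Proof.
intros hf h0.
pose proof (continuous_Re _ _ hf) as hR.
pose proof (continuous_Im _ _ hf) as hI.
assert (hn : continuous (fun t => / (Re (f t) ^ 2 + Im (f t) ^ 2)) x).
{ apply continuous_Rinv.
  - simpl. apply continuous_Rplus; repeat apply continuous_Rmult; try assumption;
      apply continuous_const.
  - apply Rgt_not_eq, C_neq_0_sqr, h0. }
apply continuous_C; unfold Cinv, Rdiv; cbn [Re Im fst snd];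
  apply continuous_Rmult; try apply continuous_Ropp; assumption.
Qed.

(** For [a <= b], composition with [clamp a b] extends a function continuously from [[a, b]] to the
    line. Lemmas that ask for continuity or bounds everywhere then apply to integrands controlled
    only on an interval. *)
Definition clamp (a b c : R) : R := Rmax a (Rmin b c).

Lemma clamp_in (a b c : R) : a <= b -> a <= clamp a b c <= b.
Proof.
intros h. unfold clamp. split; [apply Rmax_l |]. apply Rmax_lub; [exact h | apply Rmin_l].
Qed.

Lemma clamp_id (a b c : R) : a <= c <= b -> clamp a b c = c.
Proof. intros h. unfold clamp. rewrite Rmin_right, Rmax_right; lra. Qed.

Lemma continuous_clamp {T : UniformSpace} (a b : R) (f : T -> R) (x : T) :
  continuous f x -> continuous (fun t => clamp a b (f t)) x.
Proof.
intros hf. apply (continuous_comp f (clamp a b) x hf).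
apply filterlim_locally. intros eps. exists eps. intros y hy.
unfold ball in *; simpl in *; unfold AbsRing_ball, abs, minus, plus, opp in *; simpl in *.
eapply Rle_lt_trans; [| exact hy].
unfold clamp, Rmax, Rmin. repeat destruct Rle_dec; unfold Rabs; repeat destruct Rcase_abs; lra.
Qed.

(** The goals that it leaves are the nonvanishing conditions of the inverses. *)
Ltac solve_continuous := repeat (cbv beta; lazymatch goal with
  | |- @continuous _ _ (fun _ => ?c) _ => apply continuous_const
  | |- @continuous _ _ (fun x => x) _ => apply continuous_id
  | |- @continuous _ _ (fun x => fst x) _ => exact (continuous_fst _ _)
  | |- @continuous _ _ (fun x => snd x) _ => exact (continuous_snd _ _)
  | |- @continuous _ _ (fun x => RtoC (@?f x)) _ => apply (continuous_RtoC f)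
  | |- @continuous _ _ (fun x => Cexp (@?f x)) _ => apply (continuous_Cexp f)
  | |- @continuous _ _ (fun x => exp (@?f x)) _ => apply (continuous_Rexp f)
  | |- @continuous _ _ (fun x => clamp _ _ (@?f x)) _ => apply (continuous_clamp _ _ f)
  | |- @continuous _ _ (fun x => Cplus (@?f x) (@?g x)) _ => apply (continuous_Cplus f g)
  | |- @continuous _ _ (fun x => Cminus (@?f x) (@?g x)) _ => apply (continuous_Cminus f g)
  | |- @continuous _ _ (fun x => Cmult (@?f x) (@?g x)) _ => apply (continuous_Cmult f g)
  | |- @continuous _ _ (fun x => Copp (@?f x)) _ => apply (continuous_Copp f)
  | |- @continuous _ _ (fun x => Cinv (@?f x)) _ => apply (continuous_Cinv f)
  | |- @continuous _ _ (fun x => Rplus (@?f x) (@?g x)) _ => apply (continuous_Rplus f g)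
  | |- @continuous _ _ (fun x => Rminus (@?f x) (@?g x)) _ => apply (continuous_Rminus f g)
  | |- @continuous _ _ (fun x => Rmult (@?f x) (@?g x)) _ => apply (continuous_Rmult f g)
  | |- @continuous _ _ (fun x => Ropp (@?f x)) _ => apply (continuous_Ropp f)
  | |- @continuous _ _ (fun x => Rinv (@?f x)) _ => apply (continuous_Rinv f)
  | |- @continuous _ _ (fun x => sin (@?f x)) _ => apply (continuous_Rcomp sin f);
    [exact continuity_sin |]
  | |- @continuous _ _ (fun x => cos (@?f x)) _ => apply (continuous_Rcomp cos f);
    [exact continuity_cos |]
  | |- @continuous _ _ Ropp _ => apply (continuous_Ropp (fun x => x))
  | _ => first [assumption | exact (continuous_fst _ _) | exact (continuous_snd _ _)]
  end).

(** * Derivatives of complex-valued functions *)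

Lemma is_Cderive_C (f : R -> C) (x : R) (l : C) :
  is_derive (fun t => Re (f t)) x (Re l) -> is_derive (fun t => Im (f t)) x (Im l) ->
  is_Cderive f x l.
Proof.
intros h1 h2.
pose proof (filterdiff_comp_2 (K := R_AbsRing) (T := R_NormedModule) (U := R_NormedModule)
  (V := R_NormedModule) (W := C_R_NormedModule) (F := locally x)
  (fun t => Re (f t)) (fun t => Im (f t)) (fun a b => (a, b))
  (fun y => scal y (Re l)) (fun y => scal y (Im l)) (fun a b => (a, b)) h1 h2) as H.
unfold is_derive.
eapply filterdiff_ext_lin.
- eapply filterdiff_ext.
  2: apply H. intros y; simpl. now destruct (f y).
  apply filterdiff_ext with (f := fun t : R * R => t); [now intros [] |].
  eapply filterdiff_ext_lin. apply filterdiff_id. now intros [].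
- intros y. now destruct l.
Qed.

Lemma is_derive_Re (f : R -> C) (x : R) (l : C) :
  is_Cderive f x l -> is_derive (fun t => Re (f t)) x (Re l).
Proof.
intros h. unfold is_derive in *.
apply (filterdiff_comp' (V := C_R_NormedModule) f (fun z => Re z) x _ (fun z => Re z)) in h.
- exact h.
- apply (filterdiff_linear (U := C_R_NormedModule) (V := R_NormedModule)).
  apply is_linear_fst.
Qed.

Lemma is_derive_Im (f : R -> C) (x : R) (l : C) :
  is_Cderive f x l -> is_derive (fun t => Im (f t)) x (Im l).
Proof.
intros h. unfold is_derive in *.
apply (filterdiff_comp' (V := C_R_NormedModule) f (fun z => Im z) x _ (fun z => Im z)) in h.
- exact h.
- apply (filterdiff_linear (U := C_R_NormedModule) (V := R_NormedModule)).
  apply is_linear_snd.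
Qed.

Lemma is_Cderive_const (c : C) (x : R) : is_Cderive (fun _ => c) x (RtoC 0).
Proof. exact (is_derive_const (V := C_R_NormedModule) c x). Qed.

Lemma is_Cderive_RtoC (f : R -> R) (x l : R) :
  is_derive f x l -> is_Cderive (fun t => RtoC (f t)) x (RtoC l).
Proof. intros h. apply is_Cderive_C; simpl; [exact h | exact (is_derive_const 0 x)]. Qed.

Lemma is_Cderive_plus (f g : R -> C) (x : R) (l m : C) :
  is_Cderive f x l -> is_Cderive g x m -> is_Cderive (fun t => f t + g t)%C x (l + m)%C.
Proof. exact (is_derive_plus (V := C_R_NormedModule) f g x l m). Qed.

Lemma is_Cderive_opp (f : R -> C) (x : R) (l : C) :
  is_Cderive f x l -> is_Cderive (fun t => - f t)%C x (- l)%C.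
Proof. exact (is_derive_opp (V := C_R_NormedModule) f x l). Qed.

Lemma is_Cderive_minus (f g : R -> C) (x : R) (l m : C) :
  is_Cderive f x l -> is_Cderive g x m -> is_Cderive (fun t => f t - g t)%C x (l - m)%C.
Proof. exact (is_derive_minus (V := C_R_NormedModule) f g x l m). Qed.

Lemma is_derive_Rmult (f g : R -> R) (x l m : R) :
  is_derive f x l -> is_derive g x m -> is_derive (fun t => f t * g t) x (l * g x + f x * m).
Proof.
intros hf hg.
exact (is_derive_mult (K := R_AbsRing) f g x l m hf hg Rmult_comm).
Qed.

Lemma is_Cderive_mult (f g : R -> C) (x : R) (l m : C) :
  is_Cderive f x l -> is_Cderive g x m ->
  is_Cderive (fun t => f t * g t)%C x (l * g x + f x * m)%C.
Proof.
intros hf hg.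
pose proof (is_derive_Re _ _ _ hf) as f1. pose proof (is_derive_Im _ _ _ hf) as f2.
pose proof (is_derive_Re _ _ _ hg) as g1. pose proof (is_derive_Im _ _ _ hg) as g2.
apply is_Cderive_C.
- eapply is_derive_ext; [intros t; reflexivity |].
  replace (Re (l * g x + f x * m)) with
    ((Re l * Re (g x) + Re (f x) * Re m) - (Im l * Im (g x) + Im (f x) * Im m))
    by (unfold Cmult, Cplus, Re, Im; simpl; ring).
  apply (is_derive_minus (V := R_NormedModule) (fun t => Re (f t) * Re (g t)) (fun t => Im (f t) *
    Im (g t)));
    apply is_derive_Rmult; assumption.
- replace (Im (l * g x + f x * m)) with
    ((Re l * Im (g x) + Re (f x) * Im m) + (Im l * Re (g x) + Im (f x) * Re m))
    by (unfold Cmult, Cplus, Re, Im; simpl; ring).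
  apply (is_derive_plus (V := R_NormedModule) (fun t => Re (f t) * Im (g t)) (fun t => Im (f t) *
    Re (g t)));
    apply is_derive_Rmult; assumption.
Qed.

Lemma is_Cderive_Cexp (f : R -> C) (x : R) (l : C) :
  is_Cderive f x l -> is_Cderive (fun t => Cexp (f t)) x (l * Cexp (f x))%C.
Proof.
intros hf.
pose proof (is_derive_Re _ _ _ hf) as f1. pose proof (is_derive_Im _ _ _ hf) as f2.
assert (he : is_derive (fun t => exp (Re (f t))) x (Re l * exp (Re (f x)))).
{ apply (is_derive_comp exp (fun t => Re (f t))); [apply is_derive_exp | exact f1]. }
assert (hc : is_derive (fun t => cos (Im (f t))) x (Im l * - sin (Im (f x)))).
{ apply (is_derive_comp cos (fun t => Im (f t))); [apply is_derive_cos | exact f2]. }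
assert (hs : is_derive (fun t => sin (Im (f t))) x (Im l * cos (Im (f x)))).
{ apply (is_derive_comp sin (fun t => Im (f t))); [apply is_derive_sin | exact f2]. }
apply is_Cderive_C.
- replace (Re (l * Cexp (f x)))
   with (Re l * exp (Re (f x)) * cos (Im (f x)) + exp (Re (f x)) * (Im l * - sin (Im (f x))))
   by (unfold Cexp, Cmult, Re, Im; simpl; ring).
  exact (is_derive_Rmult _ _ _ _ _ he hc).
- replace (Im (l * Cexp (f x)))
   with (Re l * exp (Re (f x)) * sin (Im (f x)) + exp (Re (f x)) * (Im l * cos (Im (f x))))
   by (unfold Cexp, Cmult, Re, Im; simpl; ring).
  exact (is_derive_Rmult _ _ _ _ _ he hs).
Qed.

(** * The complex exponential *)

Lemma Cexp_plus (z w : C) : Cexp (z + w) = (Cexp z * Cexp w)%C.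
Proof.
unfold Cexp, Cmult, Cplus, Re, Im; cbn [fst snd].
rewrite exp_plus, cos_plus, sin_plus. f_equal; ring.
Qed.

Lemma Cexp_RtoC (x : R) : Cexp x = RtoC (exp x).
Proof. unfold Cexp, RtoC; cbn [Re Im fst snd]. rewrite cos_0, sin_0. f_equal; ring. Qed.

Lemma Cexp_0 : Cexp 0 = 1%C.
Proof. rewrite Cexp_RtoC. now rewrite exp_0. Qed.

Lemma Cexp_neq_0 (z : C) : Cexp z <> 0%C.
Proof.
intros h. assert (h1 : (Cexp z * Cexp (- z))%C = 1%C).
{ rewrite <- Cexp_plus, Cplus_opp_r. apply Cexp_0. }
rewrite h, Cmult_0_l in h1. injection h1. lra.
Qed.

Lemma Cexp_opp (z : C) : Cexp (- z) = (/ Cexp z)%C.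
Proof.
assert (h1 : (Cexp z * Cexp (- z))%C = 1%C).
{ rewrite <- Cexp_plus, Cplus_opp_r. apply Cexp_0. }
pose proof (Cexp_neq_0 z).
rewrite <- (Cmult_1_l (/ Cexp z)), <- h1. field. assumption.
Qed.

Lemma Cmod_Cexp (z : C) : Cmod (Cexp z) = exp (Re z).
Proof.
unfold Cmod, Cexp; cbn [fst snd].
replace ((exp (Re z) * cos (Im z)) ^ 2 + (exp (Re z) * sin (Im z)) ^ 2)
  with (exp (Re z) ^ 2 * (Rsqr (sin (Im z)) + Rsqr (cos (Im z)))) by (unfold Rsqr; ring).
rewrite sin2_cos2, Rmult_1_r. apply sqrt_pow2, Rlt_le, exp_pos.
Qed.

(** * Complex integrals over a compact interval *)

Lemma is_CInt_continuous (f : R -> C) (a b : R) :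
  (forall y, continuous (U := C_UniformSpace) f y) -> is_CInt f a b (CInt f a b).
Proof.
intros hf. apply (RInt_correct (V := C_R_CompleteNormedModule)).
apply (ex_RInt_continuous (V := C_R_CompleteNormedModule)). intros; apply hf.
Qed.

Lemma is_CInt_unique (f : R -> C) (a b : R) (l : C) : is_CInt f a b l -> CInt f a b = l.
Proof. exact (is_RInt_unique (V := C_R_CompleteNormedModule) f a b l). Qed.

Lemma CInt_ext (f g : R -> C) (a b : R) :
  (forall x, Rmin a b < x < Rmax a b -> f x = g x) -> CInt f a b = CInt g a b.
Proof. exact (RInt_ext (V := C_R_CompleteNormedModule) f g a b). Qed.

Lemma CInt_point (f : R -> C) (a : R) : CInt f a a = 0%C.
Proof. exact (RInt_point (V := C_R_CompleteNormedModule) a f). Qed.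

Lemma is_CInt_pair (f : R -> C) (a b : R) (l : C) :
  is_RInt (fun t => Re (f t)) a b (Re l) -> is_RInt (fun t => Im (f t)) a b (Im l) ->
  is_CInt f a b l.
Proof.
intros h1 h2. destruct l as [l1 l2].
exact (is_RInt_fct_extend_pair (U := R_NormedModule) (V := R_NormedModule) f a b l1 l2 h1 h2).
Qed.

Lemma is_RInt_Re (f : R -> C) (a b : R) (l : C) :
  is_CInt f a b l -> is_RInt (fun t => Re (f t)) a b (Re l).
Proof. exact (is_RInt_fct_extend_fst (U := R_NormedModule) (V := R_NormedModule) f a b l). Qed.

Lemma is_RInt_Im (f : R -> C) (a b : R) (l : C) :
  is_CInt f a b l -> is_RInt (fun t => Im (f t)) a b (Im l).
Proof. exact (is_RInt_fct_extend_snd (U := R_NormedModule) (V := R_NormedModule) f a b l). Qed.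

Lemma is_CInt_scal (k : C) (f : R -> C) (a b : R) (l : C) :
  is_CInt f a b l -> is_CInt (fun t => k * f t)%C a b (k * l)%C.
Proof.
intros h. pose proof (is_RInt_Re _ _ _ _ h) as h1. pose proof (is_RInt_Im _ _ _ _ h) as h2.
apply is_CInt_pair; simpl.
- exact (is_RInt_minus (V := R_NormedModule) _ _ _ _ _ _
    (is_RInt_scal (V := R_NormedModule) _ _ _ (Re k) _ h1)
    (is_RInt_scal (V := R_NormedModule) _ _ _ (Im k) _ h2)).
- exact (is_RInt_plus (V := R_NormedModule) _ _ _ _ _ _
    (is_RInt_scal (V := R_NormedModule) _ _ _ (Re k) _ h2)
    (is_RInt_scal (V := R_NormedModule) _ _ _ (Im k) _ h1)).
Qed.

Lemma is_CInt_plus (f g : R -> C) (a b : R) (l m : C) :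
  is_CInt f a b l -> is_CInt g a b m -> is_CInt (fun t => f t + g t)%C a b (l + m)%C.
Proof. exact (is_RInt_plus (V := C_R_NormedModule) f g a b l m). Qed.

Lemma is_CInt_minus (f g : R -> C) (a b : R) (l m : C) :
  is_CInt f a b l -> is_CInt g a b m -> is_CInt (fun t => f t - g t)%C a b (l - m)%C.
Proof. exact (is_RInt_minus (V := C_R_NormedModule) f g a b l m). Qed.

Lemma is_CInt_derive_on (f df : R -> C) (a b : R) :
  (forall x, Rmin a b <= x <= Rmax a b -> is_Cderive f x (df x)) ->
  (forall x, continuous (U := C_UniformSpace) df x) ->
  is_CInt df a b (f b - f a)%C.
Proof.
intros h1 h2.
exact (is_RInt_derive (V := C_R_CompleteNormedModule) f df a b h1 (fun x _ => h2 x)).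
Qed.

Lemma is_CInt_derive (f df : R -> C) (a b : R) :
  (forall x, is_Cderive f x (df x)) ->
  (forall x, continuous (U := C_UniformSpace) df x) ->
  is_CInt df a b (f b - f a)%C.
Proof. intros h1 h2. now apply is_CInt_derive_on. Qed.

Lemma Cmod_CInt_le (f : R -> C) (g : R -> R) (a b : R) (l : C) (lg : R) :
  a <= b -> (forall x, a <= x <= b -> Cmod (f x) <= g x) ->
  is_CInt f a b l -> is_RInt g a b lg -> Cmod l <= lg.
Proof.
intros hab hfg hf hg. rewrite Cmod_norm.
apply (norm_RInt_le (V := C_R_NormedModule) f g a b l lg hab); try assumption.
intros x hx. specialize (hfg x hx). now rewrite Cmod_norm in hfg.
Qed.

Lemma CInt_Chasles (f : R -> C) (a b c : R) :
  (forall y, continuous (U := C_UniformSpace) f y) ->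
  (CInt f a b + CInt f b c)%C = CInt f a c.
Proof.
intros hf. apply (RInt_Chasles (V := C_R_CompleteNormedModule));
apply (ex_RInt_continuous (V := C_R_CompleteNormedModule)); intros; apply hf.
Qed.

(** * Iterated integrals and closed forms *)

Lemma Cmod_Re_Im_le (z : C) : Cmod z <= Rabs (Re z) + Rabs (Im z).
Proof.
replace z with (RtoC (Re z) + Ci * RtoC (Im z))%C.
- eapply Rle_trans; [apply Cmod_triangle |]. rewrite Cmod_mult, !Cmod_R.
  replace (Cmod Ci) with 1.
  + unfold Re, Im, Cplus, Cmult, Ci, RtoC; simpl.
    replace (fst z + (0 * snd z - 1 * 0)) with (fst z) by ring.
    replace (0 + (0 * 0 + 1 * snd z)) with (snd z) by ring. lra.
  + unfold Cmod, Ci; simpl. replace (0 * (0 * 1) + 1 * (1 * 1)) with 1 by ring.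
    now rewrite sqrt_1.
- destruct z; unfold Re, Im, Cplus, Cmult, Ci, RtoC; simpl. f_equal; ring.
Qed.

Lemma filterlim_C {T : Type} (F : (T -> Prop) -> Prop) {FF : Filter F} (f : T -> C) (l : C) :
  filterlim f F (Clocally l) <-> (forall eps, 0 < eps -> F (fun x => Cmod (f x - l) < eps)).
Proof.
split.
- intros h eps he.
  generalize (proj1 (filterlim_locally_ball_norm (K := R_AbsRing) (U := C_R_NormedModule)
    (F := F) f l) h (mkposreal _ he)). apply filter_imp. intros x hx.
  unfold ball_norm in hx. now rewrite <- Cmod_norm in hx.
- intros h.
  apply (proj2 (filterlim_locally_ball_norm (K := R_AbsRing) (U := C_R_NormedModule) (F := F) f l)).
  intros [eps he]. specialize (h eps he). revert h. apply filter_imp. intros x hx.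
  unfold ball_norm. now rewrite <- Cmod_norm.
Qed.

Lemma locally_R (x : R) (P : R -> Prop) :
  (exists d, 0 < d /\ forall t, Rabs (t - x) < d -> P t) <-> locally x P.
Proof.
split.
- intros [d [hd h]]. exists (mkposreal d hd). intros t ht. apply h, ht.
- intros [d h]. exists d. split; [apply cond_pos |]. intros t ht. apply h, ht.
Qed.

Definition continuous2 (f : R -> R -> C) := forall y c,
  continuous (T := prod_UniformSpace R_UniformSpace R_UniformSpace) (U := C_UniformSpace)
    (fun p => f (fst p) (snd p)) (y, c).

Lemma continuous2_comp (f : R -> R -> C) {T : UniformSpace} (g h : T -> R) (x : T) :
  continuous2 f -> continuous g x -> continuous h x ->
  continuous (U := C_UniformSpace) (fun t => f (g t) (h t)) x.
Proof. intros hf hg hh. apply (continuous_comp_2 g h f x hg hh). apply hf. Qed.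

Lemma continuous2_l (f : R -> R -> C) (c y : R) :
  continuous2 f -> continuous (U := C_UniformSpace) (fun t => f t c) y.
Proof. intros hf. apply (continuous2_comp f (fun t => t) (fun _ => c)); solve_continuous. Qed.

Lemma continuous2_r (f : R -> R -> C) (c y : R) :
  continuous2 f -> continuous (U := C_UniformSpace) (fun t => f y t) c.
Proof. intros hf. apply (continuous2_comp f (fun _ => y) (fun t => t)); solve_continuous. Qed.

Lemma continuous2_swap (f : R -> R -> C) : continuous2 f -> continuous2 (fun c y => f y c).
Proof. intros hf c y. apply (continuous2_comp f); solve_continuous. Qed.

(** Compactness of [[a, b]] makes continuity in [c] at [c0] uniform in [y]; the real and imaginary
    parts each take [eps / 2]. *)
Lemma continuous2_uniform (f : R -> R -> C) (a b c0 eps : R) :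
  continuous2 f -> 0 < eps -> exists d, 0 < d /\ forall c, Rabs (c - c0) < d ->
    forall y, a <= y <= b -> Cmod (f y c - f y c0) < eps.
Proof.
intros hf he.
assert (he2 : 0 < eps / 2) by lra.
assert (h1 : forall x, a <= x <= b -> continuity_2d_pt (fun u v => Re (f u v)) x c0).
{ intros x _. apply continuity_2d_pt_filterlim.
  exact (continuous_Re (fun p : R * R => f (fst p) (snd p)) (x, c0) (hf x c0)). }
assert (h2 : forall x, a <= x <= b -> continuity_2d_pt (fun u v => Im (f u v)) x c0).
{ intros x _. apply continuity_2d_pt_filterlim.
  exact (continuous_Im (fun p : R * R => f (fst p) (snd p)) (x, c0) (hf x c0)). }
destruct (uniform_continuity_2d_1d _ _ _ _ h1 (mkposreal _ he2)) as [d1 H1].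
destruct (uniform_continuity_2d_1d _ _ _ _ h2 (mkposreal _ he2)) as [d2 H2].
pose proof (cond_pos d1) as p1. pose proof (cond_pos d2) as p2.
exists (Rmin d1 d2). split; [apply Rmin_glb_lt; assumption |].
intros c hc y hy.
pose proof (Rmin_l d1 d2). pose proof (Rmin_r d1 d2).
apply Rabs_def2 in hc.
eapply Rle_lt_trans; [apply Cmod_Re_Im_le |].
specialize (H1 y c0 y c). specialize (H2 y c0 y c). simpl in H1, H2.
unfold Cminus. rewrite !(fun z w : C => eq_refl : Re (z + w) = Re z + Re w).
rewrite !(fun z w : C => eq_refl : Im (z + w) = Im z + Im w).
rewrite !(fun z : C => eq_refl : Re (- z) = - Re z).
rewrite !(fun z : C => eq_refl : Im (- z) = - Im z).
assert (Rabs (y - y) < d1) by (rewrite Rminus_eq_0, Rabs_R0; assumption).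
assert (Rabs (y - y) < d2) by (rewrite Rminus_eq_0, Rabs_R0; assumption).
assert (Rabs (Re (f y c) - Re (f y c0)) < eps / 2) by (apply H1; lra).
assert (Rabs (Im (f y c) - Im (f y c0)) < eps / 2) by (apply H2; lra).
unfold Rminus in *. lra.
Qed.

Lemma Cmod_CInt_const (f : R -> C) (a b M : R) (l : C) :
  (forall x, Rmin a b <= x <= Rmax a b -> Cmod (f x) <= M) -> is_CInt f a b l ->
  Cmod l <= Rabs (b - a) * M.
Proof.
intros h hf. rewrite Cmod_norm.
apply (norm_RInt_le_const_abs (V := C_R_NormedModule) f a b l M); [| exact hf].
intros x hx. specialize (h x hx). now rewrite Cmod_norm in h.
Qed.

Lemma continuous_CInt_param (f : R -> R -> C) (a b c0 : R) :
  continuous2 f -> continuous (U := C_UniformSpace) (fun c => CInt (fun y => f y c) a b) c0.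
Proof.
intros hf. apply filterlim_C; [apply locally_filter |]. intros eps he.
(* The summand 1 keeps the divisor positive when [a = b]. *)
set (k := Rabs (b - a) + 1). assert (hk : 0 < k) by (pose proof (Rabs_pos (b - a)); unfold k; lra).
assert (he' : 0 < eps / k) by (apply Rdiv_lt_0_compat; assumption).
destruct (continuous2_uniform f (Rmin a b) (Rmax a b) c0 _ hf he') as [d [hd H]].
apply locally_R. exists d. split; [exact hd |]. intros c hc.
apply Rle_lt_trans with (Rabs (b - a) * (eps / k)).
- apply (Cmod_CInt_const (fun y => f y c - f y c0)%C).
  + intros x hx. now apply Rlt_le, H.
  + apply is_CInt_minus; apply is_CInt_continuous; intros; apply continuous2_l; assumption.
- unfold k in *. apply Rmult_lt_reg_r with (Rabs (b - a) + 1); [assumption |].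
  field_simplify; lra.
Qed.

(** With the limit [b] replaced by a variable [u], both sides vanish at [u = a] and have the same
    derivative, the integral of [g u t] over [t]: one by differentiation under the integral sign,
    the other by the fundamental theorem of calculus. *)
Lemma RInt_param_Fubini (g : R -> R -> R) (a b c d : R) :
  (forall y t, continuous (T := prod_UniformSpace R_UniformSpace R_UniformSpace)
     (fun p => g (fst p) (snd p)) (y, t)) ->
  a <= b ->
  RInt (fun t => RInt (fun y => g y t) a b) c d = RInt (fun y => RInt (fun t => g y t) c d) a b.
Proof.
intros hg hab.
(* The cast to [C] makes the parametric continuity already proved for complex integrands
   available. *)
assert (hg2 : continuous2 (fun y t => RtoC (g y t))).
{ intros y t. apply continuous_RtoC, hg. }
assert (gl : forall t y, continuous (fun y => g y t) y).
{ intros t y. exact (continuous_Re _ _ (continuous2_l _ t y hg2)). }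
assert (gr : forall y t, continuous (fun t => g y t) t).
{ intros y t. exact (continuous_Re _ _ (continuous2_r _ t y hg2)). }
assert (exl : forall t u v, ex_RInt (fun y => g y t) u v).
{ intros. apply (ex_RInt_continuous (V := R_CompleteNormedModule)). intros; apply gl. }
assert (exr : forall y u v, ex_RInt (fun t => g y t) u v).
{ intros. apply (ex_RInt_continuous (V := R_CompleteNormedModule)). intros; apply gr. }
assert (ReI : forall (f : R -> R) u v, ex_RInt f u v -> Re (CInt (fun t => RtoC (f t)) u v) = RInt
  f u v).
{ intros f u v [l hl]. rewrite (is_RInt_unique _ _ _ _ hl).
  rewrite (is_CInt_unique _ _ _ (RtoC l)); [reflexivity |].
  apply is_CInt_pair; simpl; [exact hl |].
  assert (h : is_RInt (fun _ => 0) u v ((v - u) * 0))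
    by exact (is_RInt_const (V := R_NormedModule) u v 0).
  rewrite Rmult_0_r in h. exact h. }
assert (cl : forall u v t, continuous (fun t => RInt (fun y => g y t) u v) t).
{ intros u v t. pose proof (continuous_Re _ _ (continuous_CInt_param _ u v t hg2)) as h.
  revert h. apply continuous_ext. intros s. now apply ReI. }
assert (cr : forall u v y, continuous (fun y => RInt (fun t => g y t) u v) y).
{ intros u v y. pose proof (continuous_Re _ _ (continuous_CInt_param _ u v y (continuous2_swap _
  hg2))) as h.
  revert h. apply continuous_ext. intros s. now apply ReI. }
set (F := fun u => RInt (fun t => RInt (fun y => g y t) a u) c d
    - RInt (fun y => RInt (fun t => g y t) c d) a u).
assert (dF : forall u, is_derive F u 0).
{ intros u. unfold F.
  replace 0 with (RInt (fun t => g u t) c d - RInt (fun t => g u t) c d) by ring.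
  assert (dg : forall v t, is_derive (fun u => RInt (fun y => g y t) a u) v (g v t)).
  { intros v t. apply (is_derive_RInt (V := R_NormedModule) (fun y => g y t) _ a); [|apply gl].
    apply filter_forall. intros w. apply (RInt_correct (V := R_CompleteNormedModule)), exl. }
  apply (is_derive_minus (V := R_NormedModule)).
  - evar_last.
    + apply (is_derive_RInt_param (fun u t => RInt (fun y => g y t) a u)).
      * apply filter_forall. intros v t _. eexists; apply dg.
      * intros t _. apply continuity_2d_pt_ext with g.
        { intros v s. symmetry. apply is_derive_unique, dg. }
        apply continuity_2d_pt_filterlim. apply hg.
      * apply filter_forall. intros v.
        apply (ex_RInt_continuous (V := R_CompleteNormedModule)). intros; apply cl.
    + apply RInt_ext. intros t _. apply is_derive_unique, dg.
  - apply (is_derive_RInt (V := R_NormedModule) (fun y => RInt (fun t => g y t) c d) _ a);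
    [|apply cr].
    apply filter_forall. intros w. apply (RInt_correct (V := R_CompleteNormedModule)).
    apply (ex_RInt_continuous (V := R_CompleteNormedModule)). intros; apply cr. }
assert (Fa : F a = 0).
{ unfold F. rewrite (RInt_ext (V := R_CompleteNormedModule) _ (fun _ => 0)).
  - rewrite RInt_const, RInt_point. unfold scal, zero; simpl; unfold mult; simpl. ring.
  - intros t _. apply (RInt_point (V := R_CompleteNormedModule)). }
destruct hab as [hab | <-].
- pose proof (eq_is_derive F a b (fun t _ => dF t) hab) as h. rewrite Fa in h.
  unfold F in h. lra.
- unfold F in Fa. lra.
Qed.

Lemma CInt_Re (f : R -> C) (a b : R) : (forall y, continuous (U := C_UniformSpace) f y) ->
  Re (CInt f a b) = RInt (fun t => Re (f t)) a b.
Proof. intros hf. symmetry. apply is_RInt_unique, is_RInt_Re, is_CInt_continuous, hf. Qed.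

Lemma CInt_Im (f : R -> C) (a b : R) : (forall y, continuous (U := C_UniformSpace) f y) ->
  Im (CInt f a b) = RInt (fun t => Im (f t)) a b.
Proof. intros hf. symmetry. apply is_RInt_unique, is_RInt_Im, is_CInt_continuous, hf. Qed.

Lemma C_ext (z w : C) : Re z = Re w -> Im z = Im w -> z = w.
Proof. destruct z, w; simpl; congruence. Qed.

Lemma CInt_Fubini (f : R -> R -> C) (a b c d : R) : continuous2 f -> a <= b ->
  CInt (fun t => CInt (fun y => f y t) a b) c d = CInt (fun y => CInt (fun t => f y t) c d) a b.
Proof.
intros hf hab.
assert (h1 : forall t y, continuous (U := C_UniformSpace) (fun y => f y t) y)
  by (intros; apply continuous2_l, hf).
assert (h2 : forall y t, continuous (U := C_UniformSpace) (fun t => f y t) t)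
  by (intros; apply continuous2_r, hf).
assert (h3 : forall t, continuous (U := C_UniformSpace) (fun t => CInt (fun y => f y t) a b) t)
  by (intros; apply continuous_CInt_param, hf).
assert (h4 : forall y, continuous (U := C_UniformSpace) (fun y => CInt (fun t => f y t) c d) y)
  by (intros; apply (continuous_CInt_param (fun t y => f y t)), continuous2_swap, hf).
apply C_ext.
- rewrite !CInt_Re by assumption.
  rewrite (RInt_ext (fun t => Re (CInt _ _ _)) (fun t => RInt (fun y => Re (f y t)) a b))
    by (intros; now rewrite CInt_Re).
  rewrite (RInt_ext (fun y => Re (CInt (fun t => f y t) c d)) (fun y => RInt (fun t => Re (f y t))
    c d))
    by (intros; now rewrite CInt_Re).
  apply (RInt_param_Fubini (fun y t => Re (f y t))); [| exact hab].
  intros y t. apply (continuous_Re (fun p : R * R => f (fst p) (snd p))), hf.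
- rewrite !CInt_Im by assumption.
  rewrite (RInt_ext (fun t => Im (CInt _ _ _)) (fun t => RInt (fun y => Im (f y t)) a b))
    by (intros; now rewrite CInt_Im).
  rewrite (RInt_ext (fun y => Im (CInt (fun t => f y t) c d)) (fun y => RInt (fun t => Im (f y t))
    c d))
    by (intros; now rewrite CInt_Im).
  apply (RInt_param_Fubini (fun y t => Im (f y t))); [| exact hab].
  intros y t. apply (continuous_Im (fun p : R * R => f (fst p) (snd p))), hf.
Qed.

(* The form [T dy + X dt] is closed.  The clamped variants let [T], [X] and [f] be singular
   outside the strip [c <= t <= d]. *)
Lemma CInt_closed_form (T X f : R -> R -> C) (a b c d : R) :
  a <= b -> c <= d ->
  continuous2 (fun y t => T y (clamp c d t)) -> continuous2 (fun y t => X y (clamp c d t)) ->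
  continuous2 (fun y t => f y (clamp c d t)) ->
  (forall y t, c <= t <= d -> is_Cderive (fun t => T y t) t (f y t)) ->
  (forall y t, c <= t <= d -> is_Cderive (fun y => X y t) y (f y t)) ->
  (CInt (fun y => T y d) a b - CInt (fun y => T y c) a b)%C
  = (CInt (fun t => X b (clamp c d t)) c d - CInt (fun t => X a (clamp c d t)) c d)%C.
Proof.
intros hab hcd hT hX hf dT dX.
pose proof (CInt_Fubini _ a b c d hf hab) as h. cbv beta in h.
assert (cT : forall t, c <= t <= d -> forall y, continuous (U := C_UniformSpace) (fun y => T y t)
  y).
{ intros t ht y. pose proof (continuous2_l _ t y hT) as h1. cbv beta in h1.
  now rewrite clamp_id in h1. }
transitivity (CInt (fun y => CInt (fun t => f y (clamp c d t)) c d) a b).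
- symmetry. rewrite (CInt_ext _ (fun y => T y d - T y c)%C).
  + apply is_CInt_unique, is_CInt_minus; apply is_CInt_continuous; apply cT; lra.
  + intros y _. apply is_CInt_unique, is_CInt_derive_on.
    * rewrite Rmin_left, Rmax_right by exact hcd. intros t ht.
      rewrite clamp_id by exact ht. now apply dT.
    * intros t. apply (continuous2_r _ t y hf).
- rewrite <- h.
  rewrite (CInt_ext _ (fun t => X b (clamp c d t) - X a (clamp c d t))%C).
  + apply is_CInt_unique, is_CInt_minus; apply is_CInt_continuous; intros t;
    apply (continuous2_r _ t _ hX).
  + intros t _. apply is_CInt_unique, (is_CInt_derive (fun y => X y (clamp c d t))).
    * intros y. apply dX. now apply clamp_in.
    * intros y. apply (continuous2_l _ t y hf).
Qed.

Local Notation everywhere_continuous f := (forall y : R, continuous (U := C_UniformSpace) f y).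

(** * Integrals over a half-line *)

(** A plain limit of proper integrals; for a continuous integrand it implies [is_RInt_gen], which is
    needed only at the interface with the theorem. *)
Definition is_half_line_int (f : R -> C) (l : C) : Prop :=
  filterlim (fun Y => CInt f 0 Y) (Rbar_locally p_infty) (Clocally l).

(** A total function: its value is meaningful only together with a proof of convergence, usually
    from [is_half_line_int_ex]. *)
Definition half_line_int (f : R -> C) : C := CInt_gen f (at_point 0) (Rbar_locally p_infty).

Lemma is_half_line_int_is_RInt_gen (f : R -> C) (l : C) : everywhere_continuous f ->
  is_half_line_int f l ->
  is_RInt_gen (V := C_R_NormedModule) f (at_point 0) (Rbar_locally p_infty) l.
Proof.
intros hf h P hP.
apply Filter_prod with (Q := fun x => x = 0) (R := fun y => P (CInt f 0 y)).
- reflexivity.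
- apply (h P hP).
- intros x y -> hy. exists (CInt f 0 y). split; [apply is_CInt_continuous, hf | exact hy].
Qed.

Lemma half_line_int_unique (f : R -> C) (l : C) : everywhere_continuous f ->
  is_half_line_int f l -> half_line_int f = l.
Proof.
intros hf h. unfold half_line_int, CInt_gen.
apply (is_RInt_gen_unique (V := C_R_CompleteNormedModule)).
now apply is_half_line_int_is_RInt_gen.
Qed.

Lemma is_RInt_exp (K eta a b : R) : eta <> 0 ->
  is_RInt (fun y => K * exp (- eta * y)) a b (K / eta * (exp (- eta * a) - exp (- eta * b))).
Proof.
intros he.
replace (K / eta * (exp (- eta * a) - exp (- eta * b)))
  with ((- K / eta * exp (- eta * b)) - (- K / eta * exp (- eta * a))) by (field; exact he).
apply (is_RInt_derive (V := R_CompleteNormedModule) (fun y => - K / eta * exp (- eta * y))).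
- intros x _. auto_derive; [exact I |]. field. exact he.
- intros x _. solve_continuous.
Qed.

Lemma p_infty_ge (M : R) : Rbar_locally p_infty (fun y => M <= y).
Proof. exists M. intros y hy. now apply Rlt_le. Qed.

Lemma exp_tail_small (K eta eps : R) : 0 < eta -> 0 < eps ->
  exists M, 0 <= M /\ forall Y, M <= Y -> K * exp (- eta * Y) < eps.
Proof.
intros he h.
destruct (Rle_dec K 0) as [hK | hK].
- exists 0. split; [lra |]. intros Y _. pose proof (exp_pos (- eta * Y)). nra.
- assert (hK' : 0 < K) by lra.
  (* From this point on [eta * Y >= K / eps], and [exp x >= 1 + x] gives
     [exp (eta * Y) > K / eps]. *)
  exists (Rmax 0 ((K / eps) / eta)). split; [apply Rmax_l |].
  intros Y hY. assert (h1 := Rle_trans _ _ _ (Rmax_r 0 _) hY).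
  assert (h0 := Rle_trans _ _ _ (Rmax_l 0 _) hY).
  assert (h2 : K / eps <= eta * Y).
  { apply Rmult_le_reg_r with (/ eta); [now apply Rinv_0_lt_compat |].
    replace (eta * Y * / eta) with Y by (field; lra). exact h1. }
  assert (h3 : K / eps < exp (eta * Y)).
  { pose proof (exp_ineq1_le (eta * Y)). lra. }
  replace (- eta * Y) with (- (eta * Y)) by ring. rewrite exp_Ropp.
  apply Rmult_lt_reg_r with (exp (eta * Y)); [apply exp_pos |].
  rewrite Rmult_assoc, Rinv_l by (apply Rgt_not_eq, exp_pos).
  apply Rmult_lt_reg_r with (/ eps); [now apply Rinv_0_lt_compat |].
  replace (eps * exp (eta * Y) * / eps) with (exp (eta * Y)) by (field; lra).
  rewrite Rmult_1_r. exact h3.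
Qed.

Lemma CInt_tail (f : R -> C) (K eta Y Z : R) : everywhere_continuous f -> 0 < eta -> 0 <= Y <= Z ->
  (forall y, 0 <= y -> Cmod (f y) <= K * exp (- eta * y)) ->
  Cmod (CInt f 0 Z - CInt f 0 Y) <= K / eta * exp (- eta * Y).
Proof.
intros hf he hYZ hb.
rewrite <- (CInt_Chasles f 0 Y Z hf).
replace (CInt f 0 Y + CInt f Y Z - CInt f 0 Y)%C with (CInt f Y Z) by ring.
(* The sign of [K] is read off the bound at [y = 0]. *)
assert (hK : 0 <= K).
{ specialize (hb 0 (Rle_refl 0)). rewrite Rmult_0_r, exp_0, Rmult_1_r in hb.
  eapply Rle_trans; [apply Cmod_ge_0 | exact hb]. }
eapply Rle_trans.
- apply (Cmod_CInt_le f (fun y => K * exp (- eta * y)) Y Z).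
  + lra.
  + intros x hx. apply hb. lra.
  + now apply is_CInt_continuous.
  + apply is_RInt_exp. lra.
- assert (0 <= K / eta) by (apply Rle_mult_inv_pos; assumption).
  pose proof (exp_pos (- eta * Z)). nra.
Qed.

(** By [CInt_tail] the partial integrals satisfy the Cauchy criterion at infinity. *)
Lemma is_half_line_int_ex (f : R -> C) (K eta : R) : everywhere_continuous f -> 0 < eta ->
  (forall y, 0 <= y -> Cmod (f y) <= K * exp (- eta * y)) ->
  is_half_line_int f (half_line_int f).
Proof.
intros hf he hb.
assert (hx : exists l, is_half_line_int f l).
{ apply (filterlim_locally_cauchy (U := C_R_CompleteNormedModule) (F := Rbar_locally p_infty)
    (fun Y => CInt f 0 Y)).
  intros [eps hp].
  destruct (exp_tail_small (K / eta) eta (eps) he hp) as [M [hM HM]].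
  exists (fun y => M <= y). split; [apply p_infty_ge |].
  assert (aux : forall u v, M <= u <= v -> Cmod (CInt f 0 v - CInt f 0 u) < eps).
  { intros u v huv. eapply Rle_lt_trans; [apply (CInt_tail f K eta); (assumption || lra) |].
    apply HM; lra. }
  intros u v hu hv. cbv beta in hu, hv.
  apply (norm_compat1 (V := C_R_NormedModule)). rewrite <- Cmod_norm. simpl.
  destruct (Rle_dec u v) as [huv | huv].
  - apply aux; lra.
  - change (Cmod (CInt f 0 v - CInt f 0 u) < eps).
    rewrite <- Cmod_opp. replace (- (CInt f 0 v - CInt f 0 u))%C with (CInt f 0 u - CInt f 0 v)%C
      by ring.
    apply aux; lra. }
destruct hx as [l hl]. now rewrite (half_line_int_unique f l hf hl).
Qed.

Lemma half_line_int_tail (f : R -> C) (K eta Y : R) : everywhere_continuous f -> 0 < eta ->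
  (forall y, 0 <= y -> Cmod (f y) <= K * exp (- eta * y)) -> 0 <= Y ->
  Cmod (half_line_int f - CInt f 0 Y) <= K / eta * exp (- eta * Y).
Proof.
intros hf he hb hY. apply le_epsilon. intros eps hp.
pose proof (is_half_line_int_ex f K eta hf he hb) as h. unfold is_half_line_int in h.
apply (proj1 (filterlim_C (Rbar_locally p_infty) _ _)) with (eps := eps) in h; [| exact hp].
destruct (filter_ex (F := Rbar_locally p_infty) _ (filter_and _ _ h (p_infty_ge Y))) as [Z [h1 h2]].
replace (half_line_int f - CInt f 0 Y)%C with ((CInt f 0 Z - CInt f 0 Y) - (CInt f 0 Z -
  half_line_int f))%C by ring.
eapply Rle_trans; [apply Cmod_triangle |]. rewrite Cmod_opp.
pose proof (CInt_tail f K eta Y Z hf he (conj hY h2) hb). lra.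
Qed.

Lemma Cmod_half_line_int (f : R -> C) (K eta : R) : everywhere_continuous f -> 0 < eta ->
  (forall y, 0 <= y -> Cmod (f y) <= K * exp (- eta * y)) -> Cmod (half_line_int f) <= K / eta.
Proof.
intros hf he hb.
pose proof (half_line_int_tail f K eta 0 hf he hb (Rle_refl 0)) as h.
rewrite Rmult_0_r, exp_0, Rmult_1_r in h.
replace (CInt f 0 0) with (RtoC 0) in h.
- now replace (half_line_int f - 0)%C with (half_line_int f) in h by ring.
- symmetry. apply CInt_point.
Qed.

Lemma is_half_line_int_plus (f g : R -> C) (l m : C) : everywhere_continuous f ->
  everywhere_continuous g ->
  is_half_line_int f l -> is_half_line_int g m -> is_half_line_int (fun y => f y + g y)%C (l + m)%C.
Proof.
intros cf cg hf hg. unfold is_half_line_int.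
apply filterlim_ext with (f := fun Y => (CInt f 0 Y + CInt g 0 Y)%C).
- intros Y. symmetry. apply is_CInt_unique, is_CInt_plus; now apply is_CInt_continuous.
- exact (filterlim_comp_2 _ _ _ hf hg (filterlim_plus (V := C_R_NormedModule) l m)).
Qed.

Lemma is_half_line_int_opp (f : R -> C) (l : C) : everywhere_continuous f ->
  is_half_line_int f l -> is_half_line_int (fun y => - f y)%C (- l)%C.
Proof.
intros cf hf. unfold is_half_line_int.
apply filterlim_ext with (f := fun Y => (- CInt f 0 Y)%C).
- intros Y. symmetry. apply is_CInt_unique.
  apply (is_RInt_opp (V := C_R_NormedModule)). now apply is_CInt_continuous.
- exact (filterlim_comp _ _ _ _ _ _ _ _ hf (filterlim_opp (V := C_R_NormedModule) l)).
Qed.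

Lemma is_half_line_int_scal (k : C) (f : R -> C) (l : C) : everywhere_continuous f ->
  is_half_line_int f l -> is_half_line_int (fun y => k * f y)%C (k * l)%C.
Proof.
intros cf hf. unfold is_half_line_int.
apply filterlim_ext with (f := fun Y => (k * CInt f 0 Y)%C).
- intros Y. symmetry. apply is_CInt_unique, is_CInt_scal. now apply is_CInt_continuous.
- apply (filterlim_comp _ _ _ (fun Y => CInt f 0 Y) (fun z => (k * z)%C) _ (Clocally l));
  [exact hf |].
  apply (continuous_Cmult (T := C_UniformSpace) (fun _ => k) (fun z => z));
    [apply continuous_const | apply continuous_id].
Qed.

Lemma is_half_line_int_ext (f g : R -> C) (l : C) : (forall y, f y = g y) ->
  is_half_line_int f l -> is_half_line_int g l.
Proof.
intros h. apply filterlim_ext. intros Y. apply (CInt_ext).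
intros; apply h.
Qed.

(** The bound does not depend on [c], so one truncation point [M] makes the tails small for every
    [c] at once; continuity in [c] and the exchange of integrals are then inherited from
    [[0, M]]. *)
Lemma half_line_int_param (f : R -> R -> C) (K eta : R) : continuous2 f -> 0 < eta ->
  (forall y c, 0 <= y -> Cmod (f y c) <= K * exp (- eta * y)) ->
  everywhere_continuous (fun c => half_line_int (fun y => f y c)) /\
  (forall a b, is_half_line_int (fun y => CInt (fun c => f y c) a b) (CInt (fun c => half_line_int
    (fun y => f y c)) a b)).
Proof.
intros hf he hb.
assert (h1 : forall c, everywhere_continuous (fun y => f y c)) by (intros c y;
  now apply continuous2_l).
assert (ht : forall c Y, 0 <= Y -> Cmod (half_line_int (fun y => f y c) - CInt (fun y => f y c) 0 Y)
   <= K / eta * exp (- eta * Y)).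
{ intros c Y hY. apply (half_line_int_tail (fun y => f y c)); auto. }
assert (hc : everywhere_continuous (fun c => half_line_int (fun y => f y c))).
{ intros c0. apply filterlim_C; [apply locally_filter |]. intros eps hp.
  assert (hp3 : 0 < eps / 3) by lra.
  destruct (exp_tail_small (K / eta) eta _ he hp3) as [M [hM HM]].
  specialize (HM M (Rle_refl M)).
  pose proof (continuous_CInt_param f 0 M c0 hf) as hk.
  apply (proj1 (filterlim_C (locally c0) _ _)) with (eps := eps / 3) in hk; [| exact hp3].
  revert hk. apply filter_imp. intros c hk.
  replace (half_line_int (fun y => f y c) - half_line_int (fun y => f y c0))%C with
   ((half_line_int (fun y => f y c) - CInt (fun y => f y c) 0 M)
     + (CInt (fun y => f y c) 0 M - CInt (fun y => f y c0) 0 M)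
     + - (half_line_int (fun y => f y c0) - CInt (fun y => f y c0) 0 M))%C by ring.
  eapply Rle_lt_trans; [apply Cmod_triangle |].
  eapply Rle_lt_trans; [apply Rplus_le_compat_r, Cmod_triangle |].
  rewrite Cmod_opp. pose proof (ht c M hM). pose proof (ht c0 M hM). lra. }
split; [exact hc |].
intros a b. unfold is_half_line_int. apply filterlim_C; [apply Rbar_locally_filter |].
  intros eps hp.
set (k := Rabs (b - a) + 1). assert (hk : 0 < k) by (pose proof (Rabs_pos (b - a)); unfold k; lra).
destruct (exp_tail_small (k * (K / eta)) eta _ he hp) as [M [hM HM]].
generalize (p_infty_ge M). apply filter_imp. intros Y hY.
rewrite <- (CInt_Fubini f 0 Y a b hf) by lra.
eapply Rle_lt_trans; [| apply (HM Y hY)].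
apply Rle_trans with (Rabs (b - a) * (K / eta * exp (- eta * Y))).
- apply (Cmod_CInt_const (fun c => CInt (fun y => f y c) 0 Y - half_line_int (fun y => f y c))%C).
  + intros c _. rewrite <- Cmod_opp.
    replace (- (CInt (fun y => f y c) 0 Y - half_line_int (fun y => f y c)))%C
      with (half_line_int (fun y => f y c) - CInt (fun y => f y c) 0 Y)%C by ring.
    apply ht. lra.
  + apply is_CInt_minus; apply is_CInt_continuous; [| exact hc].
    intros c. now apply continuous_CInt_param.
- assert (0 <= K / eta).
  { eapply Rle_trans; [apply Cmod_ge_0 |].
    specialize (ht 0 0 (Rle_refl 0)). rewrite Rmult_0_r, exp_0, Rmult_1_r in ht. exact ht. }
  pose proof (exp_pos (- eta * Y)). unfold k.
  assert (0 <= K / eta * exp (- eta * Y)) by (apply Rmult_le_pos; lra). nra.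
Qed.

(** Clamping [c] to [[a, b]] turns the bound on that interval into the global one of
    [half_line_int_param], without changing either side. *)
Lemma half_line_int_Fubini (f : R -> R -> C) (K eta a b : R) : continuous2 f -> 0 < eta -> a <= b ->
  (forall y c, 0 <= y -> a <= c <= b -> Cmod (f y c) <= K * exp (- eta * y)) ->
  is_half_line_int (fun y => CInt (fun c => f y c) a b) (CInt (fun c => half_line_int (fun y => f y
    c)) a b).
Proof.
intros hf he hab hb.
destruct (half_line_int_param (fun y c => f y (clamp a b c)) K eta) as [h1 h2].
- intros y c. apply (continuous2_comp f); [exact hf | solve_continuous |]. apply continuous_clamp.
  solve_continuous.
- exact he.
- intros y c hy. apply hb; [exact hy | now apply clamp_in].
- specialize (h2 a b).
  rewrite (CInt_ext (fun c => half_line_int (fun y => f y c))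
    (fun c => half_line_int (fun y => f y (clamp a b c)))).
  + revert h2. apply is_half_line_int_ext. intros y. apply (CInt_ext).
    rewrite Rmin_left, Rmax_right by exact hab. intros c hc. rewrite clamp_id by lra. reflexivity.
  + rewrite Rmin_left, Rmax_right by exact hab. intros c hc. rewrite clamp_id by lra. reflexivity.
Qed.

Lemma half_line_int_continuous (f : R -> R -> C) (K eta c0 d : R) : continuous2 f -> 0 < eta ->
  0 < d ->
  (forall y c, 0 <= y -> Rabs (c - c0) <= d -> Cmod (f y c) <= K * exp (- eta * y)) ->
  continuous (U := C_UniformSpace) (fun c => half_line_int (fun y => f y c)) c0.
Proof.
intros hf he hd hb.
destruct (half_line_int_param (fun y c => f y (clamp (c0 - d) (c0 + d) c)) K eta) as [h1 h2].
- intros y c. apply (continuous2_comp f); [exact hf | solve_continuous |]. apply continuous_clamp.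
  solve_continuous.
- exact he.
- intros y c hy. apply hb; [exact hy |].
  pose proof (clamp_in (c0 - d) (c0 + d) c ltac:(lra)). apply Rabs_le. lra.
- apply (continuous_ext_loc (U := C_UniformSpace) _ (fun c => half_line_int (fun y => f y (clamp
  (c0 - d) (c0 + d) c)))).
  + apply locally_R. exists d. split; [exact hd |]. intros c hc. apply Rabs_def2 in hc.
    rewrite clamp_id by lra. reflexivity.
  + apply h1.
Qed.

(** [CInt_closed_form] on [[0, Y] x [c, d]] as [Y] grows: the side [y = 0] is zero by assumption and
    the side [y = Y] decays. It stands in for Cauchy's theorem in [Gamma_ray_rotate] and for Green's
    identity in [Poisson_identity]. *)
Lemma half_line_int_closed_form (T X f : R -> R -> C) (c d K eta : R) : c <= d ->
  continuous2 (fun y t => T y (clamp c d t)) -> continuous2 (fun y t => X y (clamp c d t)) ->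
  continuous2 (fun y t => f y (clamp c d t)) -> 0 < eta ->
  (forall y t, c <= t <= d -> is_Cderive (fun t => T y t) t (f y t)) ->
  (forall y t, c <= t <= d -> is_Cderive (fun y => X y t) y (f y t)) ->
  (forall t, X 0 t = RtoC 0) ->
  (forall y t, 0 <= y -> c <= t <= d -> Cmod (X y t) <= K * exp (- eta * y)) ->
  is_half_line_int (fun y => T y d - T y c)%C (RtoC 0).
Proof.
intros hcd hT hX hf he dT dX X0 hb.
assert (cT : forall t, c <= t <= d -> everywhere_continuous (fun y => T y t)).
{ intros t ht y. pose proof (continuous2_l _ t y hT) as h1. cbv beta in h1.
  now rewrite clamp_id in h1. }
unfold is_half_line_int. apply filterlim_C; [apply Rbar_locally_filter |]. intros eps hp.
destruct (exp_tail_small ((d - c) * K) eta _ he hp) as [M [hM HM]].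
generalize (p_infty_ge M). apply filter_imp. intros Y hY.
eapply Rle_lt_trans; [| apply (HM Y hY)].
rewrite (is_CInt_unique _ _ _ _ (is_CInt_minus _ _ _ _ _ _
  (is_CInt_continuous (fun y => T y d) 0 Y (cT d (conj hcd (Rle_refl d))))
  (is_CInt_continuous (fun y => T y c) 0 Y (cT c (conj (Rle_refl c) hcd))))).
rewrite (CInt_closed_form T X f 0 Y c d) by (assumption || lra).
replace (CInt (fun t => X 0 (clamp c d t)) c d) with (RtoC 0).
- replace (CInt (fun t => X Y (clamp c d t)) c d - 0 - 0)%C
    with (CInt (fun t => X Y (clamp c d t)) c d) by ring.
  rewrite Rmult_assoc. rewrite <- (Rabs_pos_eq (d - c)) by lra.
  apply (Cmod_CInt_const (fun t => X Y (clamp c d t))).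
  + intros t _. apply hb; [lra | now apply clamp_in].
  + apply is_CInt_continuous. intros t. apply (continuous2_r _ t Y hX).
- symmetry. rewrite (CInt_ext _ (fun _ => RtoC 0)) by (intros; apply X0).
  unfold CInt. rewrite (RInt_const (V := C_R_CompleteNormedModule)).
  exact (scal_zero_r (V := C_R_NormedModule) (d - c)).
Qed.

Lemma is_Cderive_eq (f : R -> C) (x : R) (l m : C) :
  is_Cderive f x l -> l = m -> is_Cderive f x m.
Proof. now intros h <-. Qed.

Lemma is_Cderive_id (x : R) : is_Cderive (fun t => RtoC t) x (RtoC 1).
Proof. apply is_Cderive_RtoC. exact (is_derive_id x). Qed.

Lemma is_Cderive_Ropp (x : R) : is_Cderive (fun t => RtoC (- t)) x (RtoC (-1)).
Proof. apply is_Cderive_RtoC. auto_derive; [exact I | ring]. Qed.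

Ltac solve_Cderive := eapply is_Cderive_eq; [ repeat (cbv beta; lazymatch goal with
  | |- is_derive (fun _ => ?c) _ _ => apply is_Cderive_const
  | |- is_derive (fun x => RtoC x) _ _ => apply is_Cderive_id
  | |- is_derive (fun x => RtoC (- x)) _ _ => apply is_Cderive_Ropp
  | |- is_derive (fun x => RtoC (@?f x)) _ _ => apply (is_Cderive_RtoC f); eassumption
  | |- is_derive (fun x => Cexp (@?f x)) _ _ => apply (is_Cderive_Cexp f)
  | |- is_derive (fun x => Cplus (@?f x) (@?g x)) _ _ => apply (is_Cderive_plus f g)
  | |- is_derive (fun x => Cminus (@?f x) (@?g x)) _ _ => apply (is_Cderive_minus f g)
  | |- is_derive (fun x => Cmult (@?f x) (@?g x)) _ _ => apply (is_Cderive_mult f g)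
  | |- is_derive (fun x => Copp (@?f x)) _ _ => apply (is_Cderive_opp f)
  end) | cbv beta ].

Lemma Re_plus (z w : C) : Re (z + w) = Re z + Re w. Proof. reflexivity. Qed.
Lemma Im_plus (z w : C) : Im (z + w) = Im z + Im w. Proof. reflexivity. Qed.
Lemma Re_opp (z : C) : Re (- z) = - Re z. Proof. reflexivity. Qed.
Lemma Im_opp (z : C) : Im (- z) = - Im z. Proof. reflexivity. Qed.
Lemma Re_minus (z w : C) : Re (z - w) = Re z - Re w. Proof. reflexivity. Qed.
Lemma Im_minus (z w : C) : Im (z - w) = Im z - Im w. Proof. reflexivity. Qed.
Lemma Re_mult (z w : C) : Re (z * w) = Re z * Re w - Im z * Im w. Proof. reflexivity. Qed.
Lemma Im_mult (z w : C) : Im (z * w) = Re z * Im w + Im z * Re w. Proof. reflexivity. Qed.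
Lemma Re_RtoC (x : R) : Re (RtoC x) = x. Proof. reflexivity. Qed.
Lemma Im_RtoC (x : R) : Im (RtoC x) = 0. Proof. reflexivity. Qed.
Lemma Re_Cexp (z : C) : Re (Cexp z) = exp (Re z) * cos (Im z). Proof. reflexivity. Qed.
Ltac simpl_Re_Im := repeat first [rewrite Re_plus | rewrite Im_plus | rewrite Re_opp |
  rewrite Im_opp
  | rewrite Re_minus | rewrite Im_minus | rewrite Re_mult | rewrite Im_mult
  | rewrite Re_RtoC | rewrite Im_RtoC].

(** The derivative is asked for on [0 <= y] only, because the antiderivative of [poisson] in
    [is_half_line_int_poisson] can be singular at a negative [y]. *)
Lemma is_half_line_int_derive (F f : R -> C) (K eta : R) : 0 < eta -> everywhere_continuous f ->
  (forall y, 0 <= y -> is_Cderive F y (f y)) ->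
  (forall y, 0 <= y -> Cmod (F y) <= K * exp (- eta * y)) ->
  is_half_line_int f (- F 0)%C.
Proof.
intros he cf dF hb. unfold is_half_line_int. apply filterlim_C; [apply Rbar_locally_filter |].
intros eps hp. destruct (exp_tail_small K eta eps he hp) as [M [hM HM]].
generalize (p_infty_ge M). apply filter_imp. intros Y hY.
rewrite (is_CInt_unique f 0 Y (F Y - F 0)%C).
- replace (F Y - F 0 - - F 0)%C with (F Y) by ring.
  eapply Rle_lt_trans; [apply hb; lra | apply HM, hY].
- apply is_CInt_derive_on; [| exact cf].
  intros y. rewrite Rmin_left by lra. intros [hy _]. now apply dF.
Qed.

Lemma is_half_line_int_minus (f g : R -> C) (l m : C) : everywhere_continuous f ->
  everywhere_continuous g ->
  is_half_line_int f l -> is_half_line_int g m -> is_half_line_int (fun y => f y - g y)%C (l - m)%C.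
Proof.
intros cf cg hf hg. apply (is_half_line_int_plus f (fun y => - g y)%C); try assumption.
- intros y. apply continuous_Copp, cg.
- now apply is_half_line_int_opp.
Qed.

Lemma is_half_line_int_unique (f : R -> C) (l m : C) : everywhere_continuous f ->
  is_half_line_int f l -> is_half_line_int f m -> l = m.
Proof. intros cf h1 h2. now rewrite <- (half_line_int_unique f l cf h1), (half_line_int_unique f m
  cf h2). Qed.

(** * Integrals over the whole line and logarithmic substitution *)

Lemma CInt_opp (h : R -> C) (a : R) : everywhere_continuous h -> CInt h a 0 = CInt (fun y => h (-
  y)) 0 (- a).
Proof.
intros ch. apply is_CInt_unique.
assert (ch' : everywhere_continuous (fun y => h (- y))).
{ intros y. apply (continuous_comp Ropp h); [solve_continuous | apply ch]. }
assert (h1 : is_CInt (fun y => opp (h (- - y))) 0 a (CInt (fun y => h (- y)) 0 (- a))).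
2:{ apply (is_RInt_swap (V := C_R_NormedModule)) in h1.
    apply (is_RInt_opp (V := C_R_NormedModule)) in h1.
    rewrite (opp_opp (G := C_R_NormedModule)) in h1. revert h1.
    apply (is_RInt_ext (V := C_R_NormedModule)). intros x _.
    etransitivity; [apply (opp_opp (G := C_R_NormedModule)) |]. now rewrite Ropp_involutive. }
apply (is_RInt_comp_opp (V := C_R_NormedModule) (fun y => h (- y))).
rewrite Ropp_0. now apply is_CInt_continuous.
Qed.

Definition mp_infty := filter_prod (Rbar_locally m_infty) (Rbar_locally p_infty).

Lemma filterlim_mp_infty (h : R -> C) (l m : C) : everywhere_continuous h ->
  is_half_line_int h l -> is_half_line_int (fun y => h (- y)) m ->
  filterlim (fun ab => CInt h (fst ab) (snd ab)) mp_infty (Clocally (l + m)%C).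
Proof.
intros ch hl hm.
apply filterlim_ext with
  (f := fun ab => (CInt h 0 (snd ab) + CInt (fun y => h (- y)%R) 0 (- fst ab)%R)%C).
- intros [a b]. simpl. rewrite <- CInt_opp by exact ch.
  rewrite Cplus_comm. now apply CInt_Chasles.
- apply (filterlim_comp_2 (G := Clocally l) (H := Clocally m)).
  + exact (filterlim_comp _ _ _ _ _ _ _ _ filterlim_snd hl).
  + eapply (filterlim_comp _ _ _ (fun ab => - fst ab) (fun Y => CInt (fun y => h (- y)) 0 Y));
      [| exact hm].
    eapply filterlim_comp; [apply filterlim_fst |].
    exact (filterlim_Rbar_opp m_infty).
  + exact (filterlim_plus (V := C_R_NormedModule) l m).
Qed.

(** The substitution [y = ln t] carries the improper ends [0] and [+oo] to the two ends of the line,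
    with Jacobian [/ t]. Both Euler's integral and the integral of [kernel] are treated in this
    way. *)
Lemma is_RInt_gen_log (h f : R -> C) (l : C) : everywhere_continuous h ->
  (forall t, 0 < t -> f t = (/ t * h (ln t))%C) ->
  filterlim (fun ab => CInt h (fst ab) (snd ab)) mp_infty (Clocally l) ->
  is_RInt_gen (V := C_R_NormedModule) f (at_right 0) (Rbar_locally p_infty) l.
Proof.
intros ch hf hl P hP.
assert (h1 : filterlim (fun ab : R * R => (ln (fst ab), ln (snd ab)))
   (filter_prod (at_right 0) (Rbar_locally p_infty)) mp_infty).
{ apply filterlim_pair.
  - eapply filterlim_comp; [apply filterlim_fst | apply is_lim_ln_0].
  - eapply filterlim_comp; [apply filterlim_snd | exact is_lim_ln_p]. }
pose proof (filterlim_comp _ _ _ _ _ _ _ _ h1 hl P hP) as h2. unfold filtermap in h2.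
assert (h3 : filter_prod (at_right 0) (Rbar_locally p_infty)
   (fun ab => 0 < fst ab /\ 0 < snd ab)).
{ apply Filter_prod with (Q := fun x => 0 < x) (R := fun y => 0 < y).
  - exists (mkposreal 1 Rlt_0_1). intros y _ hy. exact hy.
  - now exists 0.
  - intros x y hx hy. split; assumption. }
unfold filtermapi. generalize (filter_and _ _ h2 h3). apply filter_imp.
intros [x y]; cbn [fst snd]. intros [k [hx hy]].
eexists; split; [| exact k].
apply (is_RInt_ext (V := C_R_NormedModule) (fun t => scal (/ t) (h (ln t)))).
- intros t [ht _]. rewrite hf by (eapply Rlt_trans; [| exact ht]; now apply Rmin_glb_lt).
  rewrite scal_R_Cmult. f_equal. rewrite RtoC_inv; [reflexivity |].
  apply Rgt_not_eq. eapply Rlt_trans; [| exact ht]; now apply Rmin_glb_lt.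
- apply (is_RInt_comp (V := C_R_CompleteNormedModule)).
  + intros; apply ch.
  + intros t [ht _]. assert (0 < t) by (eapply Rlt_le_trans; [| exact ht]; now apply Rmin_glb_lt).
    split; [now apply is_derive_ln |]. apply continuous_Rinv; [solve_continuous | lra].
Qed.

(** * The Gamma function along a ray *)

(* Euler's integrand for [Gamma(c)] in the variable [t = e^(y + L)], with [y] real: integration
   runs along the ray through [e^L]. *)
Definition gamma_integrand (c L : C) (y : R) : C := Cexp (c * (y + L) - Cexp (y + L)).

(** The incomplete Gamma functions at [e^L]: the point [t = e^L] corresponds to [y = 0], so the
    half-lines [y >= 0] and [y <= 0] are the parts of the ray beyond and before it. *)
Definition upper_Gamma (c L : C) : C := half_line_int (gamma_integrand c L).
Definition lower_Gamma (c L : C) : C := half_line_int (fun y => gamma_integrand c L (- y)).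
(* Integrals over the whole line are folded to [0 <= y] throughout. *)
Definition Gamma_ray (c L : C) : C := half_line_int (fun y => gamma_integrand c L y +
  gamma_integrand c L (- y))%C.

Lemma gamma_integrand_continuous (c L : C) : everywhere_continuous (gamma_integrand c L).
Proof. intros y. unfold gamma_integrand. solve_continuous. Qed.

Lemma gamma_integrand_opp_continuous (c L : C) : everywhere_continuous (fun y => gamma_integrand c
  L (- y)).
Proof. intros y. unfold gamma_integrand. solve_continuous. Qed.

Lemma Cmod_gamma_integrand (c L : C) (y : R) :
  Cmod (gamma_integrand c L y) = exp (Re c * y + Re (c * L) - exp y * Re (Cexp L)).
Proof.
unfold gamma_integrand. rewrite Cmod_Cexp. f_equal.
rewrite Cexp_plus, Cexp_RtoC. simpl_Re_Im. ring.
Qed.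

Lemma exp_ge_sqr (y : R) : 0 <= y -> y * y / 4 <= exp y.
Proof.
intros hy. replace y with (y / 2 + y / 2) at 3 by field. rewrite exp_plus.
pose proof (exp_ineq1_le (y / 2)). nra.
Qed.

Lemma exp_mono (x y : R) : x <= y -> exp x <= exp y.
Proof. intros [h | ->]; [now apply Rlt_le, exp_increasing | apply Rle_refl]. Qed.

(** [exp_ge_sqr] replaces [k e^y] by [k y^2 / 4]; completing the square bounds
    [(p + 1) y - k y^2 / 4] by [(p + 1)^2 / k]. *)
Lemma exp_double_exp_bound (p k y : R) : 0 < k -> 0 <= y ->
  exp (p * y - k * exp y) <= exp ((p + 1) * (p + 1) / k) * exp (- (1) * y).
Proof.
intros hk hy. rewrite <- exp_plus. apply exp_mono.
pose proof (exp_ge_sqr y hy) as h.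
assert (h2 : k * (y * y / 4) <= k * exp y) by (apply Rmult_le_compat_l; lra).
assert (h3 : 0 <= (k * y / 2 - (p + 1)) * (k * y / 2 - (p + 1)) / k).
{ apply Rle_mult_inv_pos; [| lra]. exact (Rle_0_sqr (k * y / 2 - (p + 1))). }
replace ((k * y / 2 - (p + 1)) * (k * y / 2 - (p + 1)) / k) with
  (k * (y * y / 4) - (p + 1) * y + (p + 1) * (p + 1) / k) in h3 by (field; lra).
lra.
Qed.

(** The slack parameters [p], [k], [m] make the bound uniform when [c] or [L] varies under an
    integral or along a rotation. *)
Lemma gamma_integrand_bound_pos (c L : C) (p k m y : R) : Re c <= p -> 0 < k <= Re (Cexp L) ->
  Re (c * L) <= m -> 0 <= y ->
  Cmod (gamma_integrand c L y) <= exp (m + (p + 1) * (p + 1) / k) * exp (- (1) * y).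
Proof.
intros hp hk hm hy. rewrite Cmod_gamma_integrand, exp_plus, Rmult_assoc.
eapply Rle_trans.
2:{ apply Rmult_le_compat_l; [apply Rlt_le, exp_pos |].
    apply (exp_double_exp_bound p k y); lra. }
rewrite <- exp_plus. apply exp_mono. pose proof (exp_pos y). nra.
Qed.

Lemma gamma_integrand_bound_neg (c L : C) (p m y : R) : p <= Re c -> 0 <= Re (Cexp L) ->
  Re (c * L) <= m -> 0 <= y ->
  Cmod (gamma_integrand c L (- y)) <= exp m * exp (- p * y).
Proof.
intros hp hk hm hy. rewrite Cmod_gamma_integrand, <- exp_plus. apply exp_mono.
pose proof (exp_pos (- y)). nra.
Qed.

Lemma gamma_integrand_sym_bound (c L : C) (p0 p1 k m y : R) : p0 <= Re c <= p1 ->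
  0 < k <= Re (Cexp L) ->
  Re (c * L) <= m -> 0 <= y ->
  Cmod (gamma_integrand c L y) + Cmod (gamma_integrand c L (- y))
  <= (exp (m + (p1 + 1) * (p1 + 1) / k) + exp m) * exp (- Rmin 1 p0 * y).
Proof.
intros hp hk hm hy.
pose proof (gamma_integrand_bound_pos c L p1 k m y ltac:(lra) hk hm hy).
pose proof (gamma_integrand_bound_neg c L p0 m y ltac:(lra) ltac:(lra) hm hy).
rewrite Rmult_plus_distr_r.
(* The right end decays at rate 1 and the left end at rate [p0]; the folded integrand has the
   smaller of the two. *)
assert (h1 : exp (- (1) * y) <= exp (- Rmin 1 p0 * y)).
{ apply exp_mono. pose proof (Rmin_l 1 p0). nra. }
assert (h2 : exp (- p0 * y) <= exp (- Rmin 1 p0 * y)).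
{ apply exp_mono. pose proof (Rmin_r 1 p0). nra. }
pose proof (exp_pos m). pose proof (exp_pos (m + (p1 + 1) * (p1 + 1) / k)).
nra.
Qed.

Lemma Rmin_1_pos (p : R) : 0 < p -> 0 < Rmin 1 p.
Proof. intros h. apply Rmin_glb_lt; lra. Qed.

Lemma upper_Gamma_correct (c L : C) : 0 < Re (Cexp L) -> is_half_line_int (gamma_integrand c L)
  (upper_Gamma c L).
Proof.
intros hL. apply (is_half_line_int_ex _ (exp (Re (c * L) + (Re c + 1) * (Re c + 1) / Re (Cexp L)))
  1);
  [apply gamma_integrand_continuous | lra |].
intros y hy. apply gamma_integrand_bound_pos; lra.
Qed.

Lemma lower_Gamma_correct (c L : C) : 0 < Re c -> 0 < Re (Cexp L) ->
  is_half_line_int (fun y => gamma_integrand c L (- y)) (lower_Gamma c L).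
Proof.
intros hc hL. apply (is_half_line_int_ex _ (exp (Re (c * L))) (Re c));
  [apply gamma_integrand_opp_continuous | lra |].
intros y hy. apply gamma_integrand_bound_neg; lra.
Qed.

Lemma Gamma_ray_split (c L : C) : 0 < Re c -> 0 < Re (Cexp L) -> Gamma_ray c L = (upper_Gamma c L +
  lower_Gamma c L)%C.
Proof.
intros hc hL. apply half_line_int_unique.
- intros y. apply continuous_Cplus; [apply gamma_integrand_continuous |
  apply gamma_integrand_opp_continuous].
- apply is_half_line_int_plus; [apply gamma_integrand_continuous |
  apply gamma_integrand_opp_continuous | now apply upper_Gamma_correct |
    now apply lower_Gamma_correct].
Qed.

Lemma gamma_integrand_sym_continuous (c L : C) : everywhere_continuous (fun y => gamma_integrand c
  L y + gamma_integrand c L (- y))%C.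
Proof. intros y. apply continuous_Cplus; [apply gamma_integrand_continuous |
  apply gamma_integrand_opp_continuous]. Qed.

Lemma Gamma_ray_correct (c L : C) : 0 < Re c -> 0 < Re (Cexp L) ->
  is_half_line_int (fun y => gamma_integrand c L y + gamma_integrand c L (- y))%C (Gamma_ray c L).
Proof.
intros hc hL. rewrite Gamma_ray_split by assumption.
apply is_half_line_int_plus; [apply gamma_integrand_continuous |
  apply gamma_integrand_opp_continuous | now apply upper_Gamma_correct |
    now apply lower_Gamma_correct].
Qed.

Lemma CGamma_eq_Gamma_ray (c : C) : 0 < Re c -> CGamma c = Gamma_ray c 0.
Proof.
intros hc. unfold CGamma, CInt_gen.
assert (h0 : 0 < Re (Cexp 0)) by (rewrite Cexp_0; simpl; lra).
apply (is_RInt_gen_unique (V := C_R_CompleteNormedModule)).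
apply (is_RInt_gen_log (gamma_integrand c 0)).
- apply gamma_integrand_continuous.
- intros t ht. unfold gamma_integrand, Cpower. rewrite !Cplus_0_r, Cexp_RtoC, exp_ln by exact ht.
  replace (c * ln t - t)%C with ((c - 1) * ln t + ln t + - t)%C by ring.
  rewrite !Cexp_plus, <- RtoC_opp, !Cexp_RtoC, exp_ln by exact ht.
  assert (RtoC t <> 0%C) by (intros h; injection h; lra).
  field. assumption.
- rewrite Gamma_ray_split by assumption.
  apply filterlim_mp_infty; [apply gamma_integrand_continuous | now apply upper_Gamma_correct |
    now apply lower_Gamma_correct].
Qed.

Lemma Re_Cexp_pos (L : C) : - PI / 2 < Im L < PI / 2 -> 0 < Re (Cexp L).
Proof.
intros hL. rewrite Re_Cexp. apply Rmult_lt_0_compat; [apply exp_pos | apply cos_gt_0; lra].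
Qed.

(** On [(- PI / 2, PI / 2)] the cosine decreases away from 0, so [cos (s * Im L) >= cos (Im L)]. The
    rotation needs a lower bound free of [s]. *)
Lemma Re_Cexp_ray (L : C) (s : R) : - PI / 2 < Im L < PI / 2 -> 0 <= s <= 1 ->
  0 < exp (- Rabs (Re L)) * cos (Im L) <= Re (Cexp (s * L)).
Proof.
intros hL hs.
assert (hc : 0 < cos (Im L)) by (apply cos_gt_0; lra).
pose proof (exp_pos (- Rabs (Re L))).
split; [nra |].
rewrite Re_Cexp. simpl_Re_Im.
replace (s * Re L - 0 * Im L) with (s * Re L) by ring.
replace (s * Im L + 0 * Re L) with (s * Im L) by ring.
apply Rmult_le_compat; try lra.
- apply exp_mono. unfold Rabs; destruct Rcase_abs; nra.
- destruct (Rle_dec 0 (Im L)).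
  + apply cos_decr_1; nra.
  + rewrite <- (cos_neg (Im L)), <- (cos_neg (s * Im L)). apply cos_decr_1; nra.
Qed.

(** The second term arises because the factor [e^(y + L)] raises the exponent [c] by one. *)
Lemma gamma_integrand_derive_y (c L : C) (y : R) :
  is_Cderive (gamma_integrand c L) y (c * gamma_integrand c L y - gamma_integrand (c + 1) L y)%C.
Proof.
unfold gamma_integrand. solve_Cderive.
replace ((c + 1) * (y + L) - Cexp (y + L))%C with
  ((y + L) + (c * (y + L) - Cexp (y + L)))%C by ring.
rewrite (Cexp_plus (y + L)). ring.
Qed.

Lemma gamma_integrand_opp_derive_y (c L : C) (y : R) :
  is_Cderive (fun y => gamma_integrand c L (- y)) y (- (c * gamma_integrand c L (- y) -
    gamma_integrand (c + 1) L (- y)))%C.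
Proof.
unfold gamma_integrand. solve_Cderive.
replace ((c + 1) * ((- y)%R + L) - Cexp ((- y)%R + L))%C with
  (((- y)%R + L) + (c * ((- y)%R + L) - Cexp ((- y)%R + L)))%C by ring.
rewrite (Cexp_plus ((- y)%R + L)). ring.
Qed.

(** [y] and [s] enter through [y + s * L] only, so the derivative in [s] is [L] times the one in
    [y]; this is what makes the form in [Gamma_ray_rotate] closed. *)
Lemma gamma_integrand_derive_s (c L : C) (y s : R) :
  is_Cderive (fun s => gamma_integrand c (s * L) y) s (L * (c * gamma_integrand c (s * L) y -
    gamma_integrand (c + 1) (s * L) y))%C.
Proof.
unfold gamma_integrand. solve_Cderive.
replace ((c + 1) * (y + s * L) - Cexp (y + s * L))%C with
  ((y + s * L) + (c * (y + s * L) - Cexp (y + s * L)))%C by ring.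
rewrite (Cexp_plus (y + s * L)). ring.
Qed.

(** With [g] the integrand at [y + s * L], the form [g dy + L g ds] is closed; moving [s] from 0 to
    1 does not change the integral over the whole line, since [g] decays at both ends uniformly in
    [s]. *)
Lemma Gamma_ray_rotate (c L : C) : 0 < Re c -> - PI / 2 < Im L < PI / 2 ->
  Gamma_ray c L = Gamma_ray c 0.
Proof.
intros hc hL.
pose proof (Re_Cexp_ray L 1 hL ltac:(lra)) as h1.
assert (h0 : 0 < Re (Cexp 0)) by (rewrite Cexp_0; simpl; lra).
rewrite Cmult_1_l in h1.
set (k := exp (- Rabs (Re L)) * cos (Im L)) in *.
set (m := Rabs (Re (c * L))).
assert (hz : is_half_line_int (fun y => (gamma_integrand c (RtoC 1 * L) y + gamma_integrand c (RtoC
  1 * L) (- y))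
   - (gamma_integrand c (RtoC 0 * L) y + gamma_integrand c (RtoC 0 * L) (- y)))%C (RtoC 0)).
{ apply (half_line_int_closed_form (fun y s => gamma_integrand c (s * L) y + gamma_integrand c (s *
  L) (- y))%C
    (fun y s => L * (gamma_integrand c (s * L) y - gamma_integrand c (s * L) (- y)))%C
    (fun y s => L * ((c * gamma_integrand c (s * L) y - gamma_integrand (c + 1) (s * L) y)
      + (c * gamma_integrand c (s * L) (- y) - gamma_integrand (c + 1) (s * L) (- y))))%C 0 1
    (Cmod L * (exp (m + (Re c + 1) * (Re c + 1) / k) + exp m)) (Rmin 1 (Re c))).
  - lra.
  - intros y s. unfold gamma_integrand. solve_continuous.
  - intros y s. unfold gamma_integrand. solve_continuous.
  - intros y s. unfold gamma_integrand. solve_continuous.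
  - now apply Rmin_1_pos.
  - intros y s _. eapply is_Cderive_eq; [apply is_Cderive_plus; apply gamma_integrand_derive_s |
    ring].
  - intros y s _. eapply is_Cderive_eq.
    + apply is_Cderive_mult; [apply is_Cderive_const |].
      apply is_Cderive_minus; [apply gamma_integrand_derive_y | apply gamma_integrand_opp_derive_y].
    + cbv beta. ring.
  (* The two half-lines contribute opposite terms at [y = 0], which cancel. *)
  - intros s. rewrite Ropp_0. ring.
  - intros y s hy hs. rewrite Cmod_mult, Rmult_assoc.
    apply Rmult_le_compat_l; [apply Cmod_ge_0 |].
    eapply Rle_trans; [apply Cmod_triangle |]. rewrite Cmod_opp.
    apply gamma_integrand_sym_bound; [lra | now apply Re_Cexp_ray | | exact hy].
    unfold m. replace (c * (s * L))%C with (s * (c * L))%C by ring.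
    rewrite Re_mult, Re_RtoC, Im_RtoC. unfold Rabs; destruct Rcase_abs; nra. }
rewrite Cmult_1_l, Cmult_0_l in hz.
assert (hd := is_half_line_int_minus _ _ _ _ (gamma_integrand_sym_continuous c L)
  (gamma_integrand_sym_continuous c 0)
  (Gamma_ray_correct c L hc ltac:(lra)) (Gamma_ray_correct c 0 hc h0)).
assert (he : (Gamma_ray c L - Gamma_ray c 0 = 0)%C).
{ apply (is_half_line_int_unique _ _ _ (fun y => continuous_Cminus _ _ _
  (gamma_integrand_sym_continuous c L y) (gamma_integrand_sym_continuous c 0 y)) hd hz). }
replace (Gamma_ray c L) with ((Gamma_ray c L - Gamma_ray c 0) + Gamma_ray c 0)%C by ring.
  rewrite he. ring.
Qed.

Lemma CGamma_rotate (c L : C) : 0 < Re c -> - PI / 2 < Im L < PI / 2 -> Gamma_ray c L = CGamma c.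
Proof. intros hc hL. now rewrite CGamma_eq_Gamma_ray, Gamma_ray_rotate. Qed.

(** Integration by parts: integrating [gamma_integrand_derive_y] over the half-line leaves only the
    boundary value at [y = 0], which is [S^c e^(-S)] with [S = e^L]. *)
Lemma upper_Gamma_rec (c L : C) : 0 < Re (Cexp L) ->
  upper_Gamma (c + 1) L = (c * upper_Gamma c L + gamma_integrand c L 0)%C.
Proof.
intros hL.
assert (h1 := is_half_line_int_derive (gamma_integrand c L) _ (exp (Re (c * L) + (Re c + 1) * (Re c
  + 1) / Re (Cexp L))) 1
  ltac:(lra) (fun y => continuous_Cminus _ _ _
     (continuous_Cmult _ _ _ (continuous_const c y) (gamma_integrand_continuous c L y))
       (gamma_integrand_continuous (c + 1) L y))
  (fun y _ => gamma_integrand_derive_y c L y) (fun y hy => gamma_integrand_bound_pos c L _ _ _ y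
    (Rle_refl _) (conj hL (Rle_refl _)) (Rle_refl _) hy)).
assert (h2 := is_half_line_int_minus (fun y => c * gamma_integrand c L y)%C _ _ _ (fun y =>
  continuous_Cmult _ _ _ (continuous_const c y) (gamma_integrand_continuous c L y))
  (gamma_integrand_continuous (c + 1) L) (is_half_line_int_scal c _ _ (gamma_integrand_continuous c
    L) (upper_Gamma_correct c L hL)) (upper_Gamma_correct (c + 1) L hL)).
assert (he := is_half_line_int_unique _ _ _ (fun y => continuous_Cminus _ _ _
     (continuous_Cmult _ _ _ (continuous_const c y) (gamma_integrand_continuous c L y))
       (gamma_integrand_continuous (c + 1) L y)) h1 h2).
replace (upper_Gamma (c + 1) L) with (c * upper_Gamma c L - (c * upper_Gamma c L - upper_Gamma (c +
  1) L))%C by ring.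
rewrite <- he. ring.
Qed.

Lemma lower_Gamma_rec (c L : C) : 0 < Re c -> 0 < Re (Cexp L) ->
  lower_Gamma (c + 1) L = (c * lower_Gamma c L - gamma_integrand c L 0)%C.
Proof.
intros hc hL.
assert (hc1 : 0 < Re (c + 1)) by (rewrite Re_plus, Re_RtoC; lra).
assert (cc : everywhere_continuous (fun y => - (c * gamma_integrand c L (- y) - gamma_integrand (c
  + 1) L (- y)))%C).
{ intros y. unfold gamma_integrand. solve_continuous. }
assert (h1 := is_half_line_int_derive (fun y => gamma_integrand c L (- y)) _ (exp (Re (c * L))) (Re
  c) hc cc
  (fun y _ => gamma_integrand_opp_derive_y c L y) (fun y hy => gamma_integrand_bound_neg c L _ _ y
    (Rle_refl _) (Rlt_le _ _ hL) (Rle_refl _) hy)).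
assert (h2 := is_half_line_int_opp (fun y => c * gamma_integrand c L (- y) - gamma_integrand (c +
  1) L (- y))%C _
  (fun y => continuous_Cminus _ _ _
     (continuous_Cmult _ _ _ (continuous_const c y) (gamma_integrand_opp_continuous c L y))
       (gamma_integrand_opp_continuous (c + 1) L y))
  (is_half_line_int_minus (fun y => c * gamma_integrand c L (- y))%C _ _ _
  (fun y => continuous_Cmult _ _ _ (continuous_const c y) (gamma_integrand_opp_continuous c L y))
  (gamma_integrand_opp_continuous (c + 1) L) (is_half_line_int_scal c _ _
    (gamma_integrand_opp_continuous c L) (lower_Gamma_correct c L hc hL)) (lower_Gamma_correct (c +
      1) L hc1 hL))).
assert (he := is_half_line_int_unique _ _ _ cc h1 h2). simpl in he. rewrite Ropp_0 in he.
replace (lower_Gamma (c + 1) L) with (c * lower_Gamma c L + - (c * lower_Gamma c L - lower_Gamma (c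
  + 1) L))%C by ring.
rewrite <- he. ring.
Qed.

Lemma CGamma_rec (c : C) : 0 < Re c -> CGamma (c + 1) = (c * CGamma c)%C.
Proof.
intros hc.
assert (h0 : 0 < Re (Cexp 0)) by (rewrite Cexp_0; simpl; lra).
assert (hc1 : 0 < Re (c + 1)) by (rewrite Re_plus, Re_RtoC; lra).
rewrite !CGamma_eq_Gamma_ray, !Gamma_ray_split, upper_Gamma_rec, lower_Gamma_rec by assumption.
  ring.
Qed.

(** * The integral of 2 cosh (u y) / (1 + cosh y) *)

Lemma cosh2_sub_sinh2 (y : R) : cosh y * cosh y - sinh y * sinh y = 1.
Proof.
unfold cosh, sinh. assert (exp y * exp (- y) = 1) by (rewrite <- exp_plus, Rplus_opp_r;
  apply exp_0).
nra.
Qed.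

Lemma cosh_ge_1 (y : R) : 1 <= cosh y.
Proof.
pose proof (cosh2_sub_sinh2 y). pose proof (exp_pos y). pose proof (exp_pos (- y)).
assert (0 < cosh y) by (unfold cosh; lra). nra.
Qed.

Lemma cosh_ge_exp (y : R) : exp y / 2 <= cosh y.
Proof. unfold cosh. pose proof (exp_pos (- y)). lra. Qed.

Definition poisson_den (y t : R) : R := cosh y + cos t.

(* The Poisson kernel of the strip [|t| < PI], harmonic in [(y, t)]. *)
Definition poisson (y t : R) : R := sin t * / poisson_den y t.
Definition poisson_t (y t : R) : R := (cos t * poisson_den y t + sin t * sin t) * / (poisson_den y
  t * poisson_den y t).
Definition poisson_y (y t : R) : R := - (sin t * sinh y * / (poisson_den y t * poisson_den y t)).
Definition poisson_tt (y t : R) : R :=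
  sin t * (2 * (cos t * poisson_den y t + sin t * sin t) - cosh y * poisson_den y t) * /
    (poisson_den y t * poisson_den y t * poisson_den y t).

Lemma poisson_derive_t (y t : R) : poisson_den y t <> 0 -> is_derive (fun t => poisson y t) t
  (poisson_t y t).
Proof.
intros h. unfold poisson, poisson_t, poisson_den in *. auto_derive; [exact h |]. field. exact h.
Qed.

Lemma poisson_t_derive_t (y t : R) : poisson_den y t <> 0 -> is_derive (fun t => poisson_t y t) t
  (poisson_tt y t).
Proof.
intros h. unfold poisson_t, poisson_tt, poisson_den in *.
auto_derive; [now apply Rmult_integral_contrapositive |]. field. exact h.
Qed.

Lemma poisson_derive_y (y t : R) : poisson_den y t <> 0 -> is_derive (fun y => poisson y t) y
  (poisson_y y t).
Proof.
intros h. unfold poisson, poisson_y, poisson_den, cosh, sinh in *. auto_derive; [exact h |]. field.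
replace (exp y + exp (- y) + 2 * cos t) with (2 * ((exp y + exp (- y)) / 2 + cos t)) by field. lra.
Qed.

(** This is harmonicity; it reduces to the identities [cosh^2 - sinh^2 = 1] and
    [sin^2 + cos^2 = 1]. *)
Lemma poisson_y_derive_y (y t : R) : poisson_den y t <> 0 -> is_derive (fun y => poisson_y y t) y
  (- poisson_tt y t).
Proof.
intros h.
replace (- poisson_tt y t) with
  (- (sin t * (cosh y * poisson_den y t - 2 * (sinh y * sinh y)) * / (poisson_den y t * poisson_den
    y t * poisson_den y t))).
- unfold poisson_y, poisson_den, cosh, sinh in *. auto_derive;
  [now apply Rmult_integral_contrapositive |]. field.
  replace (exp y + exp (- y) + 2 * cos t) with (2 * ((exp y + exp (- y)) / 2 + cos t)) by field.
    lra.
- unfold poisson_tt. apply f_equal, (f_equal (fun z => sin t * z * _)).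
  replace (sinh y * sinh y) with (cosh y * cosh y - 1) by (pose proof (cosh2_sub_sinh2 y); lra).
  pose proof (sin2_cos2 t) as h2. unfold Rsqr in h2. unfold poisson_den. nra.
Qed.

Definition two_cosh (u : C) (y : R) : C := (Cexp (u * y) + Cexp (- (u * y)))%C.
Definition two_sinh (u : C) (y : R) : C := (Cexp (u * y) - Cexp (- (u * y)))%C.

(** [2 i sin(u (t0 - t))], which vanishes on the side [t = t0]; there Green's identity keeps
    [poisson] and loses its normal derivative. *)
Definition two_i_sin (u : C) (t0 t : R) : C :=
  (Cexp (Ci * u * (t0 - t)) - Cexp (- (Ci * u * (t0 - t))))%C.
Definition two_i_sin' (u : C) (t0 t : R) : C :=
  (- (Ci * u) * (Cexp (Ci * u * (t0 - t)) + Cexp (- (Ci * u * (t0 - t)))))%C.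

Lemma Ci_sqr : (Ci * Ci)%C = (- (1))%C.
Proof. unfold Ci, Cmult, Copp, RtoC; simpl. f_equal; ring. Qed.

Lemma two_cosh_derive (u : C) (y : R) : is_Cderive (fun y => two_cosh u y) y (u * two_sinh u y)%C.
Proof. unfold two_cosh, two_sinh. solve_Cderive. ring. Qed.

Lemma two_sinh_derive (u : C) (y : R) : is_Cderive (fun y => two_sinh u y) y (u * two_cosh u y)%C.
Proof. unfold two_cosh, two_sinh. solve_Cderive. ring. Qed.

Lemma two_i_sin_derive (u : C) (t0 t : R) : is_Cderive (fun t => two_i_sin u t0 t) t (two_i_sin' u
  t0 t).
Proof. unfold two_i_sin, two_i_sin'. solve_Cderive. ring. Qed.

Lemma two_i_sin'_derive (u : C) (t0 t : R) : is_Cderive (fun t => two_i_sin' u t0 t) t (- (u * u) *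
  two_i_sin u t0 t)%C.
Proof.
unfold two_i_sin, two_i_sin'. solve_Cderive.
replace (- (u * u))%C with ((Ci * Ci) * (u * u))%C by (rewrite Ci_sqr; ring). ring.
Qed.

(** As [cos t0 <= 0] and [cosh y >= 1], [cos t >= cos t0 >= cos t0 * cosh y]. The sign of [cos t0]
    is the reason for [PI / 2 <= t0]. *)
Lemma poisson_den_lower (y t t0 : R) : PI / 2 <= t0 < PI -> 0 <= t <= t0 ->
  0 < (1 + cos t0) * cosh y <= poisson_den y t.
Proof.
intros h0 ht. pose proof (cosh_ge_1 y).
assert (-1 < cos t0).
{ rewrite <- cos_PI. apply cos_decreasing_1; lra. }
assert (cos t0 <= 0) by (apply cos_le_0; lra).
assert (cos t0 <= cos t) by (apply cos_decr_1; lra).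
unfold poisson_den. split; nra.
Qed.

Lemma Cmod_Cexp_le (z : C) (m : R) : Re z <= m -> Cmod (Cexp z) <= exp m.
Proof. intros h. rewrite Cmod_Cexp. now apply exp_mono. Qed.

Lemma Cmod_Cexp_add_Cexp_opp (z : C) (m : R) : Rabs (Re z) <= m ->
  Cmod (Cexp z) + Cmod (Cexp (- z)) <= 2 * exp m.
Proof.
intros h. apply Rabs_le_between in h.
pose proof (Cmod_Cexp_le z m ltac:(lra)).
pose proof (Cmod_Cexp_le (- z) m ltac:(rewrite Re_opp; lra)). lra.
Qed.

Lemma Rabs_Re_mult_RtoC (u : C) (y : R) : 0 <= y -> Rabs (Re (u * y)) <= Rabs (Re u) * y.
Proof.
intros hy. simpl_Re_Im. rewrite Rmult_0_r, Rminus_0_r, Rabs_mult, (Rabs_pos_eq y) by exact hy.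
apply Rle_refl.
Qed.

Lemma Cmod_two_cosh (u : C) (y : R) : 0 <= y ->
  Cmod (two_cosh u y) <= 2 * exp (Rabs (Re u) * y).
Proof.
intros hy. eapply Rle_trans; [apply Cmod_triangle |].
now apply Cmod_Cexp_add_Cexp_opp, Rabs_Re_mult_RtoC.
Qed.

Lemma Cmod_two_sinh (u : C) (y : R) : 0 <= y ->
  Cmod (two_sinh u y) <= 2 * exp (Rabs (Re u) * y).
Proof.
intros hy. eapply Rle_trans; [apply Cmod_triangle |]. rewrite Cmod_opp.
now apply Cmod_Cexp_add_Cexp_opp, Rabs_Re_mult_RtoC.
Qed.

Lemma Cmod_two_i_sin (u : C) (t0 t : R) : 0 <= t <= t0 ->
  Cmod (two_i_sin u t0 t) <= 2 * exp (Rabs (Im u) * t0).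
Proof.
intros ht. eapply Rle_trans; [apply Cmod_triangle |]. rewrite Cmod_opp.
apply Cmod_Cexp_add_Cexp_opp. simpl_Re_Im. change (Re Ci) with 0. change (Im Ci) with 1.
replace ((0 * Re u - 1 * Im u) * (t0 - t) - (0 * Im u + 1 * Re u) * (0 - 0))
  with (- Im u * (t0 - t)) by ring.
rewrite Rabs_mult, Rabs_Ropp, (Rabs_pos_eq (t0 - t)) by lra.
apply Rmult_le_compat_l; [apply Rabs_pos | lra].
Qed.

Lemma poisson_bound (y t t0 : R) : PI / 2 <= t0 < PI -> 0 <= t <= t0 -> 
  Rabs (poisson y t) <= 2 / (1 + cos t0) * exp (- y) /\
  Rabs (poisson_y y t) <= 4 / ((1 + cos t0) * (1 + cos t0)) * exp (- y).
Proof.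
intros h0 ht. destruct (poisson_den_lower y t t0 h0 ht) as [h1 h2].
destruct (poisson_den_lower 0 t t0 h0 ht) as [h1' _].
pose proof (cosh_ge_1 y). pose proof (cosh_ge_1 0). pose proof (cosh_ge_exp y).
pose proof (exp_pos y). pose proof (exp_pos (- y)).
set (d := 1 + cos t0) in *.
assert (hd : 0 < d) by nra.
assert (hD : d * exp y / 2 <= poisson_den y t) by nra.
assert (hDp : 0 < poisson_den y t) by lra.
assert (hi : / poisson_den y t <= 2 / d * exp (- y)).
{ rewrite exp_Ropp. replace (2 / d * / exp y) with (/ (d * exp y / 2)) by (field; split; lra).
  apply Rinv_le_contravar; [| exact hD]. assert (0 < d * exp y) by (now apply Rmult_lt_0_compat).
    lra. }
assert (hip : 0 < / poisson_den y t) by (now apply Rinv_0_lt_compat).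
assert (hs : Rabs (sin t) <= 1) by (apply Rabs_le; pose proof (SIN_bound t); lra).
assert (hsh : Rabs (sinh y) * / poisson_den y t <= / d).
{ apply Rmult_le_reg_r with (poisson_den y t); [exact hDp |].
  rewrite Rmult_assoc, Rinv_l, Rmult_1_r by lra.
  apply Rle_trans with (cosh y).
  - pose proof (cosh2_sub_sinh2 y). apply Rabs_le. split; nra.
  - apply Rmult_le_reg_l with d; [exact hd |]. rewrite <- Rmult_assoc, Rinv_r, Rmult_1_l by lra.
    exact h2. }
split.
- unfold poisson. rewrite Rabs_mult, (Rabs_pos_eq (/ poisson_den y t)) by lra.
  pose proof (Rabs_pos (sin t)). nra.
- unfold poisson_y. rewrite Rabs_Ropp, Rinv_mult, !Rabs_mult, (Rabs_pos_eq (/ poisson_den y t))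
  by lra.
  pose proof (Rabs_pos (sin t)). pose proof (Rabs_pos (sinh y)).
  replace (4 / (d * d) * exp (- y)) with (2 * (1 * (/ d * (2 / d * exp (- y))))) by (field; lra).
  replace (Rabs (sin t) * Rabs (sinh y) * (/ poisson_den y t * / poisson_den y t))
    with (Rabs (sin t) * ((Rabs (sinh y) * / poisson_den y t) * / poisson_den y t)) by ring.
  assert (0 < / d) by (now apply Rinv_0_lt_compat).
  assert (hq : (Rabs (sinh y) * / poisson_den y t) * / poisson_den y t <= / d * (2 / d * exp (-
    y))).
  { apply Rmult_le_compat; try lra. apply Rmult_le_pos; lra. }
  assert (0 <= (Rabs (sinh y) * / poisson_den y t) * / poisson_den y t)
    by (repeat apply Rmult_le_pos; lra).
  nra.
Qed.

(* Green's identity for the harmonic functions [two_cosh u y * two_i_sin u t0 t] and [poisson]. *)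
Lemma Poisson_identity (u : C) (t0 : R) : Rabs (Re u) < 1 -> PI / 2 <= t0 < PI ->
  is_half_line_int (fun y => 2 * Ci * u * (two_cosh u y * poisson y t0) - two_i_sin u t0 0 *
    (two_cosh u y * / (1 + cosh y)%R))%C (RtoC 0).
Proof.
intros hu h0.
assert (hpi := PI_RGT_0).
set (d := 1 + cos t0).
set (Ks := 2 * exp (Rabs (Im u) * t0)).
assert (hDn : forall y t, poisson_den y (clamp 0 t0 t) <> 0).
{ intros y t. pose proof (poisson_den_lower y _ t0 h0 (clamp_in 0 t0 t ltac:(lra))). lra. }
apply (is_half_line_int_ext (fun y => two_cosh u y * (poisson_t y t0 * two_i_sin u t0 t0 - poisson
  y t0 * two_i_sin' u t0 t0)
   - two_cosh u y * (poisson_t y 0 * two_i_sin u t0 0 - poisson y 0 * two_i_sin' u t0 0))%C).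
(* On the side [t = t0] the sine factor vanishes. On the side [t = 0] it is [poisson] that vanishes,
   and [poisson_t] equals [1 / (1 + cosh y)]. *)
{ intros y. pose proof (cosh_ge_1 y).
  replace (two_i_sin u t0 t0) with (RtoC 0).
  2:{ unfold two_i_sin. replace (t0 - t0)%C with (RtoC 0) by ring.
      rewrite !Cmult_0_r, Copp_0. ring. }
  replace (two_i_sin' u t0 t0) with (- (2 * Ci * u))%C.
  2:{ unfold two_i_sin'. replace (t0 - t0)%C with (RtoC 0) by ring.
      rewrite !Cmult_0_r, Copp_0, Cexp_0. ring. }
  replace (poisson_t y 0) with (/ (1 + cosh y)).
  2:{ unfold poisson_t, poisson_den. rewrite cos_0, sin_0. field. lra. }
  replace (poisson y 0) with 0.
  2:{ unfold poisson. rewrite sin_0. ring. }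
  rewrite RtoC_inv by lra. ring. }
apply (half_line_int_closed_form (fun y t => two_cosh u y * (poisson_t y t * two_i_sin u t0 t -
  poisson y t * two_i_sin' u t0 t))%C
  (fun y t => - (two_cosh u y * poisson_y y t - u * two_sinh u y * poisson y t) * two_i_sin u t0
    t)%C
  (fun y t => two_cosh u y * (poisson_tt y t + u * u * poisson y t) * two_i_sin u t0 t)%C
  0 t0 ((2 * (4 / (d * d)) + Cmod u * 2 * (2 / d)) * Ks) (1 - Rabs (Re u))).
- lra.
- intros y t. unfold two_cosh, poisson_t, poisson, two_i_sin, two_i_sin', poisson_den, cosh, Rdiv.
  solve_continuous;
  cbn [fst snd]; repeat apply Rmult_integral_contrapositive_currified; apply hDn.
- intros y t. unfold two_cosh, two_sinh, poisson_y, poisson, two_i_sin, two_i_sin', poisson_den,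
  cosh, sinh, Rdiv. solve_continuous;
  cbn [fst snd]; repeat apply Rmult_integral_contrapositive_currified; apply hDn.
- intros y t. unfold two_cosh, two_sinh, poisson_tt, poisson, two_i_sin, two_i_sin', poisson_den,
  cosh, sinh, Rdiv. solve_continuous;
  cbn [fst snd]; repeat apply Rmult_integral_contrapositive_currified; apply hDn.
- lra.
- intros y t ht. pose proof (poisson_den_lower y t t0 h0 ht).
  assert (hD : poisson_den y t <> 0) by lra.
  pose proof (is_Cderive_RtoC _ _ _ (poisson_derive_t y t hD)) as d1.
  pose proof (is_Cderive_RtoC _ _ _ (poisson_t_derive_t y t hD)) as d2.
  eapply is_Cderive_eq.
  + apply (is_Cderive_mult (fun _ => two_cosh u y)); [apply is_Cderive_const |].
    apply (is_Cderive_minus (fun t => poisson_t y t * two_i_sin u t0 t)%C (fun t => poisson y t *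
      two_i_sin' u t0 t)%C);
    apply is_Cderive_mult; try eassumption; [apply two_i_sin_derive | apply two_i_sin'_derive].
  + cbv beta. ring.
- intros y t ht. pose proof (poisson_den_lower y t t0 h0 ht).
  assert (hD : poisson_den y t <> 0) by lra.
  pose proof (is_Cderive_RtoC _ _ _ (poisson_derive_y y t hD)) as d1.
  pose proof (is_Cderive_RtoC _ _ _ (poisson_y_derive_y y t hD)) as d2.
  eapply is_Cderive_eq.
  + apply (is_Cderive_mult (fun y => - (two_cosh u y * poisson_y y t - u * two_sinh u y * poisson y
    t))%C); [| apply is_Cderive_const].
    apply is_Cderive_opp, is_Cderive_minus.
    * apply is_Cderive_mult; [apply two_cosh_derive | eassumption].
    * apply (is_Cderive_mult (fun y => u * two_sinh u y)%C); [| eassumption].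
      apply is_Cderive_mult; [apply is_Cderive_const | apply two_sinh_derive].
  + cbv beta. rewrite RtoC_opp. ring.
- intros t. unfold poisson_y, two_sinh, sinh. replace (- (u * 0))%C with (u * 0)%C by ring.
  rewrite Ropp_0.
  replace (- (sin t * ((exp 0 - exp 0) / 2) * / (poisson_den 0 t * poisson_den 0 t))) with 0.
  + ring.
  + replace (exp 0 - exp 0) with 0 by ring. unfold Rdiv. ring.
- intros y t hy ht. destruct (poisson_bound y t t0 h0 ht) as [b1 b2]. fold d in b1, b2.
  rewrite Cmod_mult.
  replace ((2 * (4 / (d * d)) + Cmod u * 2 * (2 / d)) * Ks * exp (- (1 - Rabs (Re u)) * y))
    with ((2 * exp (Rabs (Re u) * y) * (4 / (d * d) * exp (- y)) + Cmod u * (2 * exp (Rabs (Re u) *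
      y)) * (2 / d * exp (- y))) * Ks).
  2:{ replace (- (1 - Rabs (Re u)) * y) with (Rabs (Re u) * y + - y) by ring. rewrite exp_plus.
    ring. }
  apply Rmult_le_compat; try apply Cmod_ge_0; [| now apply Cmod_two_i_sin].
  rewrite Cmod_opp. eapply Rle_trans; [apply Cmod_triangle |]. rewrite Cmod_opp, !Cmod_mult,
    !Cmod_R.
  apply Rplus_le_compat; repeat apply Rmult_le_compat; try apply Cmod_ge_0; try apply Rabs_pos;
    try assumption; try (apply Rmult_le_pos; apply Cmod_ge_0); try apply Rle_refl.
  + now apply Cmod_two_cosh.
  + now apply Cmod_two_sinh.
Qed.

(** [e^z - 1] is the integral of [z e^(t z)] over [0 <= t <= 1]. *)
Lemma Cmod_Cexp_sub_1 (z : C) : Cmod (Cexp z - 1) <= Cmod z * exp (Rmax 0 (Re z)).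
Proof.
assert (h : is_CInt (fun t => z * Cexp (t * z))%C 0 1 (Cexp (1 * z) - Cexp (0 * z))%C).
{ apply (is_CInt_derive (fun t => Cexp (t * z))).
  - intros t. solve_Cderive. ring.
  - intros t. solve_continuous. }
rewrite Cmult_1_l, Cmult_0_l, Cexp_0 in h.
replace (Cmod z * exp (Rmax 0 (Re z))) with (Rabs (1 - 0) * (Cmod z * exp (Rmax 0 (Re z)))).
2:{ rewrite Rminus_0_r, Rabs_R1. ring. }
apply (Cmod_CInt_const (fun t => z * Cexp (t * z))%C); [| exact h].
rewrite Rmin_left, Rmax_right by lra. intros t ht.
rewrite Cmod_mult. apply Rmult_le_compat_l; [apply Cmod_ge_0 |].
apply Cmod_Cexp_le. simpl_Re_Im. pose proof (Rmax_l 0 (Re z)). pose proof (Rmax_r 0 (Re z)). nra.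
Qed.

(* With [s = y / 2], both sides are squares: [e^(us) - e^(-us)] against
   [(2 |u| / eta) e^(- eta s) (e^s - e^(-s))]. *)
Lemma two_cosh_sub_2_bound (u : C) (eta y : R) : 0 <= y -> 0 < eta -> Rabs (Re u) + 2 * eta = 1 ->
  Cmod (two_cosh u y - 2) <= 8 * (Cmod u * Cmod u) / (eta * eta) * exp (- eta * y) * (cosh y - 1).
Proof.
intros hy he hp. set (s := y / 2). set (p := Rabs (Re u)) in *.
assert (hp0 : 0 <= p) by apply Rabs_pos.
assert (hs : 0 <= s) by (unfold s; lra).
set (D := (Cexp (u * s) - Cexp (- (u * s)))%C).
assert (hD : Cmod D <= 2 * Cmod u * (s * exp (p * s))).
{ replace D with (Cexp (- (u * s)) * (Cexp ((2 * s)%R * u) - 1))%C.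
  2:{ unfold D. rewrite RtoC_mult. replace (2 * s * u)%C with (u * s + u * s)%C by ring.
      rewrite Cexp_plus, Cexp_opp. field. apply Cexp_neq_0. }
  rewrite Cmod_mult.
  eapply Rle_trans.
  { apply Rmult_le_compat_l; [apply Cmod_ge_0 | apply Cmod_Cexp_sub_1]. }
  rewrite Cmod_Cexp, Cmod_mult, Cmod_R, Rabs_pos_eq by lra. simpl_Re_Im.
  replace (exp (- (Re u * s - Im u * 0)) * (2 * s * Cmod u * exp (Rmax 0 (2 * s * Re u - 0 * Im
    u))))
    with (2 * Cmod u * (s * (exp (- (Re u * s - Im u * 0)) * exp (Rmax 0 (2 * s * Re u - 0 * Im
      u))))) by ring.
  rewrite <- exp_plus.
  pose proof (Cmod_ge_0 u).
  apply Rmult_le_compat_l; [lra |]. apply Rmult_le_compat_l; [exact hs |]. apply exp_mono.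
  unfold p. unfold Rmax, Rabs; destruct Rle_dec, Rcase_abs; nra. }
(* As [p = 1 - 2 eta], the claim is [eta s e^s <= e^(eta s) (e^s - e^(-s))]. After multiplication by
   [1 + 2 s], [e1] bounds the difference below by [2 s e^s], [e2] bounds [e^(eta s)] below by
   [1 + eta s], and [eta <= 1 / 2] concludes. *)
assert (hS : s * exp (p * s) <= / eta * (exp (- eta * s) * (exp s - exp (- s)))).
{ assert (e1 : exp (- s) * (1 + 2 * s) <= exp s).
  { replace (exp s) with (exp (- s) * exp (2 * s)) by (rewrite <- exp_plus; f_equal; ring).
    apply Rmult_le_compat_l; [apply Rlt_le, exp_pos | apply exp_ineq1_le]. }
  assert (e2 : 1 + eta * s <= exp (eta * s)) by apply exp_ineq1_le.
  replace (exp (p * s)) with (exp (- eta * s) * (exp s * exp (- (eta * s)))).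
  2:{ rewrite <- !exp_plus. f_equal. replace p with (1 - 2 * eta) by lra. ring. }
  rewrite exp_Ropp.
  replace (exp (- eta * s) * (exp s - exp (- s))) with
    (exp (- eta * s) * ((exp s - exp (- s)) * 1)) by ring.
  pose proof (exp_pos (eta * s)). pose proof (exp_pos s). pose proof (exp_pos (- s)).
  pose proof (exp_pos (- eta * s)).
  apply Rmult_le_reg_l with eta; [exact he |].
  apply Rmult_le_reg_r with (exp (eta * s) * (1 + 2 * s)); [nra |].
  replace (eta * (s * (exp (- eta * s) * (exp s * / exp (eta * s)))) * (exp (eta * s) * (1 + 2 *
    s)))
    with (exp (- eta * s) * (exp s * (eta * s * (1 + 2 * s)))) by (field; lra).
  replace (eta * (/ eta * (exp (- eta * s) * ((exp s - exp (- s)) * 1))) * (exp (eta * s) * (1 + 2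
    * s)))
    with (exp (- eta * s) * (exp (eta * s) * (exp s * (1 + 2 * s) - exp (- s) * (1 + 2 * s))))
      by (field; lra).
  apply Rmult_le_compat_l; [lra |].
  assert (e3 : 2 * s * exp s <= exp s * (1 + 2 * s) - exp (- s) * (1 + 2 * s)) by lra.
  apply Rle_trans with ((1 + eta * s) * (2 * s * exp s)).
  - assert (eta <= 1 / 2) by lra. assert (0 <= s * exp s) by (apply Rmult_le_pos; lra).
    assert (eta * (1 + 2 * s) <= 2 * (1 + eta * s)) by nra. nra.
  - assert (0 <= eta * s) by (apply Rmult_le_pos; lra).
    apply Rmult_le_compat; try lra. apply Rmult_le_pos; lra. }
replace (two_cosh u y - 2)%C with (D * D)%C.
2:{ unfold D, two_cosh. replace (RtoC y) with (RtoC s + RtoC s)%C.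
    - replace (u * (s + s))%C with (u * s + u * s)%C by ring.
      rewrite !Cexp_opp, Cexp_plus. pose proof (Cexp_neq_0 (u * s)). field. assumption.
    - rewrite <- RtoC_plus. f_equal. unfold s. field. }
rewrite Cmod_mult.
set (A := s * exp (p * s)) in *. set (B := exp (- eta * s) * (exp s - exp (- s))) in *.
assert (hB : B * B = 2 * exp (- eta * y) * (cosh y - 1)).
{ unfold B, cosh. replace y with (s + s) by (unfold s; field).
  replace (- eta * (s + s)) with (- eta * s + - eta * s) by ring.
  replace (- (s + s)) with (- s + - s) by ring. rewrite !exp_plus.
  assert (exp s * exp (- s) = 1) by (rewrite <- exp_plus, Rplus_opp_r; apply exp_0). nra. }
replace (8 * (Cmod u * Cmod u) / (eta * eta) * exp (- eta * y) * (cosh y - 1))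
  with ((2 * Cmod u * (/ eta * B)) * (2 * Cmod u * (/ eta * B))).
2:{ replace ((2 * Cmod u * (/ eta * B)) * (2 * Cmod u * (/ eta * B)))
      with (4 * (Cmod u * Cmod u) / (eta * eta) * (B * B)) by (field; lra).
    rewrite hB. field. lra. }
pose proof (Cmod_ge_0 u). pose proof (Cmod_ge_0 D).
apply Rmult_le_compat; try assumption;
(eapply Rle_trans; [exact hD | apply Rmult_le_compat_l; [lra | exact hS]]).
Qed.

(** * Total mass and concentration of the Poisson kernel *)

Lemma is_derive_atan (x : R) : is_derive atan x (/ (1 + x * x)).
Proof.
replace (1 + x * x) with (1 + x ^ 2) by ring. apply is_derive_Reals, derivable_pt_lim_atan.
Qed.

Lemma atan_le (x : R) : 0 <= x -> 0 <= atan x <= x.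
Proof.
intros hx.
destruct (MVT_gen atan 0 x (fun z => / (1 + z * z))) as [c [_ hc]].
- intros c _. apply is_derive_atan.
- intros c _. apply derivable_continuous_pt, derivable_pt_atan.
- rewrite atan_0, Rminus_0_r, Rminus_0_r in hc. rewrite hc.
  assert (0 < / (1 + c * c) <= 1).
  { pose proof (Rle_0_sqr c). unfold Rsqr in *. split; [apply Rinv_0_lt_compat; lra |].
    rewrite <- Rinv_1 at 2. apply Rinv_le_contravar; lra. }
  split; nra.
Qed.

Lemma poisson_den_pos (y e : R) : 0 < e <= PI / 2 -> 0 < poisson_den y (PI - e).
Proof.
intros he. pose proof PI_RGT_0.
pose proof (poisson_den_lower y (PI - e) (PI - e) ltac:(lra) ltac:(lra)). lra.
Qed.

Lemma poisson_nonneg (y e : R) : 0 < e <= PI / 2 -> 0 <= poisson y (PI - e).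
Proof.
intros he. pose proof PI_RGT_0. unfold poisson. apply Rmult_le_pos.
- apply sin_ge_0; lra.
- apply Rlt_le, Rinv_0_lt_compat, poisson_den_pos, he.
Qed.

Lemma poisson_continuous (e : R) : 0 < e <= PI / 2 -> everywhere_continuous (fun y => RtoC (poisson
  y (PI - e))).
Proof.
intros he y. unfold poisson, poisson_den, cosh, Rdiv. solve_continuous. apply Rgt_not_eq,
  (poisson_den_pos y e he).
Qed.

(** [atan (sin t / (e^y + cos t))] is, for [y >= 0], the argument of [e^y + e^(i t)]. It falls from
    [t / 2] at [y = 0] to 0 at infinity, and the kernel is -2 times its derivative. *)
Lemma is_half_line_int_poisson (e : R) : 0 < e <= PI / 2 ->
  is_half_line_int (fun y => RtoC (poisson y (PI - e))) (RtoC (PI - e)).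
Proof.
intros he. pose proof PI_RGT_0 as hpi.
set (t := PI - e). assert (ht : PI / 2 <= t < PI) by (unfold t; lra).
set (Q := fun y => - 2 * atan (sin t / (exp y + cos t))).
assert (hc1 : -1 < cos t) by (rewrite <- cos_PI; apply cos_decreasing_1; lra).
assert (hc0 : cos t <= 0) by (apply cos_le_0; lra).
assert (hs : 0 < sin t) by (apply sin_gt_0; lra).
assert (hD : forall y, 0 <= y -> 0 < (1 + cos t) * exp y <= exp y + cos t).
{ intros y hy. pose proof (exp_ineq1_le y). split; nra. }
replace (RtoC t) with (- RtoC (Q 0))%C.
- apply (is_half_line_int_derive (fun y => RtoC (Q y)) _ (2 / (1 + cos t)) 1);
  [lra | now apply poisson_continuous | |].
  + intros y hy. destruct (hD y hy) as [h1 h2].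
    apply is_Cderive_RtoC. unfold Q, poisson, poisson_den, cosh.
    evar_last.
    * apply (is_derive_scal (fun y => atan (sin t / (exp y + cos t)))).
      apply (is_derive_comp atan (fun y => sin t / (exp y + cos t))); [apply is_derive_atan |].
      auto_derive; [lra | reflexivity].
    * unfold scal; simpl; unfold mult; simpl.
      pose proof (exp_pos y). pose proof (sin2_cos2 t) as h3. unfold Rsqr in h3.
      assert (h4 : (exp y + cos t) * (exp y + cos t) + sin t * sin t = exp y * (2 * ((exp y + exp
        (- y)) / 2 + cos t))).
      { assert (exp y * exp (- y) = 1) by (rewrite <- exp_plus, Rplus_opp_r; apply exp_0). nra. }
      assert (h5 : 0 < (exp y + exp (- y)) / 2 + cos t) by (apply (poisson_den_pos y e he)).
      replace (1 + sin t / (exp y + cos t) * (sin t / (exp y + cos t)))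
       with (((exp y + cos t) * (exp y + cos t) + sin t * sin t) / ((exp y + cos t) * (exp y + cos
         t))) by (field; lra).
      rewrite h4. field. lra.
  + intros y hy. destruct (hD y hy) as [h1 h2]. rewrite Cmod_R. unfold Q.
    assert (h3 : 0 <= sin t / (exp y + cos t)) by (apply Rle_mult_inv_pos; lra).
    pose proof (atan_le _ h3) as h4.
    rewrite Rabs_mult, (Rabs_pos_eq (atan _)) by lra.
    replace (Rabs (- 2)) with 2 by (unfold Rabs; destruct Rcase_abs; lra).
    replace (2 / (1 + cos t) * exp (Ropp 1 * y)) with (2 * (1 * / ((1 + cos t) * exp y))).
    2:{ replace (Ropp 1 * y) with (- y) by ring. rewrite exp_Ropp. field. split; [apply Rgt_not_eq,
      exp_pos | lra]. }
    apply Rmult_le_compat_l; [lra |]. eapply Rle_trans; [apply h4 |]. unfold Rdiv.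
    apply Rmult_le_compat; [lra | apply Rlt_le, Rinv_0_lt_compat; lra | apply SIN_bound |].
    apply Rinv_le_contravar; lra.
- rewrite <- RtoC_opp. f_equal. unfold Q. rewrite exp_0.
  replace (sin t / (1 + cos t)) with (tan (t / 2)).
  + rewrite atan_tan by lra. field.
  + replace t with (2 * (t / 2)) at 2 3 by field. rewrite sin_2a, cos_2a_cos. unfold tan.
    assert (0 < cos (t / 2)) by (apply cos_gt_0; lra).
    replace (1 + (2 * cos (t / 2) * cos (t / 2) - 1)) with (2 * cos (t / 2) * cos (t / 2)) by ring.
    field. lra.
Qed.

Definition cosh_quot (u : C) (y : R) : C := (two_cosh u y * / (1 + cosh y)%R)%C.

Lemma cosh_quot_continuous (u : C) : everywhere_continuous (cosh_quot u).
Proof.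
intros y. unfold cosh_quot, two_cosh, cosh, Rdiv. solve_continuous.
intros h. apply (f_equal Re) in h. rewrite !Re_RtoC in h. pose proof (cosh_ge_1 y).
  unfold cosh in *. lra.
Qed.

Lemma cosh_quot_bound (u : C) (y : R) : 0 <= y -> Cmod (cosh_quot u y) <= 4 * exp (- (1 - Rabs (Re
  u)) * y).
Proof.
intros hy. unfold cosh_quot. pose proof (cosh_ge_1 y). pose proof (cosh_ge_exp y).
rewrite <- RtoC_inv, Cmod_mult, Cmod_R by lra.
rewrite Rabs_pos_eq by (apply Rlt_le, Rinv_0_lt_compat; lra).
replace (4 * exp (- (1 - Rabs (Re u)) * y)) with (2 * exp (Rabs (Re u) * y) * / (exp y / 2)).
- apply Rmult_le_compat; [apply Cmod_ge_0 | apply Rlt_le, Rinv_0_lt_compat;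
  lra | now apply Cmod_two_cosh |].
  pose proof (exp_pos y). apply Rinv_le_contravar; lra.
- replace (- (1 - Rabs (Re u)) * y) with (Rabs (Re u) * y + - y) by ring.
  rewrite exp_plus, (exp_Ropp y). pose proof (exp_pos y). field. lra.
Qed.

(** Serves to let [t0 = PI - e] tend to [PI]: estimates are made for [e > 0] only, and continuity
    carries the conclusion to [e = 0]. *)
Lemma eq_0_of_linear_bound (G : R -> C) (K : R) : continuous (U := C_UniformSpace) G 0 ->
  (forall e, 0 < e <= PI / 2 -> Cmod (G e) <= K * e) -> G 0 = 0%C.
Proof.
intros hc hb. apply Cmod_eq_0. apply Rle_antisym; [| apply Cmod_ge_0].
apply le_epsilon. intros eps he. rewrite Rplus_0_l.
pose proof PI_RGT_0.
apply (proj1 (filterlim_C (locally 0) _ _)) with (eps := eps / 2) in hc; [| lra].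
apply locally_R in hc. destruct hc as [d [hd hc]].
(* [K] may be zero or negative, so it is replaced by a constant that can be divided by. *)
set (K' := Rmax K 1). assert (1 <= K') by apply Rmax_r. assert (K <= K') by apply Rmax_l.
set (e := Rmin (PI / 2) (Rmin (d / 2) (eps / 2 / K'))).
assert (h1 : e <= PI / 2) by apply Rmin_l.
assert (h2 : e <= d / 2) by (eapply Rle_trans; [apply Rmin_r | apply Rmin_l]).
assert (h3 : e <= eps / 2 / K') by (eapply Rle_trans; [apply Rmin_r | apply Rmin_r]).
assert (h0 : 0 < e).
{ repeat apply Rmin_glb_lt; try lra. repeat apply Rdiv_lt_0_compat; lra. }
specialize (hc e ltac:(rewrite Rminus_0_r, Rabs_pos_eq; lra)).
specialize (hb e ltac:(lra)).
replace (G 0) with (G e - (G e - G 0))%C by ring.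
eapply Rle_trans; [apply Cmod_triangle |]. rewrite Cmod_opp.
assert (K * e <= eps / 2).
{ apply Rle_trans with (K' * e); [nra |].
  apply Rmult_le_reg_r with (/ K'); [apply Rinv_0_lt_compat; lra |].
  replace (K' * e * / K') with e by (field; lra). exact h3. }
lra.
Qed.

(* As [t0] tends to [PI], [poisson] concentrates at [y = 0] with total mass [t0]. *)
Lemma cosh_quot_value (u : C) : Rabs (Re u) < 1 ->
  (half_line_int (cosh_quot u) * (Cexp (Ci * u * PI) - Cexp (- (Ci * u * PI))))%C = (4 * Ci * u *
    PI)%C.
Proof.
intros hu. pose proof PI_RGT_0 as hpi.
(* Half of the gap, as [two_cosh_sub_2_bound] requires [Rabs (Re u) + 2 * eta = 1]. *)
set (eta := (1 - Rabs (Re u)) / 2).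
assert (heta : 0 < eta) by (unfold eta; lra).
set (K := 8 * (Cmod u * Cmod u) / (eta * eta)).
assert (hK : 0 <= K).
{ unfold K. pose proof (Cmod_ge_0 u). apply Rle_mult_inv_pos; nra. }
set (G := fun e : R => (4 * Ci * u * (PI - e) - two_i_sin u (PI - e)%R 0 * half_line_int (cosh_quot
  u))%C).
assert (hG : G 0 = RtoC 0).
{ apply (eq_0_of_linear_bound G (2 * Cmod u * (K / eta))).
  - unfold G, two_i_sin. solve_continuous.
  - intros e he. set (t := PI - e).
    assert (ht : PI / 2 <= t < PI) by (unfold t; lra).
    assert (hs : 0 <= sin e <= e).
    { split; [apply sin_ge_0; lra | apply Rlt_le, sin_lt_x; lra]. }
    assert (c1 : everywhere_continuous (fun y => (two_cosh u y - 2) * poisson y t)%C).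
    { intros y. apply continuous_Cmult; [unfold two_cosh; solve_continuous |
      apply (poisson_continuous e he)]. }
    assert (b1 : forall y, 0 <= y -> Cmod ((two_cosh u y - 2) * poisson y t) <= (K * sin e) * exp
      (- eta * y)).
    { intros y hy. rewrite Cmod_mult, Cmod_R.
      unfold t. rewrite Rabs_pos_eq by (now apply poisson_nonneg). fold t.
      pose proof (two_cosh_sub_2_bound u eta y hy heta ltac:(unfold eta; field)) as hb.
        fold K in hb.
      pose proof (poisson_den_pos y e he) as hD. fold t in hD.
      pose proof (cosh_ge_1 y).
      (* Since [cos t >= -1], [cosh y - 1 <= poisson_den y t]. The double zero of [two_cosh u y - 2]
         at [y = 0] thus absorbs the concentration of the kernel and leaves the small factor
         [sin e]. *)
      assert (hPi : poisson y t * (cosh y - 1) <= sin e).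
      { unfold poisson. replace (sin t) with (sin e) by (unfold t; now rewrite sin_PI_x).
        apply Rmult_le_reg_r with (poisson_den y t); [exact hD |].
        replace (sin e * / poisson_den y t * (cosh y - 1) * poisson_den y t)
          with (sin e * (cosh y - 1)) by (field; lra).
        apply Rmult_le_compat_l; [lra |]. unfold poisson_den. pose proof (COS_bound t). lra. }
      pose proof (poisson_nonneg y e he) as hP. fold t in hP.
      apply Rle_trans with (K * exp (- eta * y) * (cosh y - 1) * poisson y t).
      + apply Rmult_le_compat_r; assumption.
      + replace (K * exp (- eta * y) * (cosh y - 1) * poisson y t) with
          (K * exp (- eta * y) * (poisson y t * (cosh y - 1))) by ring.
        replace (K * sin e * exp (- eta * y)) with (K * exp (- eta * y) * sin e) by ring.
        apply Rmult_le_compat_l; [| exact hPi]. apply Rmult_le_pos; [exact hK | apply Rlt_le,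
          exp_pos]. }
    pose proof (is_half_line_int_ex _ _ _ c1 heta b1) as isb.
    pose proof (Cmod_half_line_int _ _ _ c1 heta b1) as hb.
    set (A := half_line_int (fun y => (two_cosh u y - 2) * poisson y t)%C) in *.
    assert (cj := cosh_quot_continuous u).
    assert (hj : is_half_line_int (cosh_quot u) (half_line_int (cosh_quot u))).
    { apply (is_half_line_int_ex _ 4 (1 - Rabs (Re u))); [exact cj | lra | intros;
      now apply cosh_quot_bound]. }
    (* [two_cosh] is split into its value 2 at [y = 0], which sees the total mass [t] of the kernel,
       and a remainder whose integral [A] is [O(e)]. *)
    assert (hA : is_half_line_int (fun y => 2 * Ci * u * ((two_cosh u y - 2) * poisson y t)
        + ((4 * Ci * u) * poisson y t + - (two_i_sin u t 0) * cosh_quot u y))%C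
      (2 * Ci * u * A + ((4 * Ci * u) * t + - (two_i_sin u t 0) * half_line_int (cosh_quot u)))%C).
    { apply is_half_line_int_plus; [| | apply is_half_line_int_scal; assumption |].
      + intros y. apply continuous_Cmult; [solve_continuous | apply c1].
      + intros y. apply continuous_Cplus; apply continuous_Cmult;
          [solve_continuous | apply (poisson_continuous e he) | solve_continuous | apply cj].
      + apply is_half_line_int_plus.
        * intros y. apply continuous_Cmult; [solve_continuous | apply (poisson_continuous e he)].
        * intros y. apply continuous_Cmult; [solve_continuous | apply cj].
        * apply is_half_line_int_scal; [apply (poisson_continuous e he) |
          now apply is_half_line_int_poisson].
        * now apply is_half_line_int_scal. }
    assert (hz := Poisson_identity u t hu ht).
    assert (hE : (2 * Ci * u * A + ((4 * Ci * u) * t + - (two_i_sin u t 0) * half_line_int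
      (cosh_quot u)))%C = RtoC 0).
    { apply (is_half_line_int_unique (fun y => 2 * Ci * u * ((two_cosh u y - 2) * poisson y t)
        + ((4 * Ci * u) * poisson y t + - (two_i_sin u t 0) * cosh_quot u y))%C).
      + intros y. apply continuous_Cplus; [| apply continuous_Cplus]; apply continuous_Cmult;
          [solve_continuous | apply c1 | solve_continuous | apply (poisson_continuous e he) |
            solve_continuous | apply cj].
      + exact hA.
      + revert hz. apply is_half_line_int_ext. intros y. unfold cosh_quot. ring. }
    replace (G e) with (- (2 * Ci * u * A))%C.
    2:{ unfold G. fold t.
        replace (PI - e)%C with (RtoC t) by (unfold t; now rewrite RtoC_minus).
        replace (4 * Ci * u * t - two_i_sin u t 0 * half_line_int (cosh_quot u))%C with
         ((2 * Ci * u * A + ((4 * Ci * u) * t + - (two_i_sin u t 0) * half_line_int (cosh_quot u)))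
           - 2 * Ci * u * A)%C by ring.
        rewrite hE. ring. }
    rewrite Cmod_opp, !Cmod_mult, Cmod_R, Rabs_pos_eq by lra.
    replace (Cmod Ci) with 1 by (unfold Cmod, Ci; simpl; replace (0 * (0 * 1) + 1 * (1 * 1)) with 1
      by ring; now rewrite sqrt_1).
    pose proof (Cmod_ge_0 u).
    assert (K * sin e / eta <= K / eta * e).
    { unfold Rdiv. replace (K * / eta * e) with (K * e * / eta) by ring.
      apply Rmult_le_compat_r; [apply Rlt_le, Rinv_0_lt_compat, heta |]. nra. }
    replace (2 * Cmod u * (K / eta) * e) with (2 * 1 * Cmod u * (K / eta * e)) by ring.
    apply Rmult_le_compat_l; [lra |]. eapply Rle_trans; [exact hb | assumption]. }
unfold G, two_i_sin in hG. rewrite !Rminus_0_r in hG.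
replace (PI - 0)%C with (RtoC PI) in hG by ring.
replace (4 * Ci * u * PI)%C with ((4 * Ci * u * PI - (Cexp (Ci * u * PI) - Cexp (- (Ci * u * PI)))
  * half_line_int (cosh_quot u))
  + half_line_int (cosh_quot u) * (Cexp (Ci * u * PI) - Cexp (- (Ci * u * PI))))%C by ring.
rewrite hG. ring.
Qed.

(** * The reflection formula *)

(* At [c = e^s], an antiderivative in [s] of [- e^(2 s) exp(- e^s (1 + e^y))]; at [c = 0], the
   weight [1 / (1 + e^y)^2]. *)
Definition beta_cutoff (y c : R) : R :=
  exp (- (c * (1 + exp y))) * (c * / (1 + exp y) + / ((1 + exp y) * (1 + exp y))).

Definition beta_integrand (u : C) (y c : R) : C := (Cexp ((1 + u) * y) * beta_cutoff y c)%C.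

Lemma beta_cutoff_derive (y s : R) :
  is_derive (fun s => beta_cutoff y (exp s)) s (- (exp (2 * s) * exp (- (exp s * (1 + exp y))))).
Proof.
unfold beta_cutoff. pose proof (exp_pos y). auto_derive; [repeat split; nra |].
replace (2 * s) with (s + s) by ring. rewrite exp_plus. field. lra.
Qed.

(** The variables of the two Gamma integrals are [e^(y + s)] and [e^s], so [e^y] is their ratio. The
    powers of [e^s] involving [u] cancel, and the integral in [s] becomes elementary. *)
Lemma gamma_integrand_mult (u : C) (y s : R) :
  (gamma_integrand (1 + u) s y * gamma_integrand (1 - u) 0 s)%C =
  (Cexp ((1 + u) * y) * (exp (2 * s) * exp (- (exp s * (1 + exp y))))%R)%C.
Proof.
unfold gamma_integrand. rewrite RtoC_mult, <- !Cexp_RtoC, <- !Cexp_plus. f_equal.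
rewrite Cexp_plus, !Cplus_0_r, !Cexp_RtoC, RtoC_opp, !RtoC_mult, RtoC_plus. ring.
Qed.

Lemma beta_integrand_derive (u : C) (y s : R) :
  is_Cderive (fun s => - beta_integrand u y (exp s))%C s (gamma_integrand (1 + u) s y *
    gamma_integrand (1 - u) 0 s)%C.
Proof.
rewrite gamma_integrand_mult. unfold beta_integrand.
pose proof (is_Cderive_RtoC _ _ _ (beta_cutoff_derive y s)) as h.
eapply is_Cderive_eq.
- apply is_Cderive_opp. apply (is_Cderive_mult (fun _ => Cexp ((1 + u) * y)));
  [apply is_Cderive_const | exact h].
- cbv beta. rewrite RtoC_opp. ring.
Qed.

(** With [s = c (1 + e^y)] the cutoff is [(1 + s) e^(-s) / (1 + e^y)^2]; the rate [1 / 2] comes from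
    [1 + s <= 2 e^(s / 2)] and [s >= c]. *)
Lemma beta_cutoff_bound (y c : R) : 0 <= c ->
  0 <= beta_cutoff y c <= 2 * exp (- (1 / 2) * c) * / ((1 + exp y) * (1 + exp y)).
Proof.
intros hc. pose proof (exp_pos y) as hy.
set (s := c * (1 + exp y)). assert (hs : c <= s) by (unfold s; nra).
assert (hg : beta_cutoff y c = exp (- s) * (1 + s) * / ((1 + exp y) * (1 + exp y))).
{ unfold beta_cutoff, s. field. lra. }
rewrite hg.
assert (hi : 0 < / ((1 + exp y) * (1 + exp y))) by (apply Rinv_0_lt_compat; nra).
assert (h1 : 1 + s <= 2 * exp (s / 2)).
{ pose proof (exp_ineq1_le (s / 2)). lra. }
pose proof (exp_pos (- s)).
split; [repeat apply Rmult_le_pos; lra |].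
apply Rmult_le_compat_r; [lra |].
apply Rle_trans with (exp (- s) * (2 * exp (s / 2))); [apply Rmult_le_compat_l; lra |].
replace (exp (- s) * (2 * exp (s / 2))) with (2 * exp (- s + s / 2)) by (rewrite exp_plus; ring).
apply Rmult_le_compat_l; [lra |]. apply exp_mono. lra.
Qed.

Lemma Cmod_beta_integrand (u : C) (y c : R) : 0 <= c ->
  Cmod (beta_integrand u y c) <= 2 * exp (- (1 / 2) * c) * (exp ((1 + Re u) * y) * / ((1 + exp y) *
    (1 + exp y))).
Proof.
intros hc. unfold beta_integrand. rewrite Cmod_mult, Cmod_R, Cmod_Cexp.
destruct (beta_cutoff_bound y c hc) as [h1 h2]. rewrite Rabs_pos_eq by exact h1. simpl_Re_Im.
replace ((1 + Re u) * y - (0 + Im u) * 0) with ((1 + Re u) * y) by ring.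
pose proof (exp_pos ((1 + Re u) * y)).
replace (2 * exp (- (1 / 2) * c) * (exp ((1 + Re u) * y) * / ((1 + exp y) * (1 + exp y))))
  with (exp ((1 + Re u) * y) * (2 * exp (- (1 / 2) * c) * / ((1 + exp y) * (1 + exp y)))) by ring.
apply Rmult_le_compat_l; lra.
Qed.

Lemma beta_integrand_sym_bound (u : C) (y c : R) : 0 <= c -> 0 <= y ->
  Cmod (beta_integrand u y c + beta_integrand u (- y) c) <= 4 * exp (- (1 / 2) * c) * exp (- (1 -
    Rabs (Re u)) * y).
Proof.
intros hc hy. eapply Rle_trans; [apply Cmod_triangle |].
pose proof (Cmod_beta_integrand u y c hc) as h1. pose proof (Cmod_beta_integrand u (- y) c hc) as
  h2.
pose proof (exp_pos y). pose proof (exp_pos (- y)). pose proof (exp_pos (- (1 / 2) * c)).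
pose proof (exp_pos ((1 + Re u) * - y)). pose proof (exp_pos ((1 + Re u) * y)).
assert (a1 : Re u <= Rabs (Re u)) by apply Rle_abs.
assert (a2 : - Re u <= Rabs (Re u)) by (rewrite <- Rabs_Ropp; apply Rle_abs).
assert (b1 : exp ((1 + Re u) * y) * / ((1 + exp y) * (1 + exp y)) <= exp (- (1 - Rabs (Re u)) * y)).
{ apply Rle_trans with (exp ((1 + Re u) * y) * / (exp y * exp y)).
  - apply Rmult_le_compat_l; [lra |]. apply Rinv_le_contravar; nra.
  - rewrite <- exp_plus, <- exp_Ropp, <- exp_plus. apply exp_mono. nra. }
assert (b2 : exp ((1 + Re u) * - y) * / ((1 + exp (- y)) * (1 + exp (- y))) <= exp (- (1 - Rabs (Re
  u)) * y)).
{ apply Rle_trans with (exp ((1 + Re u) * - y) * 1).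
  - apply Rmult_le_compat_l; [lra |]. rewrite <- Rinv_1. apply Rinv_le_contravar; nra.
  - rewrite Rmult_1_r. apply exp_mono. nra. }
nra.
Qed.

Lemma beta_integrand_sym_cont2 (u : C) : continuous2 (fun y c => beta_integrand u y c +
  beta_integrand u (- y) c)%C.
Proof.
intros y c. unfold beta_integrand, beta_cutoff. solve_continuous; cbn [fst snd];
repeat apply Rmult_integral_contrapositive_currified;
match goal with |- context [exp ?z] => pose proof (exp_pos z) end; apply Rgt_not_eq; lra.
Qed.

(** The weight [e^y / (1 + e^y)^2 = 1 / (2 (1 + cosh y))] is even, so folding turns [e^(u y)] into a
    hyperbolic cosine. *)
Lemma beta_integrand_sym_0 (u : C) (y : R) : (beta_integrand u y 0 + beta_integrand u (- y) 0)%C =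
  (/ 2 * cosh_quot u y)%C.
Proof.
unfold beta_integrand, cosh_quot, two_cosh. pose proof (exp_pos y) as hp.
replace (beta_cutoff y 0) with (/ ((1 + exp y) * (1 + exp y))).
2:{ unfold beta_cutoff. rewrite !Rmult_0_l, Ropp_0, exp_0. ring. }
replace (beta_cutoff (- y) 0) with (exp y * exp y * / ((1 + exp y) * (1 + exp y))).
2:{ unfold beta_cutoff. rewrite !Rmult_0_l, Ropp_0, exp_0, exp_Ropp. field. split; lra. }
replace ((1 + u) * (- y)%R)%C with (- (u * y) + - y)%C by (rewrite RtoC_opp; ring).
replace ((1 + u) * y)%C with (u * y + y)%C by ring.
rewrite <- (RtoC_inv (1 + cosh y)) by (pose proof (cosh_ge_1 y); lra).
replace (/ (1 + cosh y)) with (2 * exp y * / ((1 + exp y) * (1 + exp y))).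
2:{ unfold cosh. rewrite exp_Ropp. field. repeat split; nra. }
rewrite !Cexp_plus, <- RtoC_opp, !Cexp_RtoC, exp_Ropp.
rewrite !RtoC_mult. rewrite !RtoC_inv by nra.
assert (RtoC (exp y) <> 0%C) by (intros h; injection h; lra).
assert (RtoC ((1 + exp y) * (1 + exp y)) <> 0%C) by (intros h; injection h; nra).
field. split; assumption.
Qed.

(** The product is a double integral in [y] and [s]. With [s] truncated to [[a, b]] the order can be
    exchanged and the integral in [s] is exact, giving [Phi (e^a) - Phi (e^b)]. As [a -> -oo] and
    [b -> +oo] this tends to [Phi 0], the integral with weight [1 / (1 + e^y)^2]. *)
Lemma CGamma_prod_cosh_quot (u : C) : Rabs (Re u) < 1 ->
  (CGamma (1 + u) * CGamma (1 - u))%C = (/ 2 * half_line_int (cosh_quot u))%C.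
Proof.
intros hu.
apply Rabs_def2 in hu as hu'. destruct hu' as [hu1 hu2].
set (eta := 1 - Rabs (Re u)). assert (he : 0 < eta) by (unfold eta; lra).
(* [Rabs] extends [Phi] to negative [c], so that its continuity at the endpoint 0 is two-sided. *)
set (Phi := fun c => half_line_int (fun y => beta_integrand u y (Rabs c) + beta_integrand u (- y)
  (Rabs c))%C).
assert (cms := beta_integrand_sym_cont2 u).
assert (hP : everywhere_continuous Phi).
{ refine (proj1 (half_line_int_param (fun y c => beta_integrand u y (Rabs c) + beta_integrand u (-
  y) (Rabs c))%C 4 eta _ _ _)).
  - intros y c. apply (continuous2_comp (fun y c => beta_integrand u y c + beta_integrand u (- y)
    c)%C fst (fun p => Rabs (snd p)));
      [exact cms | solve_continuous |].
    apply continuous_Rcomp; [apply Rcontinuity_abs | solve_continuous].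
  - exact he.
  - intros y c hy. eapply Rle_trans; [apply beta_integrand_sym_bound; [apply Rabs_pos |
    exact hy] |].
    fold eta. pose proof (exp_pos (- eta * y)).
    assert (exp (- (1 / 2) * Rabs c) <= 1).
    { apply Rle_trans with (exp 0); [apply exp_mono; pose proof (Rabs_pos c); lra | rewrite exp_0;
      lra]. }
    nra. }
assert (hPc : forall c, 0 <= c -> is_half_line_int (fun y => beta_integrand u y c + beta_integrand
  u (- y) c)%C (Phi c)).
{ intros c hc. unfold Phi. rewrite Rabs_pos_eq by exact hc.
  apply (is_half_line_int_ex _ (4 * exp (- (1 / 2) * c)) eta); [intros y;
    apply (continuous2_l _ c y cms) | exact he |].
  intros y hy. now apply beta_integrand_sym_bound. }
assert (hPb : forall c, 0 <= c -> Cmod (Phi c) <= 4 / eta * exp (- (1 / 2) * c)).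
{ intros c hc. unfold Phi. rewrite Rabs_pos_eq by exact hc.
  replace (4 / eta * exp (- (1 / 2) * c)) with (4 * exp (- (1 / 2) * c) / eta) by (field; lra).
  apply Cmod_half_line_int; [intros y; now apply (continuous2_l _ c y cms) | exact he |].
  intros y hy. now apply beta_integrand_sym_bound. }
assert (hc1 : 0 < Re (1 + u)) by (simpl_Re_Im; lra).
assert (hc2 : 0 < Re (1 - u)) by (simpl_Re_Im; lra).
assert (main : forall a b, a <= b ->
  (CGamma (1 + u) * CInt (gamma_integrand (1 - u) 0) a b)%C = (Phi (exp a) - Phi (exp b))%C).
{ intros a b hab.
  set (f := fun y s : R => ((gamma_integrand (1 + u) s y + gamma_integrand (1 + u) s (- y)) *
    gamma_integrand (1 - u) 0 s)%C).
  set (Sg := Rabs a + Rabs b).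
  assert (hSg : forall s, a <= s <= b -> - Sg <= s <= Sg).
  { intros s hs. unfold Sg, Rabs. destruct Rcase_abs, Rcase_abs; lra. }
  (* The shift of the first variable by [s] leaves its Gamma integral unchanged, by
     [CGamma_rotate]. *)
  assert (hfs : forall s, half_line_int (fun y => f y s) = (CGamma (1 + u) * gamma_integrand (1 -
    u) 0 s)%C).
  { intros s. rewrite <- (CGamma_rotate (1 + u) (RtoC s)).
    - apply half_line_int_unique.
      + intros y. unfold f. apply continuous_Cmult; [apply gamma_integrand_sym_continuous |
        solve_continuous].
      + rewrite Cmult_comm.
        apply (is_half_line_int_ext (fun y => gamma_integrand (1 - u) 0 s * (gamma_integrand (1 +
          u) s y + gamma_integrand (1 + u) s (- y)))%C).
        { intros y. unfold f. ring. }
        apply is_half_line_int_scal; [apply gamma_integrand_sym_continuous |].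
          apply Gamma_ray_correct; [exact hc1 |].
        rewrite Cexp_RtoC. apply exp_pos.
    - exact hc1.
    - pose proof PI_RGT_0. rewrite Im_RtoC. lra. }
  assert (cf : continuous2 f).
  { intros y s. unfold f, gamma_integrand. solve_continuous. }
  assert (hF : is_half_line_int (fun y => CInt (fun s => f y s) a b) (CInt (fun s => half_line_int
    (fun y => f y s)) a b)).
  (* The constants come from [0 < Re (1 + u) < 2], [0 < Re (1 - u) < 2] and [- Sg <= s <= Sg]; in
     particular [e^s >= e^(- Sg)]. *)
  { apply (half_line_int_Fubini f ((exp (2 * Sg + (2 + 1) * (2 + 1) / exp (- Sg)) + exp (2 * Sg)) *
    exp (2 * Sg))
      (Rmin 1 (1 + Re u))); [exact cf | apply Rmin_1_pos; lra | exact hab |].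
    intros y s hy hs. apply hSg in hs. unfold f. rewrite Cmod_mult.
    replace ((exp (2 * Sg + (2 + 1) * (2 + 1) / exp (- Sg)) + exp (2 * Sg)) * exp (2 * Sg) * exp (-
      Rmin 1 (1 + Re u) * y))
      with ((exp (2 * Sg + (2 + 1) * (2 + 1) / exp (- Sg)) + exp (2 * Sg)) * exp (- Rmin 1 (1 + Re
        u) * y) * exp (2 * Sg)) by ring.
    apply Rmult_le_compat; try apply Cmod_ge_0.
    - eapply Rle_trans; [apply Cmod_triangle |].
      apply gamma_integrand_sym_bound; [simpl_Re_Im; lra | | | exact hy].
      + rewrite Cexp_RtoC, Re_RtoC. split; [apply exp_pos |]. apply exp_mono; lra.
      + simpl_Re_Im. nra.
    - rewrite Cmod_gamma_integrand. apply exp_mono. rewrite Cmult_0_r, Cexp_0. simpl_Re_Im.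
      pose proof (exp_pos s). nra. }
  rewrite (CInt_ext _ (fun s => CGamma (1 + u) * gamma_integrand (1 - u) 0 s)%C) in hF by (intros;
    apply hfs).
  rewrite (is_CInt_unique _ _ _ _ (is_CInt_scal (CGamma (1 + u)) _ _ _ _
    (is_CInt_continuous (gamma_integrand (1 - u) 0) a b (gamma_integrand_continuous (1 - u) 0))))
      in hF.
  apply (is_half_line_int_unique (fun y => CInt (fun s => f y s) a b)).
  - intros y. apply (continuous_CInt_param (fun s y => f y s)). now apply continuous2_swap.
  - exact hF.
  - apply (is_half_line_int_ext (fun y => (beta_integrand u y (exp a) + beta_integrand u (- y) (exp
    a)) - (beta_integrand u y (exp b) + beta_integrand u (- y) (exp b)))%C).
    + intros y. symmetry. apply is_CInt_unique.
      replace ((beta_integrand u y (exp a) + beta_integrand u (- y) (exp a)) - (beta_integrand u y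
        (exp b) + beta_integrand u (- y) (exp b)))%C
       with ((- beta_integrand u y (exp b) + - beta_integrand u (- y) (exp b)) - (- beta_integrand
         u y (exp a) + - beta_integrand u (- y) (exp a)))%C by ring.
      apply (is_CInt_derive (fun s => - beta_integrand u y (exp s) + - beta_integrand u (- y) (exp
        s))%C).
      * intros s. eapply is_Cderive_eq; [apply is_Cderive_plus; apply beta_integrand_derive |].
        unfold f. ring.
      * intros s. apply (continuous2_r f s y cf).
    + apply is_half_line_int_minus; try (apply hPc, Rlt_le, exp_pos); intros y;
      apply (continuous2_l _ _ y cms). }
assert (l1 : filterlim (fun ab => (CGamma (1 + u) * CInt (gamma_integrand (1 - u) 0) (fst ab) (snd
  ab))%C) mp_infty
   (Clocally (CGamma (1 + u) * CGamma (1 - u))%C)).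
{ assert (h0 : 0 < Re (Cexp 0)) by (rewrite Cexp_0; simpl; lra).
  rewrite (CGamma_eq_Gamma_ray (1 - u) hc2), (Gamma_ray_split (1 - u) 0 hc2 h0).
  apply (filterlim_comp _ _ _ (fun ab => CInt (gamma_integrand (1 - u) 0) (fst ab) (snd ab))
    (fun z => CGamma (1 + u) * z)%C _ (Clocally (upper_Gamma (1 - u) 0 + lower_Gamma (1 - u) 0)%C)).
  - apply filterlim_mp_infty; [apply gamma_integrand_continuous | now apply upper_Gamma_correct |
    now apply lower_Gamma_correct].
  - apply (continuous_Cmult (T := C_UniformSpace) (fun _ => CGamma (1 + u)) (fun z => z));
      [apply continuous_const | apply continuous_id]. }
assert (l2 : filterlim (fun ab => (CGamma (1 + u) * CInt (gamma_integrand (1 - u) 0) (fst ab) (snd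
  ab))%C) mp_infty
   (Clocally (Phi 0%R - 0)%C)).
{ apply (filterlim_ext_loc (fun ab => Phi (exp (fst ab)) - Phi (exp (snd ab)))%C).
  - apply Filter_prod with (Q := fun a => a < 0) (R := fun b => 0 < b).
    + now exists 0.
    + now exists 0.
    + intros a b ha hb. symmetry. apply main. simpl. lra.
  - apply (filterlim_comp_2 (G := Clocally (Phi 0%R)) (H := Clocally (- 0)%C)
      (fun ab => Phi (exp (fst ab))) (fun ab => - Phi (exp (snd ab)))%C Cplus).
    + apply (filterlim_comp _ _ _ (fun ab : R * R => exp (fst ab)) Phi _ (locally 0)); [| apply hP].
      eapply filterlim_comp; [apply filterlim_fst | exact is_lim_exp_m].
    + rewrite Copp_0. eapply (filterlim_comp _ _ _ (fun ab : R * R => snd ab) (fun b => - Phi (exp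
      b))%C);
        [apply filterlim_snd |].
      apply filterlim_C; [apply Rbar_locally_filter |]. intros eps hp.
      destruct (exp_tail_small (4 / eta) (1 / 2) eps ltac:(lra) hp) as [M [hM HM]].
      generalize (p_infty_ge M). apply filter_imp. intros b hb.
      replace (- Phi (exp b) - 0)%C with (- Phi (exp b))%C by ring. rewrite Cmod_opp.
      eapply Rle_lt_trans; [apply hPb, Rlt_le, exp_pos |].
      apply HM. pose proof (exp_ineq1_le b). lra.
    + exact (filterlim_plus (V := C_R_NormedModule) (Phi 0) (- 0)%C). }
assert (hu0 : (CGamma (1 + u) * CGamma (1 - u))%C = (Phi 0%R - 0)%C).
{ exact (filterlim_locally_unique (V := C_R_NormedModule) (F := mp_infty) _ _ _ l1 l2). }
rewrite hu0. replace (Phi 0%R - 0)%C with (Phi 0%R) by ring.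
apply (is_half_line_int_unique (fun y => beta_integrand u y 0 + beta_integrand u (- y) 0)%C).
- intros y. apply (continuous2_l _ _ y cms).
- apply hPc. lra.
- apply (is_half_line_int_ext (fun y => / 2 * cosh_quot u y)%C).
  + intros y. symmetry. apply beta_integrand_sym_0.
  + apply is_half_line_int_scal; [apply cosh_quot_continuous |].
    apply (is_half_line_int_ex _ 4 eta); [apply cosh_quot_continuous | exact he |]. intros y hy.
      now apply cosh_quot_bound.
Qed.

(** The product form avoids a division by the sine, which vanishes at [u = 0]. *)
Lemma CGamma_reflection (u : C) : Rabs (Re u) < 1 ->
  (CGamma (1 + u) * CGamma (1 - u) * Csin (u * PI))%C = (u * PI)%C.
Proof.
intros hu. rewrite CGamma_prod_cosh_quot by exact hu. pose proof (cosh_quot_value u hu) as h.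
unfold Csin. replace (Ci * (u * PI))%C with (Ci * u * PI)%C by ring.
assert (hC : Ci <> 0%C) by (intros e; injection e; lra).
replace (/ 2 * half_line_int (cosh_quot u) * ((Cexp (Ci * u * PI) - Cexp (- (Ci * u * PI))) / (2 *
  Ci)))%C
  with (half_line_int (cosh_quot u) * (Cexp (Ci * u * PI) - Cexp (- (Ci * u * PI))) / (4 * Ci))%C
    by (field; assumption).
rewrite h. field. exact hC.
Qed.

(** * The reciprocal Gamma function *)

(** The part beyond [t = 1] is the recurrence at [c = 0]. The part before it cannot use
    [lower_Gamma_rec], which needs [0 < Re c]; its antiderivative [exp (- e^(-y))] is lowered by 1
    so as to decay. *)
Lemma CGamma_1 : CGamma 1 = 1%C.
Proof.
assert (h0 : 0 < Re (Cexp 0)) by (rewrite Cexp_0; simpl; lra).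
assert (h1 : 0 < Re 1) by (simpl; lra).
rewrite CGamma_eq_Gamma_ray, Gamma_ray_split by assumption.
replace (upper_Gamma 1 0) with (gamma_integrand 0 0 0).
2:{ replace (RtoC 1) with (0 + 1)%C by ring. rewrite upper_Gamma_rec by exact h0. ring. }
assert (hl : is_half_line_int (fun y => gamma_integrand 1 0 (- y)) (- (gamma_integrand 0 0 (- 0) -
  1))%C).
{ apply (is_half_line_int_derive (fun y => gamma_integrand 0 0 (- y) - 1)%C _ 1 1);
  [lra | apply gamma_integrand_opp_continuous | |].
  - intros y _. eapply is_Cderive_eq;
      [apply is_Cderive_minus; [apply gamma_integrand_opp_derive_y | apply is_Cderive_const] |].
    replace (0 + 1)%C with (RtoC 1) by ring. ring.
  - intros y _. unfold gamma_integrand. rewrite Cplus_0_r, Cmult_0_l, Cexp_RtoC.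
    replace (0 - exp (- y))%C with (RtoC (- exp (- y))) by (rewrite RtoC_opp; ring).
    rewrite Cexp_RtoC, <- RtoC_minus, Cmod_R.
    pose proof (exp_ineq1_le (- exp (- y))). pose proof (exp_pos (- y)).
    assert (exp (- exp (- y)) <= 1) by (rewrite <- exp_0; apply exp_mono; lra).
    replace (Ropp 1 * y) with (- y) by ring.
    rewrite Rabs_left1; lra. }
assert (e : lower_Gamma 1 0 = (- (gamma_integrand 0 0 (- 0) - 1))%C).
{ apply half_line_int_unique; [apply gamma_integrand_opp_continuous | exact hl]. }
rewrite e, Ropp_0. ring.
Qed.

Lemma Cmult_neq_0_inv (z w : C) : (z * w)%C <> 0%C -> z <> 0%C /\ w <> 0%C.
Proof. intros h. split; intros e; apply h; rewrite e; ring. Qed.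

Lemma Re_pos_neq_0 (z : C) : 0 < Re z -> z <> 0%C.
Proof. intros h e. rewrite e, Re_RtoC in h. lra. Qed.

Lemma RtoC_neq_0 (x : R) : x <> 0 -> RtoC x <> 0%C.
Proof. intros h e. apply h. exact (f_equal Re e). Qed.

(** For [0 < Re c <= 1] and [c <> 1], the reflection formula at [u = 1 - c] exhibits [CGamma c] as a
    factor of the nonzero number [u * PI]. The recurrence covers the rest of the half-plane. *)
Lemma CGamma_neq_0 (c : C) : 0 < Re c -> CGamma c <> 0%C.
Proof.
assert (hn : forall n c, 0 < Re c <= INR n + 1 -> CGamma c <> 0%C).
{ induction n as [| n IH]; intros z hz.
  - simpl in hz. set (u := (1 - z)%C). replace z with (1 - u)%C by (unfold u; ring).
    destruct (Ceq_dec u 0) as [e | hu].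
    + rewrite e. replace (1 - 0)%C with (RtoC 1) by ring. rewrite CGamma_1. apply RtoC_neq_0. lra.
    + assert (hr : Rabs (Re u) < 1) by (unfold u; simpl_Re_Im; apply Rabs_def1; lra).
      assert (h : (u * PI)%C <> 0%C).
      { apply Cmult_neq_0; [exact hu |]. apply RtoC_neq_0, PI_neq0. }
      rewrite <- (CGamma_reflection u hr) in h.
      apply Cmult_neq_0_inv in h. destruct h as [h _]. now apply Cmult_neq_0_inv in h.
  - rewrite S_INR in hz.
    destruct (Rle_dec (Re z) (INR n + 1)) as [h | h]; [apply IH; lra |].
    pose proof (pos_INR n).
    replace z with ((z - 1) + 1)%C by ring.
    assert (h1 : 0 < Re (z - 1)) by (simpl_Re_Im; lra).
    rewrite CGamma_rec by exact h1.
    apply Cmult_neq_0; [now apply Re_pos_neq_0 |]. apply IH. simpl_Re_Im. lra. }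
intros hc. destruct (INR_unbounded (Re c)) as [n hn']. apply (hn n). lra.
Qed.

(** Here [up (- Re s) <= 0], so no shift takes place. *)
Lemma rGamma_pos (s : C) : 0 < Re s -> rGamma s = (/ CGamma s)%C.
Proof.
intros hs. unfold rGamma. destruct (archimed (- Re s)) as [h1 h2].
assert (h3 : (up (- Re s) <= 0)%Z).
{ apply Z.lt_succ_r. apply lt_IZR. simpl. lra. }
replace (Z.to_nat (up (- Re s))) with O by lia. reflexivity.
Qed.

(** For [Re s <= 0] this is one unfolding of [rGamma_shift], as [up] drops by exactly one; for
    [0 < Re s] neither side is shifted and [CGamma_rec] decides. *)
Lemma rGamma_rec (s : C) : rGamma s = (s * rGamma (s + 1))%C.
Proof.
destruct (Rlt_dec 0 (Re s)) as [hs | hs].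
- rewrite !rGamma_pos by (simpl_Re_Im; lra). rewrite CGamma_rec by exact hs.
  pose proof (Re_pos_neq_0 s hs). pose proof (CGamma_neq_0 s hs). field. split; assumption.
- unfold rGamma. destruct (archimed (- Re s)) as [h1 h2].
  assert (h3 : (0 < up (- Re s))%Z) by (apply lt_IZR; lra).
  replace (up (- Re (s + 1))) with (up (- Re s) - 1)%Z.
  + replace (Z.to_nat (up (- Re s))) with (S (Z.to_nat (up (- Re s) - 1))) by lia. reflexivity.
  + apply tech_up; rewrite minus_IZR; simpl_Re_Im; lra.
Qed.

Lemma Cexp_Ci_PI : Cexp (Ci * PI) = (- (1))%C.
Proof.
unfold Cexp. simpl_Re_Im. change (Re Ci) with 0. change (Im Ci) with 1.
replace (0 * PI - 1 * 0) with 0 by ring. replace (0 * 0 + 1 * PI) with PI by ring.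
rewrite exp_0, cos_PI, sin_PI. apply C_ext; simpl; ring.
Qed.

Lemma Csin_plus_PI (z : C) : Csin (z + PI) = (- Csin z)%C.
Proof.
unfold Csin. replace (Ci * (z + PI))%C with (Ci * z + Ci * PI)%C by ring.
rewrite !Cexp_opp, Cexp_plus, Cexp_Ci_PI.
assert (Ci <> 0%C) by (intros e; injection e; lra).
pose proof (Cexp_neq_0 (Ci * z)). field. repeat split; assumption.
Qed.

(** [CGamma_reflection] at [u = w - 1] gives the strip [0 < Re w < 2], and both sides are multiplied
    by [- w] when [w] becomes [w + 1]. Large [Re w] occurs because [Re b] has no lower bound. *)
Lemma rGamma_reflection (w : C) : 0 < Re w ->
  rGamma (1 - w) = (CGamma w * Csin (w * PI) / PI)%C.
Proof.
assert (hpi : RtoC PI <> 0%C) by apply RtoC_neq_0, PI_neq0.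
assert (hn : forall n w, 0 < Re w < INR n + 2 -> rGamma (1 - w) = (CGamma w * Csin (w * PI) /
  PI)%C).
{ induction n as [| n IH]; intros z hz.
  - simpl in hz. set (u := (z - 1)%C). replace z with (1 + u)%C by (unfold u; ring).
    replace (1 - (1 + u))%C with (- u)%C by ring.
    assert (hu : Rabs (Re u) < 1) by (unfold u; simpl_Re_Im; apply Rabs_def1; lra).
    pose proof (CGamma_reflection u hu) as h.
    rewrite rGamma_rec. replace (- u + 1)%C with (1 - u)%C by ring.
    assert (h1 : 0 < Re (1 - u)) by (unfold u; simpl_Re_Im; lra).
    rewrite rGamma_pos by exact h1.
    replace ((1 + u) * PI)%C with (u * PI + PI)%C by ring. rewrite Csin_plus_PI.
    pose proof (CGamma_neq_0 _ h1) as h2.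
    replace u with (CGamma (1 + u) * CGamma (1 - u) * Csin (u * PI) / PI)%C at 1 by (rewrite h;
      field; exact hpi).
    field. split; assumption.
  - rewrite S_INR in hz.
    destruct (Rlt_dec (Re z) (INR n + 2)) as [h | h]; [apply IH; lra |].
    pose proof (pos_INR n).
    set (x := (z - 1)%C). replace z with (x + 1)%C by (unfold x; ring).
    assert (hx : 0 < Re x < INR n + 2) by (unfold x; simpl_Re_Im; lra).
    specialize (IH x hx).
    replace (1 - (x + 1))%C with (- x)%C by ring.
    rewrite rGamma_rec. replace (- x + 1)%C with (1 - x)%C by ring. rewrite IH.
    rewrite CGamma_rec by lra. replace ((x + 1) * PI)%C with (x * PI + PI)%C by ring.
    rewrite Csin_plus_PI. field. exact hpi. }
intros hw. destruct (INR_unbounded (Re w)) as [n hn']. apply (hn n). lra.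
Qed.

Lemma CGamma_continuous (b : C) (v0 : R) : 0 < Re b + v0 ->
  continuous (U := C_UniformSpace) (fun v : R => CGamma (b + v)) v0.
Proof.
intros h. set (d := (Re b + v0) / 2). assert (hd : 0 < d) by (unfold d; lra).
apply (continuous_ext_loc (U := C_UniformSpace) _ (fun v : R => Gamma_ray (b + v) 0)).
- apply locally_R. exists d. split; [exact hd |]. intros v hv. apply Rabs_def2 in hv.
  symmetry. apply CGamma_eq_Gamma_ray. simpl_Re_Im. unfold d in *; lra.
- apply (half_line_int_continuous (fun y v => gamma_integrand (b + v) 0 y + gamma_integrand (b + v)
  0 (- y))%C
   (exp (0 + (3 * d + 1) * (3 * d + 1) / 1) + exp 0) (Rmin 1 d) v0 d).
  + intros y v. unfold gamma_integrand. solve_continuous.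
  + now apply Rmin_1_pos.
  + exact hd.
  + intros y v hy hv. apply Rabs_le_between' in hv.
    eapply Rle_trans; [apply Cmod_triangle |].
    apply gamma_integrand_sym_bound.
    * simpl_Re_Im. unfold d in *; lra.
    * rewrite Cexp_0, Re_RtoC. lra.
    * rewrite Cmult_0_r, Re_RtoC. lra.
    * exact hy.
Qed.

Lemma upper_Gamma_continuous (b L : C) (v0 : R) : 0 < Re (Cexp L) ->
  continuous (U := C_UniformSpace) (fun v : R => upper_Gamma (b + v) L) v0.
Proof.
intros hL.
set (p := Re b + v0 + 1). set (m := Re (b * L) + (Rabs v0 + 1) * Rabs (Re L)).
apply (half_line_int_continuous (fun y v => gamma_integrand (b + v) L y)
   (exp (m + (p + 1) * (p + 1) / Re (Cexp L))) 1 v0 1); try lra.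
- intros y v. unfold gamma_integrand. solve_continuous.
- intros y v hy hv. apply Rabs_le_between' in hv. apply gamma_integrand_bound_pos; [simpl_Re_Im;
  unfold p; lra | lra | | exact hy].
  replace ((b + v) * L)%C with (b * L + v * L)%C by ring. unfold m.
  rewrite Re_plus, (Re_mult v), Re_RtoC, Im_RtoC.
  apply Rplus_le_compat_l. rewrite Rmult_0_l, Rminus_0_r.
  eapply Rle_trans; [apply Rle_abs |]. rewrite Rabs_mult.
  apply Rmult_le_compat_r; [apply Rabs_pos |].
  unfold Rabs; destruct Rcase_abs, Rcase_abs; lra.
Qed.

(** The number of shifts in the definition jumps with the argument. The recurrence, applied a fixed
    number of times near [v0], reaches the half-plane of Euler's integral instead. *)
Lemma rGamma_continuous (b : C) (v0 : R) :
  continuous (U := C_UniformSpace) (fun v : R => rGamma (b + v)) v0.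
Proof.
assert (hn : forall n b, 0 < Re b + v0 + INR n ->
  continuous (U := C_UniformSpace) (fun v : R => rGamma (b + v)) v0).
{ clear b. induction n as [| n IH]; intros b h.
  - simpl in h. apply (continuous_ext_loc (U := C_UniformSpace) _ (fun v : R => / CGamma (b +
    v))%C).
    + apply locally_R. exists (Re b + v0). split; [lra |]. intros v hv. apply Rabs_def2 in hv.
      symmetry. apply rGamma_pos. simpl_Re_Im. lra.
    + apply continuous_Cinv; [apply CGamma_continuous; lra |]. apply CGamma_neq_0. simpl_Re_Im. lra.
  - apply (continuous_ext (U := C_UniformSpace) (fun v : R => (b + v) * rGamma ((b + 1) + v))%C).
    + intros v. rewrite (rGamma_rec (b + v)). f_equal. f_equal. ring.
    + apply continuous_Cmult; [solve_continuous |]. apply IH. rewrite S_INR in h. simpl_Re_Im. lra.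
      }
destruct (INR_unbounded (- (Re b + v0))) as [n hn']. apply (hn n). lra.
Qed.

Lemma continuous_Cmod (f : R -> C) (x : R) : continuous (U := C_UniformSpace) f x ->
  continuous (fun t => Cmod (f t)) x.
Proof.
intros h. apply (continuous_ext (fun t => norm (V := C_R_NormedModule) (f t))).
- intros t. symmetry. apply Cmod_norm.
- exact (filterlim_comp _ _ _ _ _ _ _ _ h (filterlim_norm (V := C_R_NormedModule) (f x))).
Qed.

(** A unit step in [v] divides the modulus by at least [e^l] as soon as [Re b + v >= e^l], which
    defines [v1]. Hence [e^(l v) |1 / Gamma(b + v)|] never exceeds its maximum over
    [[v1, v1 + 1]]. *)
Lemma rGamma_decay (b : C) (l : R) :
  exists K v1, forall v, v1 <= v -> Cmod (rGamma (b + v)) <= K * exp (- l * v).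
Proof.
set (v1 := exp l - Re b).
set (f := fun v : R => exp (l * v) * Cmod (rGamma (b + v))).
destruct (continuity_ab_maj f v1 (v1 + 1)) as [x [hx _]]; [lra | |].
{ intros v _. apply continuity_pt_filterlim. 
  apply (continuous_Rmult (fun v => exp (l * v)) (fun v : R => Cmod (rGamma (b + v))));
    [solve_continuous |]. apply continuous_Cmod, rGamma_continuous. }
exists (f x), v1.
assert (hn : forall n v, v1 <= v <= v1 + 1 + INR n -> f v <= f x).
{ induction n as [| n IH]; intros v hv.
  - simpl in hv. apply hx. lra.
  - rewrite S_INR in hv. destruct (Rle_dec v (v1 + 1 + INR n)) as [h | h]; [apply IH; lra |].
    pose proof (pos_INR n).
    apply Rle_trans with (f (v - 1)); [| apply IH; lra].
    unfold f. rewrite (rGamma_rec (b + (v - 1)%R)), Cmod_mult.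
    replace (b + (v - 1)%R + 1)%C with (b + v)%C by (rewrite RtoC_minus; ring).
    replace (l * v) with (l * (v - 1) + l) by ring. rewrite exp_plus, Rmult_assoc.
    apply Rmult_le_compat_l; [apply Rlt_le, exp_pos |].
    apply Rmult_le_compat_r; [apply Cmod_ge_0 |].
    eapply Rle_trans; [| apply re_le_Cmod]. eapply Rle_trans; [| apply Rle_abs].
    simpl_Re_Im. unfold v1 in *. lra. }
intros v hv. destruct (INR_unbounded (v - v1)) as [n hn'].
specialize (hn n v ltac:(lra)). unfold f at 1 in hn.
replace (- l * v) with (- (l * v)) by ring. rewrite exp_Ropp.
pose proof (exp_pos (l * v)).
apply Rmult_le_reg_l with (exp (l * v)); [assumption |].
replace (exp (l * v) * (f x * / exp (l * v))) with (f x) by (field; lra). exact hn.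
Qed.

(** * The regularized incomplete Gamma function *)

(* [Gamma(c, e^L) / Gamma(c)], written [Q(c)] in the header. *)
Definition Qreg (L c : C) : C := (rGamma c * upper_Gamma c L)%C.

Lemma Qreg_rec (L c : C) : 0 < Re (Cexp L) ->
  Qreg L (c + 1) = (Qreg L c + rGamma (c + 1) * Cexp (c * L) * Cexp (- Cexp L))%C.
Proof.
intros hL. unfold Qreg. rewrite upper_Gamma_rec by exact hL. rewrite (rGamma_rec c).
unfold gamma_integrand. rewrite Cplus_0_l. unfold Cminus. rewrite (Cexp_plus (c * L)). ring.
Qed.

Lemma Qreg_continuous (L b : C) : 0 < Re (Cexp L) -> everywhere_continuous (fun v : R => Qreg L (b
  + v)).
Proof.
intros hL v. apply continuous_Cmult; [apply rGamma_continuous | now apply upper_Gamma_continuous].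
Qed.

(** By rotation of the ray, [1 - Q] is the lower incomplete Gamma function divided by [Gamma], and
    only the numerator's growth [e^(Re L * v)] has to be beaten. *)
Lemma Qreg_limit (L b : C) : - PI / 2 < Im L < PI / 2 ->
  exists K v1, forall v, v1 <= v -> Cmod (Qreg L (b + v) - 1) <= K * exp (- (1) * v).
Proof.
intros hIm.
assert (hL : 0 < Re (Cexp L)) by now apply Re_Cexp_pos.
(* The extra 1 in the rate is what remains as [e^(-v)]. *)
destruct (rGamma_decay b (Re L + 1)) as [K [v1 hK]].
exists (K * exp (Re (b * L))), (Rmax v1 (1 - Re b)). intros v hv.
assert (h1 := Rle_trans _ _ _ (Rmax_l _ _) hv). assert (h2 := Rle_trans _ _ _ (Rmax_r _ _) hv).
assert (hc : 1 <= Re (b + v)) by (simpl_Re_Im; lra).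
assert (hc0 : 0 < Re (b + v)) by lra.
specialize (hK v h1).
assert (hl : Cmod (lower_Gamma (b + v) L) <= exp (Re ((b + v) * L))).
{ unfold lower_Gamma. replace (exp (Re ((b + v) * L))) with (exp (Re ((b + v) * L)) / 1) by field.
  apply Cmod_half_line_int; [apply gamma_integrand_opp_continuous | lra |].
  intros y hy. apply gamma_integrand_bound_neg; lra. }
replace (Qreg L (b + v) - 1)%C with (- (rGamma (b + v) * lower_Gamma (b + v) L))%C.
- rewrite Cmod_opp, Cmod_mult.
  replace (K * exp (Re (b * L)) * exp (- (1) * v)) with ((K * exp (- (Re L + 1) * v)) * exp (Re ((b
    + v) * L))).
  + apply Rmult_le_compat; try apply Cmod_ge_0; assumption.
  + replace (Re ((b + v) * L)) with (Re (b * L) + Re L * v) by (simpl_Re_Im; ring).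
    rewrite !Rmult_assoc, <- !exp_plus. f_equal. f_equal. ring.
- unfold Qreg. rewrite rGamma_pos by exact hc0.
  pose proof (CGamma_neq_0 _ hc0) as h0.
  pose proof (Gamma_ray_split (b + v) L hc0 hL) as hs. rewrite CGamma_rotate in hs by assumption.
  replace (upper_Gamma (b + v) L) with (CGamma (b + v) - lower_Gamma (b + v) L)%C by (rewrite hs;
    ring).
  field. exact h0.
Qed.

Lemma is_CInt_const (c : C) (a b : R) : is_CInt (fun _ => c) a b ((b - a)%R * c)%C.
Proof. rewrite <- scal_R_Cmult. exact (is_RInt_const (V := C_R_NormedModule) a b c). Qed.

Lemma CInt_shift (f : R -> C) (s a b : R) : everywhere_continuous f ->
  CInt (fun v => f (v + s)) a b = CInt f (a + s) (b + s).
Proof.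
intros cf. apply is_CInt_unique.
assert (h : is_CInt f (1 * a + s) (1 * b + s) (CInt f (a + s) (b + s))).
{ rewrite !Rmult_1_l. now apply is_CInt_continuous. }
apply (is_RInt_comp_lin (V := C_R_NormedModule)) in h. revert h.
apply (is_RInt_ext (V := C_R_NormedModule)). intros v _.
rewrite Rmult_1_l. apply (scal_one (V := C_R_NormedModule)).
Qed.

Lemma is_half_line_int_power_rGamma (L b : C) : - PI / 2 < Im L < PI / 2 ->
  is_half_line_int (fun v : R => Cexp ((b + v - 1) * L) * rGamma (b + v))%C
    (Cexp (Cexp L) * (1 - CInt (fun v : R => Qreg L (b - 1 + v)) 0 1))%C.
Proof.
intros hIm.
assert (hL : 0 < Re (Cexp L)) by now apply Re_Cexp_pos.
set (h := fun v : R => Qreg L (b + v)).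
assert (ch : everywhere_continuous h) by now apply Qreg_continuous.
assert (ch1 : everywhere_continuous (fun v => h (v + - (1)))).
{ intros v. apply (continuous_comp (fun v => v + - (1)) h); [solve_continuous | apply ch]. }
destruct (Qreg_limit L b hIm) as [K [v1 hK]].
assert (hshift : forall v : R, Qreg L (b - 1 + v) = h (v + - (1))).
{ intros v. unfold h. f_equal. rewrite RtoC_plus, RtoC_opp. ring. }
rewrite (CInt_ext _ (fun v => h (v + - (1)))) by (intros; apply hshift).
rewrite CInt_shift by exact ch. rewrite Rplus_0_l, Rplus_opp_r.
(* The integrals of [h v] and [h (v - 1)] over [[0, T]] cancel except on the windows [[T - 1, T]]
   and [[-1, 0]]. *)
assert (hint : forall T, CInt (fun v : R => Cexp ((b + v - 1) * L) * rGamma (b + v))%C 0 T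
  = (Cexp (Cexp L) * (CInt h (T + - (1)) T - CInt h (- (1)) 0))%C).
{ intros T. apply is_CInt_unique.
  replace (CInt h (T + - (1)) T - CInt h (- (1)) 0)%C
    with (CInt h 0 T - CInt (fun v => h (v + - (1))%R) 0 T)%C.
  - apply (is_RInt_ext (V := C_R_NormedModule) (fun v => Cexp (Cexp L) * (h v - h (v + -
    (1))%R))%C).
    + intros v _. rewrite <- hshift. unfold h.
      assert (hr := Qreg_rec L (b - 1 + v) hL).
      replace (b - 1 + v + 1)%C with (b + v)%C in hr by ring. rewrite hr.
      replace (b - 1 + v)%C with (b + v - 1)%C by ring.
      rewrite (Cexp_opp (Cexp L)). pose proof (Cexp_neq_0 (Cexp L)).
      match goal with |- ?x = ?y => change (@eq C x y) end. field. assumption.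
    + apply is_CInt_scal, is_CInt_minus; now apply is_CInt_continuous.
  - rewrite CInt_shift by exact ch. rewrite Rplus_0_l.
    rewrite <- (CInt_Chasles h (- (1)) 0 (T + - (1)) ch).
    rewrite <- (CInt_Chasles h 0 (T + - (1)) T ch). ring. }
unfold is_half_line_int.
apply (filterlim_ext (fun T => Cexp (Cexp L) * (CInt h (T + - (1)) T - CInt h (- (1)) 0))%C);
  [intros T; symmetry; apply hint |].
apply (filterlim_comp _ _ _ (fun T => CInt h (T + - (1)) T)
  (fun z => Cexp (Cexp L) * (z - CInt h (- (1)) 0))%C _ (Clocally (RtoC 1))).
- apply filterlim_C; [apply Rbar_locally_filter |]. intros eps hp.
  destruct (exp_tail_small K 1 eps Rlt_0_1 hp) as [M [hM HM]].
  (* The summand 1 places the whole window [[T - 1, T]] beyond both thresholds. *)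
  set (N := Rmax M v1 + 1).
  generalize (p_infty_ge N). apply filter_imp. intros T hT.
  assert (hN1 : M <= T + - (1)) by (unfold N in hT; pose proof (Rmax_l M v1); lra).
  assert (hN2 : v1 <= T + - (1)) by (unfold N in hT; pose proof (Rmax_r M v1); lra).
  assert (hc : is_CInt (fun v => h v - 1)%C (T + - (1)) T (CInt h (T + - (1)) T - 1)%C).
  { apply is_CInt_minus; [now apply is_CInt_continuous |].
    pose proof (is_CInt_const (RtoC 1) (T + - (1)) T) as hk.
    replace (T - (T + - (1))) with 1 in hk by ring. rewrite Cmult_1_l in hk. exact hk. }
  eapply Rle_lt_trans; [| apply (HM (T + - (1)) hN1)].
  replace (K * exp (- (1) * (T + - (1)))) with (Rabs (T - (T + - (1))) * (K * exp (- (1) * (T + -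
    (1))))).
  + apply (Cmod_CInt_const _ _ _ _ _) with (2 := hc).
    rewrite Rmin_left, Rmax_right by lra. intros v hv.
    assert (hK0 := hK v ltac:(lra)). eapply Rle_trans; [exact hK0 |].
    assert (hKp : 0 <= K).
    { pose proof (Cmod_ge_0 (Qreg L (b + v) - 1)). pose proof (exp_pos (- (1) * v)). nra. }
    apply Rmult_le_compat_l; [exact hKp |]. apply exp_mono. lra.
  + replace (T - (T + - (1))) with 1 by ring. rewrite Rabs_R1. ring.
- apply (continuous_Cmult (T := C_UniformSpace) (fun _ => Cexp (Cexp L)) (fun z => z - CInt h (-
  (1)) 0)%C);
    [apply continuous_const |].
  apply (continuous_Cminus (T := C_UniformSpace) (fun z => z) (fun _ => CInt h (- (1)) 0));
    [apply continuous_id | apply continuous_const].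
Qed.

(** * The kernel *)

(* The result of integrating out [t] in
   [Gamma(w) Gamma(1 - w, e^L) = \int\int e^(- t (1 + x)) x^(w - 1) dx dt], where [x = e^y]. *)
Definition inc_kernel (w L : C) (y : R) : C :=
  (Cexp (w * y) * Cexp (- (Cexp L * (1 + exp y)%R)) * (/ (1 + exp y))%R)%C.

Lemma one_plus_exp_neq_0 (y : R) : 1 + exp y <> 0.
Proof. pose proof (exp_pos y). lra. Qed.

Lemma inc_kernel_cont2 (w : R -> R -> C) (L : R -> R -> C) : continuous2 w -> continuous2 L ->
  continuous2 (fun y v => inc_kernel (w y v) (L y v) y).
Proof.
intros hw hL y v. pose proof (hw y v). pose proof (hL y v).
unfold inc_kernel. solve_continuous. apply one_plus_exp_neq_0.
Qed.

Lemma inc_kernel_continuous (w L : C) : everywhere_continuous (inc_kernel w L).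
Proof. intros y. unfold inc_kernel. solve_continuous. apply one_plus_exp_neq_0. Qed.

Lemma inc_kernel_opp_continuous (w L : C) : everywhere_continuous (fun y => inc_kernel w L (- y)).
Proof. intros y. unfold inc_kernel. solve_continuous. apply one_plus_exp_neq_0. Qed.

Lemma inc_kernel_sym_continuous (w L : C) : everywhere_continuous (fun y => inc_kernel w L y +
  inc_kernel w L (- y))%C.
Proof. intros y. apply continuous_Cplus; [apply inc_kernel_continuous |
  apply inc_kernel_opp_continuous]. Qed.

(** With [k = Re (e^L)] and [e^s >= 1 + s], the exponent [k e^s (1 + e^y)] is at least
    [k s + k e^y], which separates the decay in [s] from that in [y]. *)
Lemma Cmod_inc_kernel (w L : C) (s y : R) : 0 < Re (Cexp L) -> 0 <= s ->
  Cmod (inc_kernel w (L + s) y) <= exp (- Re (Cexp L) * s) * exp (Re w * y - Re (Cexp L) * exp y).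
Proof.
intros hL hs. unfold inc_kernel. rewrite !Cmod_mult, !Cmod_Cexp, Cmod_R.
pose proof (exp_pos y) as hy.
assert (hi : 0 < / (1 + exp y) <= 1).
{ split; [apply Rinv_0_lt_compat; lra |]. rewrite <- Rinv_1. apply Rinv_le_contravar; lra. }
rewrite Rabs_pos_eq by lra.
rewrite Cexp_plus, Cexp_RtoC. simpl_Re_Im.
set (k := Re (Cexp L)) in *. clearbody k.
rewrite <- exp_plus, <- exp_plus.
apply Rle_trans with (exp (Re w * y - Im w * 0 +
   - ((k * exp s - Im (Cexp L) * 0) * (1 + exp y) - (k * 0 + Im (Cexp L) * exp s) * 0)) * 1).
- apply Rmult_le_compat_l; [apply Rlt_le, exp_pos | lra].
- rewrite Rmult_1_r. apply exp_mono. pose proof (exp_ineq1_le s).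
  assert (k * (1 + s) * (1 + exp y) <= k * exp s * (1 + exp y)).
  { apply Rmult_le_compat_r; [lra |]. apply Rmult_le_compat_l; lra. }
  assert (0 <= k * s * exp y) by (repeat apply Rmult_le_pos; lra). nra.
Qed.

Lemma inc_kernel_bound_pos (w L : C) (s y : R) (p : R) : Re w <= p -> 0 < Re (Cexp L) -> 0 <= s ->
  0 <= y ->
  Cmod (inc_kernel w (L + s) y) <= exp (- Re (Cexp L) * s) * exp ((p + 1) * (p + 1) / Re (Cexp L))
    * exp (- (1) * y).
Proof.
intros hp hL hs hy. eapply Rle_trans; [now apply Cmod_inc_kernel |].
rewrite Rmult_assoc. apply Rmult_le_compat_l; [apply Rlt_le, exp_pos |].
eapply Rle_trans; [| now apply exp_double_exp_bound]. apply exp_mono. nra.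
Qed.

Lemma inc_kernel_bound_neg (w L : C) (s y : R) : 0 < Re (Cexp L) -> 0 <= s ->
  Cmod (inc_kernel w (L + s) (- y)) <= exp (- Re (Cexp L) * s) * exp (- Re w * y).
Proof.
intros hL hs. eapply Rle_trans; [now apply Cmod_inc_kernel |].
apply Rmult_le_compat_l; [apply Rlt_le, exp_pos |]. apply exp_mono.
pose proof (exp_pos (- y)). nra.
Qed.

Lemma inc_kernel_sym_bound (w L : C) (s y : R) : 0 < Re (Cexp L) -> 0 <= s -> 0 <= y ->
  Cmod (inc_kernel w (L + s) y + inc_kernel w (L + s) (- y)) <=
  (exp ((Re w + 1) * (Re w + 1) / Re (Cexp L)) + 1) * exp (- Re (Cexp L) * s) * exp (- Rmin 1 (Re
    w) * y).
Proof.
intros hL hs hy. eapply Rle_trans; [apply Cmod_triangle |].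
pose proof (inc_kernel_bound_pos w L s y (Re w) (Rle_refl _) hL hs hy) as h1.
pose proof (inc_kernel_bound_neg w L s y hL hs) as h2.
assert (h3 : exp (- (1) * y) <= exp (- Rmin 1 (Re w) * y)).
{ apply exp_mono. pose proof (Rmin_l 1 (Re w)). nra. }
assert (h4 : exp (- Re w * y) <= exp (- Rmin 1 (Re w) * y)).
{ apply exp_mono. pose proof (Rmin_r 1 (Re w)). nra. }
set (A := exp (- Re (Cexp L) * s)) in *.
assert (0 < A) by apply exp_pos.
set (B := exp ((Re w + 1) * (Re w + 1) / Re (Cexp L))) in *.
assert (0 < B) by apply exp_pos.
assert (A * B * exp (- (1) * y) <= A * B * exp (- Rmin 1 (Re w) * y)).
{ apply Rmult_le_compat_l; [apply Rmult_le_pos; lra | exact h3]. }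
assert (A * exp (- Re w * y) <= A * exp (- Rmin 1 (Re w) * y)) by (apply Rmult_le_compat_l; lra).
lra.
Qed.

(** The exponents [w] and [1 - w] add up to 1, so the product contains [e^(L + s)] exactly once, as
    the derivative of the inner exponential requires. *)
Lemma inc_kernel_derive_s (w L : C) (y s : R) :
  is_Cderive (fun s => - inc_kernel w (L + s) y)%C s (gamma_integrand w (L + s) y * gamma_integrand
    (1 - w) L s)%C.
Proof.
unfold inc_kernel.
eapply is_Cderive_eq.
- apply is_Cderive_opp.
  apply (is_Cderive_mult (fun s => Cexp (w * y) * Cexp (- (Cexp (L + s) * (1 + exp y)%R)))%C (fun _
    => RtoC (/ (1 + exp y))));
    [| apply is_Cderive_const].
  apply (is_Cderive_mult (fun _ => Cexp (w * y))); [apply is_Cderive_const |].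
  solve_Cderive. reflexivity.
- cbv beta. unfold gamma_integrand.
  rewrite RtoC_inv by apply one_plus_exp_neq_0.
  assert (RtoC (1 + exp y) <> 0%C) by (apply RtoC_neq_0, one_plus_exp_neq_0).
  replace (w * (y + (L + s)) - Cexp (y + (L + s)))%C
    with (w * y + w * (L + s) + - (Cexp (L + s) * exp y))%C
    by (rewrite (Cexp_plus y), Cexp_RtoC; ring).
  replace ((1 - w) * (s + L) - Cexp (s + L))%C
    with ((L + s) + - (w * (L + s)) + - Cexp (L + s))%C
    by (replace (s + L)%C with (L + s)%C by ring; ring).
  replace (- (Cexp (L + s) * (1 + exp y)%R))%C with (- Cexp (L + s) + - (Cexp (L + s) * exp y))%C
    by (rewrite RtoC_plus; ring).
  rewrite !Cexp_plus, (Cexp_opp (w * (L + s))). pose proof (Cexp_neq_0 (w * (L + s))).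
  field. split; assumption.
Qed.

Lemma inc_kernel_sym_correct (w L : C) (s : R) : 0 < Re w -> 0 < Re (Cexp L) -> 0 <= s ->
  is_half_line_int (fun y => inc_kernel w (L + s) y + inc_kernel w (L + s) (- y))%C
    (half_line_int (fun y => inc_kernel w (L + s) y + inc_kernel w (L + s) (- y))%C).
Proof.
intros hw hL hs.
eapply is_half_line_int_ex; [apply inc_kernel_sym_continuous | now apply Rmin_1_pos, hw |].
intros y hy. now apply inc_kernel_sym_bound.
Qed.

(** While [s] runs along the ray of the second factor, the integral for [CGamma w] is rotated to the
    ray through [e^(L + s)]. Truncated at [s = b], the double integral is [Phi 0 - Phi b], and
    [Phi b] tends to 0. *)
Lemma CGamma_mul_upper_Gamma (w L : C) : 0 < Re w -> - PI / 2 < Im L < PI / 2 ->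
  (CGamma w * upper_Gamma (1 - w) L)%C = half_line_int (fun y => inc_kernel w L y + inc_kernel w L
    (- y))%C.
Proof.
intros hw hIm.
assert (hL : 0 < Re (Cexp L)) by now apply Re_Cexp_pos.
set (eta := Rmin 1 (Re w)). assert (he : 0 < eta) by now apply Rmin_1_pos.
set (Phi := fun s : R => half_line_int (fun y => inc_kernel w (L + s) y + inc_kernel w (L + s) (-
  y))%C).
set (K := (exp ((Re w + 1) * (Re w + 1) / Re (Cexp L)) + 1)).
assert (hPb : forall s, 0 <= s -> Cmod (Phi s) <= K / eta * exp (- Re (Cexp L) * s)).
{ intros s hs. replace (K / eta * exp (- Re (Cexp L) * s)) with (K * exp (- Re (Cexp L) * s) / eta)
  by (field; lra).
  apply Cmod_half_line_int; [apply inc_kernel_sym_continuous | exact he |]. intros y hy.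
    now apply inc_kernel_sym_bound. }
assert (main : forall b, 0 <= b -> (CGamma w * CInt (gamma_integrand (1 - w) L) 0 b)%C = (Phi 0%R -
  Phi b)%C).
{ intros b hb.
  set (f := fun y s : R => ((gamma_integrand w (L + s) y + gamma_integrand w (L + s) (- y)) *
    gamma_integrand (1 - w) L s)%C).
  assert (hexp : forall s, 0 <= s -> Re (Cexp L) <= Re (Cexp (L + s))).
  { intros s hs. rewrite Cexp_plus, Cexp_RtoC. simpl_Re_Im. pose proof (exp_ineq1_le s). nra. }
  assert (hfs : forall s, 0 <= s -> half_line_int (fun y => f y s) = (CGamma w * gamma_integrand (1
    - w) L s)%C).
  { intros s hs. rewrite <- (CGamma_rotate w (L + s)).
    - apply half_line_int_unique.
      + intros y. unfold f. apply continuous_Cmult; [apply gamma_integrand_sym_continuous |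
        solve_continuous].
      + rewrite Cmult_comm.
        apply (is_half_line_int_ext (fun y => gamma_integrand (1 - w) L s * (gamma_integrand w (L +
          s) y + gamma_integrand w (L + s) (- y)))%C).
        { intros y. unfold f. ring. }
        apply is_half_line_int_scal; [apply gamma_integrand_sym_continuous |].
          apply Gamma_ray_correct; [exact hw |].
        specialize (hexp s hs). lra.
    - exact hw.
    - simpl_Re_Im. lra. }
  assert (cf : continuous2 f).
  { intros y s. unfold f, gamma_integrand. solve_continuous. }
  set (m := Re (w * L) + Re w * b).
  assert (hF : is_half_line_int (fun y => CInt (fun s => f y s) 0 b) (CInt (fun s => half_line_int
    (fun y => f y s)) 0 b)).
  { apply (half_line_int_Fubini f ((exp (m + (Re w + 1) * (Re w + 1) / Re (Cexp L)) + exp m) *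
       exp (Re ((1 - w) * L) + (Re (1 - w) + 1) * (Re (1 - w) + 1) / Re (Cexp L)))
      (Rmin 1 (Re w))); [exact cf | exact he | exact hb |].
    intros y s hy hs. unfold f. rewrite Cmod_mult.
    rewrite (Rmult_comm _ (exp (Re ((1 - w) * L) + _))), Rmult_assoc, Rmult_comm.
    apply Rmult_le_compat; try apply Cmod_ge_0.
    - pose proof (gamma_integrand_bound_pos (1 - w) L _ _ _ s (Rle_refl _) (conj hL (Rle_refl _))
      (Rle_refl _) ltac:(lra)) as h.
      eapply Rle_trans; [exact h |]. rewrite <- Rmult_1_r.
      apply Rmult_le_compat_l; [apply Rlt_le, exp_pos |].
      apply Rle_trans with (exp 0); [apply exp_mono; lra | rewrite exp_0; lra].
    - eapply Rle_trans; [apply Cmod_triangle |].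
      apply gamma_integrand_sym_bound; [lra | | | exact hy].
      + split; [exact hL | apply hexp; lra].
      + unfold m. replace (w * (L + s))%C with (w * L + w * s)%C by ring.
        rewrite Re_plus, (Re_mult w s), Re_RtoC, Im_RtoC. nra. }
  rewrite (CInt_ext _ (fun s => CGamma w * gamma_integrand (1 - w) L s)%C) in hF.
  2:{ rewrite Rmin_left, Rmax_right by exact hb. intros s hs. apply hfs. lra. }
  rewrite (is_CInt_unique _ _ _ _ (is_CInt_scal (CGamma w) _ _ _ _
    (is_CInt_continuous (gamma_integrand (1 - w) L) 0 b (gamma_integrand_continuous (1 - w) L))))
      in hF.
  apply (is_half_line_int_unique (fun y => CInt (fun s => f y s) 0 b)).
  - intros y. apply (continuous_CInt_param (fun s y => f y s)). now apply continuous2_swap.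
  - exact hF.
  - apply (is_half_line_int_ext (fun y => (inc_kernel w (L + 0%R) y + inc_kernel w (L + 0%R) (- y))
    - (inc_kernel w (L + b) y + inc_kernel w (L + b) (- y)))%C).
    + intros y. symmetry. apply is_CInt_unique.
      replace ((inc_kernel w (L + 0%R) y + inc_kernel w (L + 0%R) (- y)) - (inc_kernel w (L + b) y
        + inc_kernel w (L + b) (- y)))%C
       with ((- inc_kernel w (L + b) y + - inc_kernel w (L + b) (- y)) - (- inc_kernel w (L + 0%R)
         y + - inc_kernel w (L + 0%R) (- y)))%C by ring.
      apply (is_CInt_derive (fun s : R => - inc_kernel w (L + s) y + - inc_kernel w (L + s) (-
        y))%C).
      * intros s. eapply is_Cderive_eq; [apply is_Cderive_plus; apply inc_kernel_derive_s |].
        unfold f. ring.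
      * intros s. apply (continuous2_r f s y cf).
    + exact (is_half_line_int_minus _ _ _ _ (inc_kernel_sym_continuous w (L + 0%R))
      (inc_kernel_sym_continuous w (L + b))
        (inc_kernel_sym_correct w L 0 hw hL (Rle_refl 0)) (inc_kernel_sym_correct w L b hw hL hb)).
          }
assert (l1 : filterlim (fun b => (CGamma w * CInt (gamma_integrand (1 - w) L) 0 b)%C) (Rbar_locally
  p_infty)
   (Clocally (CGamma w * upper_Gamma (1 - w) L)%C)).
{ apply (filterlim_comp _ _ _ (fun b => CInt (gamma_integrand (1 - w) L) 0 b)
    (fun z => CGamma w * z)%C _ (Clocally (upper_Gamma (1 - w) L))).
  - now apply upper_Gamma_correct.
  - apply (continuous_Cmult (T := C_UniformSpace) (fun _ => CGamma w) (fun z => z));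
      [apply continuous_const | apply continuous_id]. }
assert (l2 : filterlim (fun b => (CGamma w * CInt (gamma_integrand (1 - w) L) 0 b)%C) (Rbar_locally
  p_infty)
   (Clocally (Phi 0%R))).
{ apply filterlim_C; [apply Rbar_locally_filter |]. intros eps hp.
  destruct (exp_tail_small (K / eta) (Re (Cexp L)) eps hL hp) as [M [hM HM]].
  generalize (p_infty_ge M). apply filter_imp. intros b hb.
  rewrite main by lra. replace (Phi 0%R - Phi b - Phi 0%R)%C with (- Phi b)%C by ring.
    rewrite Cmod_opp.
  eapply Rle_lt_trans; [apply hPb; lra | apply HM, hb]. }
assert (hu0 : (CGamma w * upper_Gamma (1 - w) L)%C = Phi 0%R).
{ exact (filterlim_locally_unique (V := C_R_NormedModule) (F := Rbar_locally p_infty) _ _ _ l1 l2).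
  }
rewrite hu0. unfold Phi. rewrite Cplus_0_r. reflexivity.
Qed.

Lemma Csin_Qreg (w L : C) : 0 < Re w -> - PI / 2 < Im L < PI / 2 ->
  (Csin (w * PI) / PI * half_line_int (fun y => inc_kernel w L y + inc_kernel w L (- y)))%C = Qreg
    L (1 - w).
Proof.
intros hw hIm. rewrite <- CGamma_mul_upper_Gamma by assumption. unfold Qreg.
rewrite rGamma_reflection by exact hw. unfold Cdiv. ring.
Qed.

(** * Complex sine and cosine *)

Lemma Cmod_Ci : Cmod Ci = 1.
Proof. unfold Cmod, Ci; simpl. replace (0 * (0 * 1) + 1 * (1 * 1)) with 1 by ring. apply sqrt_1.
  Qed.

Lemma Ci_neq_0 : Ci <> 0%C.
Proof. intros e; injection e; lra. Qed.

Lemma Re_le_Cmod (z : C) : Re z <= Cmod z.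
Proof. eapply Rle_trans; [apply Rle_abs | apply re_le_Cmod]. Qed.

(** From [sin z = e^(- i z) (e^(2 i z) - 1) / (2 i)]. The factor [Cmod z] is the point: in
    [CInt_log_kernel_limit] it supplies the factor [w] that [inc_kernel_left_tail] asks for. *)
Lemma Cmod_Csin (z : C) : Cmod (Csin z) <= Cmod z * exp (3 * Cmod z).
Proof.
replace (Csin z) with (Cexp (- (Ci * z)) * (Cexp (2 * (Ci * z)) - 1) * / (2 * Ci))%C.
- assert (hz : Cmod (Ci * z) = Cmod z) by (rewrite Cmod_mult, Cmod_Ci; ring).
  assert (h2 : Cmod (2 * (Ci * z)) = 2 * Cmod z).
  { rewrite Cmod_mult, hz, Cmod_R, Rabs_pos_eq; lra. }
  pose proof (Cmod_Cexp_sub_1 (2 * (Ci * z))) as h. rewrite h2 in h.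
  assert (h6 : Cmod (/ (2 * Ci)) = / 2).
  { rewrite Cmod_inv by (apply Cmult_neq_0; [apply RtoC_neq_0; lra | apply Ci_neq_0]).
    rewrite Cmod_mult, Cmod_Ci, Cmod_R, Rabs_pos_eq, Rmult_1_r by lra. reflexivity. }
  rewrite !(Cmod_mult (_ * _)), (Cmod_mult (Cexp _)), h6.
  assert (h3 : Cmod (Cexp (- (Ci * z))) <= exp (Cmod z)).
  { apply Cmod_Cexp_le. eapply Rle_trans; [apply Re_le_Cmod |]. rewrite Cmod_opp, hz. lra. }
  assert (h4 : exp (Rmax 0 (Re (2 * (Ci * z)))) <= exp (2 * Cmod z)).
  { apply exp_mono. pose proof (Cmod_ge_0 z).
    apply Rmax_lub; [lra |]. rewrite <- h2. apply Re_le_Cmod. }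
  replace (3 * Cmod z) with (Cmod z + 2 * Cmod z) by ring. rewrite exp_plus.
  pose proof (Cmod_ge_0 z). pose proof (Cmod_ge_0 (Cexp (2 * (Ci * z)) - 1)).
  assert (h5 : Cmod (Cexp (2 * (Ci * z)) - 1) <= 2 * Cmod z * exp (2 * Cmod z)).
  { eapply Rle_trans; [exact h |]. apply Rmult_le_compat_l; lra. }
  replace (Cmod z * (exp (Cmod z) * exp (2 * Cmod z)))
    with (exp (Cmod z) * (2 * Cmod z * exp (2 * Cmod z)) * / 2) by field.
  apply Rmult_le_compat_r; [lra |]. apply Rmult_le_compat; try assumption. apply Cmod_ge_0.
- unfold Csin. replace (2 * (Ci * z))%C with (Ci * z + Ci * z)%C by ring.
  rewrite !Cexp_opp, Cexp_plus. pose proof (Cexp_neq_0 (Ci * z)). pose proof Ci_neq_0.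
  field. split; assumption.
Qed.

Lemma Ccos_plus_PI (z : C) : Ccos (z + PI) = (- Ccos z)%C.
Proof.
unfold Ccos. replace (Ci * (z + PI))%C with (Ci * z + Ci * PI)%C by ring.
rewrite !Cexp_opp, Cexp_plus, Cexp_Ci_PI. pose proof (Cexp_neq_0 (Ci * z)). field. assumption.
Qed.

Lemma Csin_opp (z : C) : Csin (- z) = (- Csin z)%C.
Proof.
unfold Csin. replace (Ci * - z)%C with (- (Ci * z))%C by ring. replace (- - (Ci * z))%C
  with (Ci * z)%C by ring.
pose proof Ci_neq_0. field. assumption.
Qed.

Lemma Ccos_opp (z : C) : Ccos (- z) = Ccos z.
Proof.
unfold Ccos. replace (Ci * - z)%C with (- (Ci * z))%C by ring. replace (- - (Ci * z))%C
  with (Ci * z)%C by ring.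
field.
Qed.

Lemma Csin_derive (f : R -> C) (x : R) (l : C) : is_Cderive f x l ->
  is_Cderive (fun t => Csin (f t)) x (l * Ccos (f x))%C.
Proof.
intros h. unfold Csin, Ccos, Cdiv. eapply is_Cderive_eq.
- apply (is_Cderive_mult (fun t => Cexp (Ci * f t) - Cexp (- (Ci * f t)))%C (fun _ => (/ (2 *
  Ci))%C));
    [| apply is_Cderive_const].
  apply is_Cderive_minus; apply is_Cderive_Cexp; [| apply is_Cderive_opp];
  (apply (is_Cderive_mult (fun _ => Ci)); [apply is_Cderive_const | exact h]).
- cbv beta. pose proof Ci_neq_0. field. assumption.
Qed.

Lemma Ccos_derive (f : R -> C) (x : R) (l : C) : is_Cderive f x l ->
  is_Cderive (fun t => Ccos (f t)) x (- (l * Csin (f x)))%C.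
Proof.
intros h. unfold Csin, Ccos, Cdiv. eapply is_Cderive_eq.
- apply (is_Cderive_mult (fun t => Cexp (Ci * f t) + Cexp (- (Ci * f t)))%C (fun _ => (/ 2)%C));
    [| apply is_Cderive_const].
  apply is_Cderive_plus; apply is_Cderive_Cexp; [| apply is_Cderive_opp];
  (apply (is_Cderive_mult (fun _ => Ci)); [apply is_Cderive_const | exact h]).
- cbv beta. pose proof Ci_neq_0.
  replace (- (l * ((Cexp (Ci * f x) - Cexp (- (Ci * f x))) * / (2 * Ci))))%C with
   (Ci * Ci * (l * ((Cexp (Ci * f x) - Cexp (- (Ci * f x))) * / (2 * Ci))))%C by (rewrite Ci_sqr;
     ring).
  field. assumption.
Qed.

(* [kernel] in the variable [x = e^y], including the Jacobian. *)
Definition log_kernel (b L : C) (y : R) : C := (exp y * kernel b (Cexp L) (exp y))%C.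

(** It satisfies [1 - warg b v = b - 1 + v], and for [Re b <= 1] its real part is at least
    [1 - v]. *)
Definition warg (b : C) (v : R) : C := (2 - b - v)%C.

Lemma PI2_plus_sqr_neq_0 (y : R) : RtoC (PI * PI + y * y) <> 0%C.
Proof. apply RtoC_neq_0. pose proof PI_RGT_0. nra. Qed.

(** Going from [v = 1] to [v = 0] raises [w] by 1, which negates sine and cosine and multiplies the
    exponential by [e^y]. The endpoint values of the antiderivative [A] thus combine to [1 + e^y]
    times the one at [v = 1]. *)
Lemma CInt_sin_exp (b : C) (y : R) :
  CInt (fun v => Csin (warg b v * PI) / PI * Cexp (warg b v * y))%C 0 1 =
  (- (Cexp ((1 - b) * y) * (1 + exp y) * ((Csin (b * PI) / PI * y + Ccos (b * PI)) / (PI * PI + y *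
    y)%R)))%C.
Proof.
pose proof (PI2_plus_sqr_neq_0 y) as hD.
assert (hpi : RtoC PI <> 0%C) by apply RtoC_neq_0, PI_neq0.
set (D := RtoC (PI * PI + y * y)) in *.
assert (hDe : D = (PI * PI + y * y)%C) by (unfold D; now rewrite RtoC_plus, !RtoC_mult).
set (A := fun v : R => (Cexp (warg b v * y) * ((Ccos (warg b v * PI) - Csin (warg b v * PI) * (y /
  PI)) * / D))%C).
assert (dw : forall v, is_Cderive (fun v => warg b v) v (- (1))%C).
{ intros v. unfold warg. solve_Cderive. ring. }
assert (h : is_CInt (fun v => Csin (warg b v * PI) / PI * Cexp (warg b v * y))%C 0 1 (A 1 - A 0)%C).
{ apply (is_CInt_derive A).
  - intros v. unfold A.
    assert (dwp : is_Cderive (fun v => warg b v * PI)%C v (- PI)%C).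
    { eapply is_Cderive_eq; [apply is_Cderive_mult; [apply dw | apply is_Cderive_const] |].
      cbv beta. ring. }
    eapply is_Cderive_eq.
    + apply (is_Cderive_mult (fun v => Cexp (warg b v * y))).
      * apply is_Cderive_Cexp. apply is_Cderive_mult; [apply dw | apply is_Cderive_const].
      * apply (is_Cderive_mult (fun v => Ccos (warg b v * PI) - Csin (warg b v * PI) * (y / PI))%C
        (fun _ => (/ D)%C));
          [| apply is_Cderive_const].
        apply is_Cderive_minus; [apply Ccos_derive, dwp |].
        apply (is_Cderive_mult (fun v => Csin (warg b v * PI))%C); [apply Csin_derive, dwp |
          apply is_Cderive_const].
    + cbv beta. rewrite hDe in *. field. split; assumption.
  - intros v. unfold warg, Csin, Cdiv. solve_continuous. }
rewrite (is_CInt_unique _ _ _ _ h). unfold A, warg.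
replace ((2 - b - 1) * PI)%C with (- (b * PI) + PI)%C by ring.
replace ((2 - b - 0) * PI)%C with (- (b * PI) + PI + PI)%C by ring.
rewrite !Csin_plus_PI, !Ccos_plus_PI, Csin_opp, Ccos_opp.
replace ((2 - b - 1) * y)%C with ((1 - b) * y)%C by ring.
replace ((2 - b - 0) * y)%C with ((1 - b) * y + y)%C by ring.
rewrite Cexp_plus, Cexp_RtoC. field. split; assumption.
Qed.

(** The factor [1 + e^y] of [CInt_sin_exp] cancels the denominator of [inc_kernel], and
    [Cexp (Cexp L)] cancels the constant part [e^(-S)] of its exponential. *)
Lemma log_kernel_CInt (b L : C) (y : R) :
  log_kernel b L y = (- Cexp (Cexp L) * CInt (fun v => Csin (warg b v * PI) / PI * inc_kernel (warg
    b v) L y) 0 1)%C.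
Proof.
assert (h : CInt (fun v => Csin (warg b v * PI) / PI * inc_kernel (warg b v) L y)%C 0 1 =
  (Cexp (- (Cexp L * (1 + exp y)%R)) * (/ (1 + exp y))%R *
   CInt (fun v => Csin (warg b v * PI) / PI * Cexp (warg b v * y)) 0 1)%C).
{ apply is_CInt_unique.
  apply (is_RInt_ext (V := C_R_NormedModule) (fun v => (Cexp (- (Cexp L * (1 + exp y)%R)) * (/ (1 +
    exp y))%R) *
    (Csin (warg b v * PI) / PI * Cexp (warg b v * y)))%C).
  - intros v _. unfold inc_kernel. match goal with |- ?x = ?y => change (@eq C x y) end. ring.
  - apply is_CInt_scal, is_CInt_continuous. intros v. unfold warg, Csin, Cdiv. solve_continuous. }
rewrite h, CInt_sin_exp. unfold log_kernel, kernel, Cpower. rewrite ln_exp.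
rewrite RtoC_inv by apply one_plus_exp_neq_0.
pose proof (RtoC_neq_0 _ (one_plus_exp_neq_0 y)) as h1.
replace (PI ^ 2 + y ^ 2)%C with (RtoC (PI * PI + y * y)) by (rewrite RtoC_plus, !RtoC_mult;
  unfold Cpow; ring).
replace (- (Cexp L * (1 + exp y)%R))%C with (- Cexp L + - Cexp L * exp y)%C by (rewrite RtoC_plus;
  ring).
replace ((1 - b) * y)%C with (y + - (b * y))%C by ring.
rewrite !Cexp_plus, !Cexp_opp, Cexp_RtoC.
pose proof (Cexp_neq_0 (b * y)). pose proof (Cexp_neq_0 (Cexp L)).
  pose proof (PI2_plus_sqr_neq_0 y) as h2.
assert (RtoC PI <> 0%C) by apply RtoC_neq_0, PI_neq0.
rewrite RtoC_plus in h1, h2. rewrite !RtoC_plus. field. repeat split; assumption.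
Qed.

Lemma sin_inc_kernel_cont2 (b L : C) : continuous2 (fun y v => Csin (warg b v * PI) / PI *
  inc_kernel (warg b v) L y)%C.
Proof. intros y v. unfold warg, Csin, Cdiv, inc_kernel. solve_continuous. apply one_plus_exp_neq_0.
  Qed.

Lemma log_kernel_continuous (b L : C) : everywhere_continuous (log_kernel b L).
Proof.
intros y.
apply (continuous_ext (U := C_UniformSpace) (fun y => - Cexp (Cexp L) * CInt (fun v => Csin (warg b
  v * PI) / PI * inc_kernel (warg b v) L y) 0 1)%C).
- intros t. symmetry. apply log_kernel_CInt.
- apply continuous_Cmult; [solve_continuous |].
  apply (continuous_CInt_param (fun v y => Csin (warg b v * PI) / PI * inc_kernel (warg b v) L
    y)%C).
  exact (continuous2_swap _ (sin_inc_kernel_cont2 b L)).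
Qed.

Lemma CInt_log_kernel (b L : C) (a c : R) : a <= c ->
  CInt (log_kernel b L) a c =
  (- Cexp (Cexp L) * CInt (fun v => Csin (warg b v * PI) / PI * CInt (inc_kernel (warg b v) L) a c)
    0 1)%C.
Proof.
intros hac.
rewrite (CInt_ext _ _ _ _ (fun y _ => log_kernel_CInt b L y)).
rewrite (is_CInt_unique _ _ _ _ (is_CInt_scal (- Cexp (Cexp L)) _ a c _ (is_CInt_continuous _ a c
  (fun y => continuous_CInt_param (fun v y => Csin (warg b v * PI) / PI * inc_kernel (warg b v) L
    y)%C 0 1 y
     (continuous2_swap _ (sin_inc_kernel_cont2 b L)))))).
f_equal. etransitivity; [symmetry; exact (CInt_Fubini _ a c 0 1 (sin_inc_kernel_cont2 b L) hac) |].
apply CInt_ext. intros v _. apply is_CInt_unique, is_CInt_scal, is_CInt_continuous,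
  inc_kernel_continuous.
Qed.

(* Integration by parts: the factor [w] absorbs the divergence of the left tail as [Re w] tends
   to [0]. *)
Lemma inc_kernel_left_tail (w L : C) (Y : R) : 0 < Re w -> 0 < Re (Cexp L) -> 0 <= Y ->
  Cmod (w * (half_line_int (fun y => inc_kernel w L (- y)) - CInt (fun y => inc_kernel w L (- y)) 0
    Y))
  <= (Cmod (Cexp L) + 2) * exp (- Re w * Y).
Proof.
intros hw hL hY.
(* [r] gathers the derivatives of all factors but [e^(- w y)]. Its additional [e^(-y)] keeps it
   integrable uniformly as [Re w] tends to 0. *)
set (r := fun y : R => (inc_kernel w L (- y) * ((Cexp L + (/ (1 + exp (- y)))%R) * exp (- y)))%C).
assert (cr : everywhere_continuous r).
{ intros y. unfold r, inc_kernel. solve_continuous; apply one_plus_exp_neq_0. }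
assert (hq : forall y, 0 <= y -> Cmod (inc_kernel w L (- y)) <= 1 * exp (- Re w * y)).
{ intros y hy. pose proof (inc_kernel_bound_neg w L 0 y hL (Rle_refl 0) ) as h.
  rewrite Cplus_0_r, Rmult_0_r, exp_0 in h. exact h. }
assert (hr : forall y, 0 <= y -> Cmod (r y) <= (Cmod (Cexp L) + 1) * exp (- (Re w + 1) * y)).
{ intros y hy. unfold r. rewrite !Cmod_mult, (Cmod_R (exp _)), (Rabs_pos_eq (exp _))
  by (apply Rlt_le, exp_pos).
  replace (- (Re w + 1) * y) with (- Re w * y + - y) by ring. rewrite exp_plus.
  pose proof (hq y hy) as h1. rewrite Rmult_1_l in h1.
  assert (h2 : Cmod (Cexp L + (/ (1 + exp (- y)))%R) <= Cmod (Cexp L) + 1).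
  { eapply Rle_trans; [apply Cmod_triangle |]. rewrite Cmod_R. pose proof (exp_pos (- y)).
    rewrite Rabs_pos_eq by (apply Rlt_le, Rinv_0_lt_compat; lra).
    apply Rplus_le_compat_l. rewrite <- Rinv_1. apply Rinv_le_contravar; lra. }
  replace ((Cmod (Cexp L) + 1) * (exp (- Re w * y) * exp (- y)))
    with (exp (- Re w * y) * ((Cmod (Cexp L) + 1) * exp (- y))) by ring.
  pose proof (exp_pos (- y)).
  apply Rmult_le_compat; try apply Cmod_ge_0; try assumption.
  - apply Rmult_le_pos; [apply Cmod_ge_0 | lra].
  - apply Rmult_le_compat_r; [lra | exact h2]. }
assert (dq : forall y, is_Cderive (fun y => - inc_kernel w L (- y))%C y (w * inc_kernel w L (- y) -
  r y)%C).
{ intros y. unfold inc_kernel, r, inc_kernel.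
  assert (hd : is_derive (fun y => / (1 + exp (- y))) y (exp (- y) * / (1 + exp (- y)) * / (1 + exp
    (- y)))).
  { pose proof (exp_pos (- y)). auto_derive; [lra |]. field. lra. }
  assert (hd2 : is_derive (fun y => 1 + exp (- y)) y (- exp (- y))).
  { auto_derive; [exact I |]. ring. }
  eapply is_Cderive_eq.
  - solve_Cderive. reflexivity.
  - cbv beta. rewrite !RtoC_mult, !RtoC_opp. ring. }
assert (cw : everywhere_continuous (fun y => w * inc_kernel w L (- y))%C).
{ intros y. apply continuous_Cmult; [solve_continuous | apply inc_kernel_opp_continuous]. }
assert (hI : is_half_line_int (fun y => inc_kernel w L (- y)) (half_line_int (fun y => inc_kernel w
  L (- y)))).
{ apply (is_half_line_int_ex _ 1 (Re w)); [apply inc_kernel_opp_continuous | exact hw | exact hq]. }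
assert (hR : is_half_line_int r (half_line_int r)).
{ apply (is_half_line_int_ex _ (Cmod (Cexp L) + 1) (Re w + 1)); [exact cr | lra | exact hr]. }
assert (e1 : (w * half_line_int (fun y => inc_kernel w L (- y)) - half_line_int r = - (- inc_kernel
  w L (- 0)))%C).
{ apply (is_half_line_int_unique (fun y => w * inc_kernel w L (- y) - r y)%C).
  - intros y. apply continuous_Cminus; [apply cw | apply cr].
  - apply is_half_line_int_minus; [exact cw | exact cr | | exact hR].
    apply is_half_line_int_scal; [apply inc_kernel_opp_continuous | exact hI].
  - apply (is_half_line_int_derive (fun y => - inc_kernel w L (- y))%C _ 1 (Re w) hw).
    + intros y. apply continuous_Cminus; [apply cw | apply cr].
    + intros y _. apply dq.
    + intros y hy. rewrite Cmod_opp. now apply hq. }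
assert (e2 : (w * CInt (fun y => inc_kernel w L (- y)) 0 Y - CInt r 0 Y = - inc_kernel w L (- Y) -
  - inc_kernel w L (- 0))%C).
{ transitivity (CInt (fun y => w * inc_kernel w L (- y) - r y)%C 0 Y).
  - symmetry. apply is_CInt_unique. apply is_CInt_minus; [apply is_CInt_scal |];
    apply is_CInt_continuous;
      [apply inc_kernel_opp_continuous | exact cr].
  - apply is_CInt_unique. apply (is_CInt_derive (fun y => - inc_kernel w L (- y))%C); [exact dq |].
    intros y. apply continuous_Cminus; [apply cw | apply cr]. }
replace (w * (half_line_int (fun y => inc_kernel w L (- y)) - CInt (fun y => inc_kernel w L (- y))
  0 Y))%C
  with ((half_line_int r - CInt r 0 Y) + inc_kernel w L (- Y))%C.
2:{ replace (w * (half_line_int (fun y => inc_kernel w L (- y)) - CInt (fun y => inc_kernel w L (-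
  y)) 0 Y))%C with
     ((w * half_line_int (fun y => inc_kernel w L (- y)) - half_line_int r) - (w * CInt (fun y =>
       inc_kernel w L (- y)) 0 Y - CInt r 0 Y)
      + (half_line_int r - CInt r 0 Y))%C by ring.
    rewrite e1, e2. ring. }
eapply Rle_trans; [apply Cmod_triangle |].
pose proof (half_line_int_tail r _ (Re w + 1) Y cr ltac:(lra) hr hY) as h1.
pose proof (hq Y hY) as h2.
pose proof (Cmod_ge_0 (Cexp L)). pose proof (exp_pos (- Re w * Y)).
assert (h3 : (Cmod (Cexp L) + 1) / (Re w + 1) * exp (- (Re w + 1) * Y) <= (Cmod (Cexp L) + 1) * exp
  (- Re w * Y)).
{ apply Rmult_le_compat.
  - apply Rle_mult_inv_pos; lra.
  - apply Rlt_le, exp_pos.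
  - apply Rmult_le_reg_r with (Re w + 1); [lra |]. unfold Rdiv. rewrite Rmult_assoc, Rinv_l by lra.
    nra.
  - apply exp_mono. nra. }
lra.
Qed.

Lemma inc_kernel_right_tail (w L : C) (p Y : R) : Re w <= p -> 0 < Re (Cexp L) -> 0 <= Y ->
  Cmod (half_line_int (inc_kernel w L) - CInt (inc_kernel w L) 0 Y) <= exp ((p + 1) * (p + 1) / Re
    (Cexp L)) * exp (- (1) * Y).
Proof.
intros hp hL hY.
replace (exp ((p + 1) * (p + 1) / Re (Cexp L))) with (exp ((p + 1) * (p + 1) / Re (Cexp L)) / 1)
  by field.
apply half_line_int_tail; [apply inc_kernel_continuous | lra | | exact hY].
intros y hy. pose proof (inc_kernel_bound_pos w L 0 y p hp hL (Rle_refl 0) hy) as h.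
rewrite Cplus_0_r, Rmult_0_r, exp_0, Rmult_1_l in h. exact h.
Qed.

Lemma inc_kernel_split (w L : C) : 0 < Re w -> 0 < Re (Cexp L) ->
  half_line_int (fun y => inc_kernel w L y + inc_kernel w L (- y))%C = (half_line_int (inc_kernel w
    L) + half_line_int (fun y => inc_kernel w L (- y)))%C.
Proof.
intros hw hL. apply half_line_int_unique; [apply inc_kernel_sym_continuous |].
apply is_half_line_int_plus; [apply inc_kernel_continuous | apply inc_kernel_opp_continuous | |].
- apply (is_half_line_int_ex _ (exp ((Re w + 1) * (Re w + 1) / Re (Cexp L))) 1);
  [apply inc_kernel_continuous | lra |].
  intros y hy. pose proof (inc_kernel_bound_pos w L 0 y (Re w) (Rle_refl _) hL (Rle_refl 0) hy) as
    h.
  rewrite Cplus_0_r, Rmult_0_r, exp_0, Rmult_1_l in h. exact h.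
- apply (is_half_line_int_ex _ 1 (Re w)); [apply inc_kernel_opp_continuous | exact hw |].
  intros y hy. pose proof (inc_kernel_bound_neg w L 0 y hL (Rle_refl 0)) as h.
  rewrite Cplus_0_r, Rmult_0_r, exp_0 in h. exact h.
Qed.

(** Averaging [e^((1 - v) a)] over [v] gains a factor [1 / - a], which makes the left tail vanish
    even for [Re b = 1]. *)
Lemma is_RInt_kernel_bound (A B a : R) : a < 0 ->
  is_RInt (fun v => A + B * exp ((1 - v) * a)) 0 1 (A + B * ((1 - exp a) / - a)).
Proof.
intros ha.
replace (A + B * ((1 - exp a) / - a)) with
  ((A * 1 - B / a * exp ((1 - 1) * a)) - (A * 0 - B / a * exp ((1 - 0) * a))).
- apply (is_RInt_derive (V := R_CompleteNormedModule) (fun v => A * v - B / a * exp ((1 - v) * a))).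
  + intros v _. auto_derive; [exact I |].
    fold (1 - v). field. lra.
  + intros v _. solve_continuous.
- replace ((1 - 1) * a) with 0 by ring. replace ((1 - 0) * a) with a by ring. rewrite exp_0. field.
  lra.
Qed.

(** On [[a, c]] the error is bounded for each [v] by the two tails, then integrated in [v]: the
    right tail gives [O(e^(-c))], the left one only [O(1 / |a|)], because its rate [Re w] may fall
    to 0 at [v = 1]. *)
Lemma CInt_log_kernel_limit (b L : C) : Re b <= 1 -> - PI / 2 < Im L < PI / 2 ->
  filterlim (fun ab => CInt (log_kernel b L) (fst ab) (snd ab)) mp_infty
    (Clocally (- Cexp (Cexp L) * CInt (fun v : R => Qreg L (b - 1 + v)) 0 1)%C).
Proof.
intros hb hIm.
assert (hL : 0 < Re (Cexp L)) by now apply Re_Cexp_pos.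
(* [W] bounds [|2 - b - v|] for [0 <= v <= 1], and [M] is the exponential factor of [Cmod_Csin] at
   modulus [W * PI]. *)
set (W := 3 + Cmod b). set (M := exp (3 * (W * PI))).
set (p := 2 - Re b). set (K1 := exp ((p + 1) * (p + 1) / Re (Cexp L))).
set (K2 := Cmod (Cexp L) + 2).
pose proof (Cmod_ge_0 b). pose proof PI_RGT_0 as hpi. pose proof (Cmod_ge_0 (Cexp L)).
assert (hM : 0 < M) by apply exp_pos. assert (hK1 : 0 < K1) by apply exp_pos.
assert (hW : forall v, 0 <= v <= 1 -> Cmod (warg b v) <= W).
{ intros v hv. unfold warg, W, Cminus. eapply Rle_trans; [apply Cmod_triangle |].
  eapply Rle_trans; [apply Rplus_le_compat_r, Cmod_triangle |].
  rewrite !Cmod_opp, !Cmod_R, !Rabs_pos_eq; lra. }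
assert (hsin : forall v, 0 <= v <= 1 -> Cmod (Csin (warg b v * PI) / PI) <= Cmod (warg b v) * M).
{ intros v hv. specialize (hW v hv).
  assert (hpc : RtoC PI <> 0%C) by (apply RtoC_neq_0, PI_neq0).
  unfold Cdiv. rewrite Cmod_mult, Cmod_inv, (Cmod_R PI), Rabs_pos_eq by (assumption || lra).
  apply Rmult_le_reg_r with PI; [exact hpi |]. rewrite Rmult_assoc, Rinv_l, Rmult_1_r by lra.
  eapply Rle_trans; [apply Cmod_Csin |]. rewrite Cmod_mult, Cmod_R, Rabs_pos_eq by lra.
  replace (Cmod (warg b v) * M * PI) with (Cmod (warg b v) * PI * M) by ring.
  pose proof (Cmod_ge_0 (warg b v)).
  apply Rmult_le_compat_l; [apply Rmult_le_pos; lra |]. unfold M. apply exp_mono.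
  apply Rmult_le_compat_l; [lra |]. apply Rmult_le_compat_r; lra. }
assert (cQ : everywhere_continuous (fun v : R => Qreg L (b - 1 + v))) by now apply Qreg_continuous.
assert (est : forall a c, a < 0 -> 0 <= c ->
  Cmod (CInt (fun v => Csin (warg b v * PI) / PI * CInt (inc_kernel (warg b v) L) a c)%C 0 1
    - CInt (fun v : R => Qreg L (b - 1 + v)) 0 1)
  <= W * M * K1 * exp (- (1) * c) + M * K2 * / - a).
{ intros a c ha hc.
  set (Dv := fun v : R => (Csin (warg b v * PI) / PI * CInt (inc_kernel (warg b v) L) a c - Qreg L
    (b - 1 + v))%C).
  assert (cI : everywhere_continuous (fun v => Csin (warg b v * PI) / PI * CInt (inc_kernel (warg b
    v) L) a c)%C).
  { intros v. apply continuous_Cmult; [unfold warg, Csin, Cdiv; solve_continuous |].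
    apply (continuous_CInt_param (fun y v => inc_kernel (warg b v) L y)).
    apply (inc_kernel_cont2 (fun y v => warg b v) (fun _ _ => L)); intros y t; [unfold warg |];
      solve_continuous. }
  (* At [v = 1] the real part of [w] may be 0, outside the reach of [Csin_Qreg]. Overwriting that
     endpoint value leaves the integral unchanged. *)
  assert (hD : is_CInt (fun v => if Rlt_dec v 1 then Dv v else RtoC 0) 0 1
    (CInt (fun v => Csin (warg b v * PI) / PI * CInt (inc_kernel (warg b v) L) a c)%C 0 1
    - CInt (fun v : R => Qreg L (b - 1 + v)) 0 1)%C).
  { apply (is_RInt_ext (V := C_R_NormedModule) Dv).
    - rewrite Rmin_left, Rmax_right by lra. intros v hv. destruct (Rlt_dec v 1); [reflexivity |
      lra].
    - apply is_CInt_minus; now apply is_CInt_continuous. }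
  eapply Rle_trans.
  - apply (Cmod_CInt_le _ (fun v => W * M * K1 * exp (- (1) * c) + M * K2 * exp ((1 - v) * a)) 0 1
    _ _
      ltac:(lra)) with (2 := hD); [| apply is_RInt_kernel_bound, ha].
    intros v hv.
    assert (hpos1 : 0 <= W * M * K1 * exp (- (1) * c)).
    { pose proof (exp_pos (- (1) * c)). unfold W. repeat apply Rmult_le_pos; lra. }
    assert (hpos2 : 0 <= M * K2 * exp ((1 - v) * a)).
    { pose proof (exp_pos ((1 - v) * a)). unfold K2. repeat apply Rmult_le_pos; lra. }
    destruct (Rlt_dec v 1) as [hv1 | hv1].
    2:{ rewrite Cmod_0. lra. }
    unfold Dv.
    assert (hw : 0 < Re (warg b v)) by (unfold warg; simpl_Re_Im; lra).
    assert (hwp : Re (warg b v) <= p) by (unfold warg, p; simpl_Re_Im; lra).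
    replace (b - 1 + v)%C with (1 - warg b v)%C by (unfold warg; ring).
    rewrite <- Csin_Qreg, inc_kernel_split by assumption.
    rewrite <- (CInt_Chasles (inc_kernel (warg b v) L) a 0 c) by apply inc_kernel_continuous.
    rewrite (CInt_opp (inc_kernel (warg b v) L) a) by apply inc_kernel_continuous.
    set (w := warg b v) in *. set (sn := (Csin (w * PI) / PI)%C).
    pose proof (inc_kernel_right_tail w L p c hwp hL hc) as t1.
    pose proof (inc_kernel_left_tail w L (- a) hw hL ltac:(lra)) as t2.
    set (X1 := (half_line_int (inc_kernel w L) - CInt (inc_kernel w L) 0 c)%C) in *.
    set (X2 := (half_line_int (fun y => inc_kernel w L (- y)) - CInt (fun y => inc_kernel w L (-
      y)) 0 (- a))%C) in *.
    replace (sn * (CInt (fun y => inc_kernel w L (- y)) 0 (- a) + CInt (inc_kernel w L) 0 c) -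
      sn * (half_line_int (inc_kernel w L) + half_line_int (fun y => inc_kernel w L (- y))))%C
        with (- (sn * X1) + - (sn * X2))%C
      by (unfold X1, X2; ring).
    eapply Rle_trans; [apply Cmod_triangle |]. rewrite !Cmod_opp, !Cmod_mult.
    pose proof (hsin v hv) as hs. pose proof (hW v hv) as hWv. fold w in hs, hWv. fold sn in hs.
    pose proof (Cmod_ge_0 X1). pose proof (Cmod_ge_0 X2). pose proof (Cmod_ge_0 w).
      pose proof (Cmod_ge_0 sn).
    apply Rplus_le_compat.
    + replace (W * M * K1 * exp (- (1) * c)) with (W * M * (K1 * exp (- (1) * c))) by ring.
      apply Rmult_le_compat; try assumption.
      eapply Rle_trans; [exact hs |]. apply Rmult_le_compat_r; lra.
    + rewrite Cmod_mult in t2.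
      apply Rle_trans with (M * (Cmod w * Cmod X2)).
      * replace (M * (Cmod w * Cmod X2)) with (Cmod w * M * Cmod X2) by ring.
        apply Rmult_le_compat_r; assumption.
      * rewrite Rmult_assoc. apply Rmult_le_compat_l; [lra |]. eapply Rle_trans; [exact t2 |].
        unfold K2. apply Rmult_le_compat_l; [lra |]. apply exp_mono.
        unfold w, warg. simpl_Re_Im. nra.
  - apply Rplus_le_compat_l. apply Rmult_le_compat_l; [unfold K2; apply Rmult_le_pos; lra |].
    unfold Rdiv. rewrite <- (Rmult_1_l (/ - a)) at 2.
    apply Rmult_le_compat_r; [apply Rlt_le, Rinv_0_lt_compat; lra |]. pose proof (exp_pos a). lra. }
apply (proj2 (filterlim_C mp_infty _ _)). intros eps hp.
set (ES := Cmod (Cexp (Cexp L))). assert (hES : 0 < ES) by (unfold ES; rewrite Cmod_Cexp;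
  apply exp_pos).
assert (hp' : 0 < eps / (2 * ES)) by (apply Rdiv_lt_0_compat; lra).
destruct (exp_tail_small (W * M * K1) 1 _ Rlt_0_1 hp') as [N [hN HN]].
(* For [a < - A] the left error is below [eps / (2 ES)]; each end takes half of [eps], after
   division by the modulus [ES] of the prefactor. *)
set (A := M * K2 / (eps / (2 * ES))).
assert (hK2 : 0 < K2) by (unfold K2; lra).
assert (hA : 0 < A) by (apply Rdiv_lt_0_compat; [apply Rmult_lt_0_compat |]; lra).
apply Filter_prod with (Q := fun a => a < - A) (R := fun c => N <= c).
- now exists (- A).
- apply p_infty_ge.
- intros a c ha hc. cbn [fst snd]. rewrite CInt_log_kernel by lra.
  set (I1 := CInt (fun v => Csin (warg b v * PI) / PI * CInt (inc_kernel (warg b v) L) a c)%C 0 1).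
  set (I0 := CInt (fun v : R => Qreg L (b - 1 + v)) 0 1).
  replace (- Cexp (Cexp L) * I1 - - Cexp (Cexp L) * I0)%C with (- (Cexp (Cexp L) * (I1 - I0)))%C
    by ring.
  rewrite Cmod_opp, Cmod_mult. fold ES.
  pose proof (est a c ltac:(lra) ltac:(lra)) as h1. fold I1 I0 in h1.
  pose proof (HN c hc) as h2.
  assert (h3 : M * K2 * / - a < eps / (2 * ES)).
  { apply Rmult_lt_reg_r with (- a); [lra |]. rewrite Rmult_assoc, Rinv_l, Rmult_1_r by lra.
    apply Rle_lt_trans with (eps / (2 * ES) * A); [right; unfold A; field; lra |].
    apply Rmult_lt_compat_l; lra. }
  apply Rle_lt_trans with (ES * (W * M * K1 * exp (- (1) * c) + M * K2 * / - a)).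
  + apply Rmult_le_compat_l; lra.
  + apply Rlt_le_trans with (ES * (eps / (2 * ES) + eps / (2 * ES))); [apply Rmult_lt_compat_l;
    lra |].
    right. field. lra.
Qed.

(** * The two sides of the identity *)

Lemma is_RInt_gen_kernel (b L : C) : Re b <= 1 -> - PI / 2 < Im L < PI / 2 ->
  is_RInt_gen (V := C_R_NormedModule) (kernel b (Cexp L)) (at_right 0) (Rbar_locally p_infty)
    (- Cexp (Cexp L) * CInt (fun v : R => Qreg L (b - 1 + v)) 0 1)%C.
Proof.
intros hb hIm. apply (is_RInt_gen_log (log_kernel b L)).
- apply log_kernel_continuous.
- intros t ht. unfold log_kernel. rewrite exp_ln by exact ht.
  assert (RtoC t <> 0%C) by (apply RtoC_neq_0; lra). field. assumption.
- now apply CInt_log_kernel_limit.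
Qed.

Theorem mainTheorem20 (a : R) (b z logz : C)
    (ha : 0 < a) (hb : Re b <= 1)
    (hlog : is_log z logz)
    (hz : 0 < Re (Cpower logz (1 / a)))
    (hbranch : - PI <= Im logz / a <= PI) :
  ex_CInt_gen (fun u => (Cpower logz u * rGamma (b + a * u))%C)
    (at_point 0) (Rbar_locally p_infty) /\
  ex_CInt_gen (kernel b (Cpower logz (1 / a)))
    (at_right 0) (Rbar_locally p_infty) /\
  CInt_gen (fun u => (Cpower logz u * rGamma (b + a * u))%C)
    (at_point 0) (Rbar_locally p_infty)
  = (Cpower logz ((1 - b) / a) / a
     * (Cexp (Cpower logz (1 / a))
        + CInt_gen (kernel b (Cpower logz (1 / a)))
            (at_right 0) (Rbar_locally p_infty)))%C.
Proof.
set (L := (logz / a)%C).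
assert (hac : RtoC a <> 0%C) by (apply RtoC_neq_0; lra).
assert (hlz : logz = (a * L)%C) by (unfold L; field; exact hac).
assert (hS : Cpower logz (1 / a) = Cexp L).
{ unfold Cpower, L. f_equal. field. exact hac. }
rewrite hS in *.
assert (hImL : Im L = Im logz / a).
{ rewrite hlz. rewrite Im_mult, Re_RtoC, Im_RtoC. field. lra. }
rewrite <- hImL in hbranch.
(* The real part of [e^L] has the sign of [cos (Im L)], and on [[- PI, PI]] the cosine is positive
   only strictly between [- PI / 2] and [PI / 2]. *)
assert (hIm : - PI / 2 < Im L < PI / 2).
{ rewrite Re_Cexp in hz. pose proof (exp_pos (Re L)) as he. pose proof PI_RGT_0.
  assert (hc : 0 < cos (Im L)) by nra.
  destruct (Rle_dec (PI / 2) (Im L)) as [h1 | h1].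
  { pose proof (cos_le_0 (Im L) h1 ltac:(lra)). lra. }
  destruct (Rle_dec (Im L) (- (PI / 2))) as [h2 | h2].
  { pose proof (cos_le_0 (- Im L) ltac:(lra) ltac:(lra)) as h3. rewrite cos_neg in h3. lra. }
  lra. }
set (I0 := CInt (fun v : R => Qreg L (b - 1 + v)) 0 1).
pose proof (is_RInt_gen_kernel b L hb hIm) as hker. fold I0 in hker.
pose proof (is_half_line_int_power_rGamma L b hIm) as hpow. fold I0 in hpow.
set (g0 := fun v : R => (Cexp ((b + v - 1) * L) * rGamma (b + v))%C) in *.
set (f := fun u : R => (Cpower logz u * rGamma (b + a * u))%C).
assert (cg0 : everywhere_continuous g0).
{ intros v. unfold g0. apply continuous_Cmult; [solve_continuous | apply rGamma_continuous]. }
(* The factor [a] in front of [g0] is the Jacobian of [v = a u]; the constant split off is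
   [z^((1 - b) / a) / a]. *)
assert (hf : forall u, f u = (Cexp ((1 - b) * L) / a * (a * g0 (a * u)%R))%C).
{ intros u. unfold f, g0, Cpower. rewrite hlz, RtoC_mult.
  replace (u * (a * L))%C with ((1 - b) * L + (b + a * u - 1) * L)%C by ring.
  rewrite Cexp_plus. field. exact hac. }
assert (cf : everywhere_continuous f).
{ intros u. apply (continuous_ext (U := C_UniformSpace) (fun u => Cexp ((1 - b) * L) / a * (a * g0
  (a * u)%R))%C).
  - intros t. symmetry. apply hf.
  - apply continuous_Cmult; [solve_continuous |]. apply continuous_Cmult; [solve_continuous |].
    apply (continuous_comp (fun u => a * u) g0); [solve_continuous | apply cg0]. }
assert (hint : is_half_line_int f (Cexp ((1 - b) * L) / a * (Cexp (Cexp L) * (1 - I0)))%C).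
{ apply (is_half_line_int_ext (fun u => Cexp ((1 - b) * L) / a * (a * g0 (a * u)%R))%C); [intros;
  symmetry; apply hf |].
  assert (cg1 : everywhere_continuous (fun u => a * g0 (a * u)%R)%C).
  { intros u. apply continuous_Cmult; [solve_continuous |].
    apply (continuous_comp (fun u => a * u) g0); [solve_continuous | apply cg0]. }
  apply is_half_line_int_scal; [exact cg1 |]. unfold is_half_line_int.
  apply (filterlim_ext (fun T => CInt g0 0 (a * T))).
  - intros T. symmetry. apply is_CInt_unique.
    assert (h : is_CInt g0 (a * 0 + 0) (a * T + 0) (CInt g0 0 (a * T))).
    { replace (a * 0 + 0) with 0 by ring. rewrite Rplus_0_r. now apply is_CInt_continuous. }
    apply (is_RInt_comp_lin (V := C_R_NormedModule)) in h. revert h.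
    apply (is_RInt_ext (V := C_R_NormedModule)). intros u _. rewrite Rplus_0_r. apply scal_R_Cmult.
  - apply (filterlim_comp _ _ _ (fun T => a * T) (fun Y => CInt g0 0 Y) _ (Rbar_locally p_infty));
    [| exact hpow].
    intros P [N hN]. exists (N / a). intros T hT. apply hN.
    apply Rmult_lt_reg_r with (/ a); [now apply Rinv_0_lt_compat |].
    replace (a * T * / a) with T by (field; lra). exact hT. }
assert (hgen := is_half_line_int_is_RInt_gen f _ cf hint).
split; [eexists; exact hgen | split; [eexists; exact hker |]].
transitivity (Cexp ((1 - b) * L) / a * (Cexp (Cexp L) * (1 - I0)))%C.
- apply (is_RInt_gen_unique (V := C_R_CompleteNormedModule)). exact hgen.
- replace (CInt_gen (kernel b (Cexp L)) (at_right 0) (Rbar_locally p_infty))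
  with (- Cexp (Cexp L) * I0)%C.
  + unfold Cpower. replace ((1 - b) / a * logz)%C with ((1 - b) * L)%C by (unfold L; field;
    exact hac). ring.
  + symmetry. apply (is_RInt_gen_unique (V := C_R_CompleteNormedModule)). exact hker.
Qed.
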